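(* Let $N$ be one of the simply-connected 3-dimensional spaceforms $\mathbb{R}^3$, $\mathbb{S}^3$, $\mathbb{H}^3$, let $\mathfrak g$ be the Lie algebra of Killing fields on $N$, and let $\Sigma\subset N$ be a connected, orientable, embedded smooth surface with unit normal $\boldsymbol\nu$ and mean curvature function $h$. For a real constant $H$, a smooth $1$-cycle $\Gamma$ in $\Sigma$, a smooth $2$-chain $K$ in $N$ with $\partial K=-\Gamma$, and $\mathbf Y\in\mathfrak g$, consider the quantity $$\oint_\Gamma \mathbf Y\cdot\boldsymbol\eta \;-\; H\iint_K \mathbf Y\cdot\boldsymbol\nu. \qquad ( * )$$ (i) If $\Sigma$ has constant mean curvature $H$ (i.e. $h\equiv H$), then $( * )$ depends only on the homology class $[\Gamma]\in H_1(\Sigma)$ and on $\mathbf Y$ (not on the representative $\Gamma$ nor on the choice of $K$), and $$\omega([\Gamma])(\mathbf Y)=\oint_\Gamma \mathbf Y\cdot\boldsymbol\eta - H\iint_K \mathbf Y\cdot\boldsymbol\nu$$ defines a linear function $\omega:H_1(\Sigma)\to\mathfrak g^*$. (ii) Conversely, suppose that for some real constant $H$ there is a homology class $c\in H_1(\Sigma)$ for which $\omega(c)$ is well-defined by this formula; that is, for each $\mathbf Y\in\mathfrak g$ the value of $( * )$ is the same for all smooth $1$-cycles $\Gamma$ in $\Sigma$ representing $c$ and all smooth $2$-chains $K$ in $N$ with $\partial K=-\Gamma$. Then $\Sigma$ has constant mean curvature.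
   Context: $N$ is oriented. $\mathrm D$ denotes covariant differentiation in $N$ and, for a vector field $\mathbf Y$ along $\Sigma$ and a local orthonormal tangent frame $(\mathbf f_1,\mathbf f_2)$ of $\Sigma$, $\mathrm{div}(\mathbf Y)=\mathrm D_{\mathbf f_1}\mathbf Y\cdot\mathbf f_1+\mathrm D_{\mathbf f_2}\mathbf Y\cdot\mathbf f_2$. The mean curvature (the trace, not the average, of the second fundamental form, with sign) is $h=\mathrm{div}(\boldsymbol\nu)$. $\Sigma$ is oriented so that an oriented tangent basis followed by $\boldsymbol\nu$ is positively oriented in $N$. For an oriented curve $\Gamma$ in $\Sigma$ with unit tangent $\mathbf t$, $\boldsymbol\eta$ is the unit conormal: the unit vector tangent to $\Sigma$, orthogonal to $\mathbf t$, such that $(\boldsymbol\eta,\mathbf t)$ is an oriented basis of the tangent plane of $\Sigma$ (so it is the outward conormal when $\Gamma$ is the oriented boundary of a region of $\Sigma$). For a $2$-chain $K$ in $N$, $\boldsymbol\nu$ also denotes the unit normal of $K$ determined in the same way by the orientation of $K$, so that $\iint_K\mathbf Y\cdot\boldsymbol\nu$ is the flux $\int_K\iota_{\mathbf Y}\,\mathrm{dvol}_N$; likewise $\oint_\Gamma\mathbf Y\cdot\boldsymbol\eta=\int_\Gamma\iota_{\mathbf Y^{\tan}}\,\mathrm dA_\Sigma$ where $\mathbf Y^{\tan}$ is the component of $\mathbf Y$ tangent to $\Sigma$. Both integrals extend linearly to chains. Homology is singular homology represented by smooth chains. *)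

(* Defs.v *)
From HB Require Import structures.
From mathcomp Require Import all_boot all_order all_algebra generic_quotient.
From mathcomp Require Import ring_quotient freeg ring.
From mathcomp Require Import all_classical all_reals all_analysis.
Import Order.TTheory GRing.Theory Num.Theory.
Import numFieldNormedType.Exports.

Set Implicit Arguments.
Unset Strict Implicit.
Unset Printing Implicit Defensive.

Local Open Scope classical_set_scope.
Local Open Scope ring_scope.

Section Smoothness.
Context {R : realType} {V W : normedModType R}.
Implicit Types (U S : set V) (f g F : V -> W) (x v : V).

Fixpoint Ck U (k : nat) f : Prop :=
  match k with
  | 0 => forall x, U x -> {for x, continuous f}
  | k'.+1 => (forall x, U x -> differentiable f x) /\
             (forall v, Ck U k' ('D_v f))
  end.

Definition smooth U f : Prop := forall k, Ck U k f.

(* Smoothness on an arbitrary subset [S]: [f] has, near every point of [S], a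
   smooth extension to an open subset of the ambient space.  Only the values
   of [f] on [S] matter. *)
Definition local_extension S f x : set (V -> W) :=
  [set F | exists U, [/\ open_nbhs x U, smooth U F &
     forall y, S y -> U y -> F y = f y]].

Definition smooth_on S f : Prop :=
  forall x, S x -> local_extension S f x !=set0.

(* The derivative at [x] of a function on [S], in a direction [v] tangent to
   [S]; it then does not depend on the chosen extension. *)
Definition derive_along S f x v : W :=
  'D_v (xget f (local_extension S f x)) x.

Lemma near_eq_differentiable f g x :
  (\near x, f x = g x) -> differentiable f x -> differentiable g x.
Proof.
move=> fg df; rewrite -[g](subrKC f).
apply: differentiableD => //.
have /= gf0 : \forall y \near x, (g - f) y = 0.
  by apply: filterS fg => y fgy; rewrite !fctE fgy subrr.
have e0 : (g - f) \o shift x = cst ((g - f) x) + (0 : V -> W) +o_ 0 id.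
  apply/eqaddoP => _/posnumP[eps].
  move: (gf0); rewrite (near_shift 0) => gf0'.
  apply: filterS gf0' => h; rewrite /= subr0 => e.
  rewrite addr0 [X in `|X|](_ : _ = 0) ?normr0; first exact: mulr_ge0.
  by rewrite -[LHS]/((g - f) (h + x) - (g - f) x) (nbhs_singleton gf0) e subr0.
apply/diff_locallyP.
have := @diff_unique _ _ _ _ (\0%R : {linear V -> W}) x _ e0.
by move=> -> //; [split => //; exact: cst_continuous | exact: cst_continuous].
Qed.

Lemma CkW U k f U' : U' `<=` U -> Ck U k f -> Ck U' k f.
Proof.
move=> UU'; elim: k f => [|k IH] f /=; first by move=> cf x /UU' /cf.
by move=> [df Df]; split=> [x /UU' /df//|v]; exact: IH.
Qed.

Lemma eq_Ck U k f g : open U -> (forall x, U x -> f x = g x) ->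
  Ck U k f -> Ck U k g.
Proof.
move=> oU; elim: k f g => [|k IH] f g fg /=.
  move=> cf x Ux; have nfg : \forall y \near x, f y = g y.
    by apply: filterS (open_nbhs_nbhs (conj oU Ux)) => y /fg.
  rewrite /prop_for /continuous_at -(fg x Ux).
  apply: cvg_trans (cf x Ux).
  exact: near_eq_cvg.
move=> [df Df]; split=> [x Ux|v].
  apply: near_eq_differentiable (df x Ux).
  by apply: filterS (open_nbhs_nbhs (conj oU Ux)) => y /fg.
apply: IH (Df v) => x Ux; apply: near_eq_derive.
by apply: filterS (open_nbhs_nbhs (conj oU Ux)) => y /fg.
Qed.

Lemma Ck_linear U k (a : R) f g : open U ->
  Ck U k f -> Ck U k g -> Ck U k (a *: f + g).
Proof.
move=> oU; elim: k f g => [|k IH] f g /=.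
  move=> cf cg x Ux; apply: continuousD; last exact: cg.
  by apply: continuousZr; exact: cf.
move=> [df Df] [dg Dg]; split=> [x Ux|v].
  by apply: differentiableD; [apply: differentiableZ; exact: df | exact: dg].
apply: eq_Ck oU _ (IH _ _ (Df v) (Dg v)) => x Ux.
rewrite deriveD; [|exact/derivableZ/diff_derivable/df|exact/diff_derivable/dg].
by rewrite deriveZ//; exact/diff_derivable/df.
Qed.

Lemma local_extension_linear S (a : R) f g F G x :
  local_extension S f x F -> local_extension S g x G ->
  local_extension S (a *: f + g) x (a *: F + G).
Proof.
move=> [U [[oU Ux] sF eF]] [U' [[oU' Ux'] sG eG]].
have oUU' : open (U `&` U') by exact: openI.
exists (U `&` U'); split=> [//|k|y Sy [Uy Uy']].
  by apply: Ck_linear => //; [apply: CkW (sF k)|apply: CkW (sG k)] => y [].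
by rewrite !fctE eF// eG.
Qed.

Lemma local_extension_differentiable S f F x :
  local_extension S f x F -> differentiable F x.
Proof. by move=> [U [[_ Ux] /(_ 1%N) [dF _] _]]; exact: dF. Qed.

(* A direction realized by a curve in [S] determines the derivative. *)
Lemma derive_alongE S f F (g : R -> V) x v :
  (\forall t \near (0 : R), S (g t)) -> g 0 = x -> is_derive (0 : R) 1 g v ->
  local_extension S f x F -> derive_along S f x v = 'D_v F x.
Proof.
move=> Sg g0 dg FE; rewrite /derive_along.
set G := xget f _.
have GE : local_extension S f x G by apply: xgetPex; exists F.
have dgg : differentiable g 0 by apply/derivable1_diffP; case: dg.
suff key H : local_extension S f x H -> 'D_v H x = 'D_1 (H \o g) 0.
  rewrite !key//; apply: near_eq_derive.
  have cg : {for (0 : R), continuous g} by exact: differentiable_continuous.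
  have [U [oUx sF eF]] := FE; have [U' [oUx' sG eG]] := GE.
  have nU : \forall t \near (0 : R), U (g t).
    by apply: cg; rewrite g0; exact: open_nbhs_nbhs.
  have nU' : \forall t \near (0 : R), U' (g t).
    by apply: cg; rewrite g0; exact: open_nbhs_nbhs.
  near=> t => /=; rewrite eF; [rewrite eG//| |]; near: t => //.
move=> /local_extension_differentiable dH.
rewrite -g0 in dH *.
rewrite [RHS]deriveE; last exact: differentiable_comp.
rewrite diff_comp// /= [LHS]deriveE//; congr ('d H _ _).
by rewrite -deriveE//; case: dg => _ ->.
Unshelve. all: by end_near. Qed.

End Smoothness.

Section SpaceForms.
Context {R : realType}.
Local Notation E := 'rV[R]_4.

Variant spaceform := Euclidean | Spherical | Hyperbolic.

(* The three space forms are hypersurfaces of a 4-dimensional vector space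
   with coordinates x_0, ..., x_3: the hyperplane x_0 = 0 and the unit sphere
   of Euclidean space, and the upper sheet of the hyperboloid <x,x> = -1 of
   Minkowski space. *)
Definition ip (M : spaceform) (u v : E) : R :=
  (if M is Hyperbolic then -1 else 1) * (u 0 0 * v 0 0) +
  \sum_(i < 4 | i != 0) u 0 i * v 0 i.

Definition model (M : spaceform) : set E :=
  match M with
  | Euclidean => [set x | x 0 0 = 0]
  | Spherical => [set x | ip Spherical x x = 1]
  | Hyperbolic => [set x | ip Hyperbolic x x = -1 /\ 0 < x 0 0]
  end.

(* Normal vector of [model M] in the ambient space, of square 1 or -1. *)
Definition ambient_normal (M : spaceform) (x : E) : E :=
  if M is Euclidean then delta_mx 0 0 else x.

Definition model_tangent (M : spaceform) (x : E) : set E :=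
  [set v | ip M (ambient_normal M x) v = 0].

Definition tangent_proj (M : spaceform) (x v : E) : E :=
  let n := ambient_normal M x in v - (ip M n v / ip M n n) *: n.

(* Riemannian volume form of [model M], for either orientation [o]. *)
Definition vol (M : spaceform) (o : bool) (x u v w : E) : R :=
  (-1) ^+ o * \det (\matrix_(i < 4) [:: ambient_normal M x; u; v; w]`_i).

(* Covariant derivative in [model M] of a vector field [F] along a submanifold
   [S] of [model M], in a direction [v] tangent to [S]. *)
Definition covariant_derivative (M : spaceform) (S : set E) (F : E -> E)
    (x v : E) : E :=
  tangent_proj M x (derive_along S F x v).

Definition killing (M : spaceform) : {pred (model M -> E)} := fun Y =>
  let Z := 'valL_0 Y in let D := covariant_derivative M (model M) Z in
  `[< [/\ smooth_on (model M) Z,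
       forall x, model M x -> model_tangent M x (Z x) &
       forall x u v, model M x -> model_tangent M x u ->
         model_tangent M x v -> ip M (D x u) v + ip M u (D x v) = 0] >].

Arguments killing : clear implicits.

Lemma ip_linearl M (a : R) u v w :
  ip M (a *: u + v) w = a * ip M u w + ip M v w.
Proof.
rewrite /ip !mxE; under eq_bigr do rewrite !mxE mulrDl -mulrA.
by rewrite big_split /= -mulr_sumr; ring.
Qed.

Lemma ipZl M (a : R) u w : ip M (a *: u) w = a * ip M u w.
Proof.
rewrite /ip !mxE; under eq_bigr do rewrite !mxE -mulrA.
by rewrite -mulr_sumr; ring.
Qed.

Lemma ipC M u v : ip M u v = ip M v u.
Proof.
by rewrite /ip (mulrC (u 0 0)); under eq_bigr do rewrite mulrC.
Qed.

Lemma ip_linearr M (a : R) u v w :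
  ip M w (a *: u + v) = a * ip M w u + ip M w v.
Proof. by rewrite ipC ip_linearl !(ipC M w). Qed.

Lemma tangent_proj_linear M x (a : R) u v :
  tangent_proj M x (a *: u + v) = a *: tangent_proj M x u + tangent_proj M x v.
Proof.
rewrite /tangent_proj ip_linearr mulrDl scalerDl scalerBr scalerA mulrA.
by rewrite opprD addrACA.
Qed.

(* Stereographic parametrization of the geodesic leaving [x] along [v]. *)
Lemma model_curve M x v : model M x -> model_tangent M x v ->
  exists g : R -> E, [/\ \forall t \near (0 : R), model M (g t), g 0 = x &
    is_derive (0 : R) 1 g v].
Proof.
move=> Mx Tv.
pose k : R :=
  match M with Euclidean => 0 | Spherical => 1 | Hyperbolic => -1 end.
pose q := k * ip M v v / 4.
pose c (t : R) := (1 + q * t ^+ 2)^-1.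
pose b (t : R) := t * c t.
pose a (t : R) := (1 - q * t ^+ 2) * c t.
have dp s : is_derive (0 : R) 1 (fun t : R => 1 + s * t ^+ 2) 0.
  rewrite (_ : (fun t : R => _) = cst 1 + s \*: (id ^+ 2)); last first.
    by apply/funext => t; rewrite !fctE.
  by apply: is_derive_eq; rewrite /= expr1 mulr0 scale0r scaler0 addr0.
have p0 : 1 + q * 0 ^+ 2 != 0 :> R by rewrite expr0n mulr0 addr0 oner_neq0.
have c0 : c 0 = 1 by rewrite /c expr0n mulr0 addr0 invr1.
have dc : is_derive (0 : R) 1 c 0.
  have := dp q => -[dq dq0].
  by apply: DeriveDef; [exact: derivableV|rewrite deriveV// dq0 scaler0].
have db : is_derive (0 : R) 1 b 1.
  rewrite (_ : b = id * c)//; apply: is_derive_eq.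
  by rewrite c0 scaler0 add0r scale1r.
have da : is_derive (0 : R) 1 a 0.
  rewrite (_ : a = (fun t => 1 + (- q) * t ^+ 2) * c); last first.
    by apply/funext => t; rewrite /a fctE mulNr.
  by apply: is_derive_eq; rewrite !scaler0 addr0.
have dZ (f : R -> R) l (w : E) :
    is_derive (0 : R) 1 f l -> is_derive (0 : R) 1 (fun t => f t *: w) (l *: w).
  move=> -[df <-].
  have df' : differentiable f 0 by exact/derivable1_diffP.
  have dfw : differentiable (fun t => f t *: w) 0 by exact: differentiableZl.
  apply: DeriveDef; first exact/derivable1_diffP.
  by rewrite !deriveE// diffZl.
have cont (f : R -> R) l : is_derive (0 : R) 1 f l -> 0 < f 0 ->
    \forall t \near (0 : R), 0 < f t.
  move=> [/derivable1_diffP/differentiable_continuous df _] f0.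
  exact: (@cvgr_gt R _ _ _ f (f 0) df 0 f0).
exists (fun t => a t *: x + b t *: v); split.
- have np : \forall t \near (0 : R), 0 < 1 + q * t ^+ 2.
    by apply: cont (dp q) _; rewrite expr0n mulr0 addr0.
  have nx0 : 0 < x 0 0 ->
      \forall t \near (0 : R), 0 < (a t *: x + b t *: v) 0 0.
    move=> x0; apply: (cont (fun t => (a t *: x + b t *: v) 0 0)).
      rewrite (_ : (fun t => _) = (x 0 0 \*: a) + (v 0 0 \*: b)).
        exact: is_deriveD.
      by apply/funext => t; rewrite !mxE !fctE mulrC (mulrC (b t)).
    rewrite /a /b c0 expr0n !mulr0 subr0 mul0r scale0r addr0 mul1r.
    by rewrite scale1r.
  have ipg t : ip M (a t *: x + b t *: v) (a t *: x + b t *: v) =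
      a t ^+ 2 * ip M x x + 2 * a t * b t * ip M x v + b t ^+ 2 * ip M v v.
    rewrite ip_linearl ipZl !(ipC M _ (_ + _)) !ip_linearl !ipZl.
    by rewrite (ipC M v x); ring.
  have ac t : a t = (1 - q * t ^+ 2) * c t by [].
  have bc t : b t = t * c t by [].
  have ct t : 0 < 1 + q * t ^+ 2 -> (1 + q * t ^+ 2) * c t = 1.
    by move=> /lt0r_neq0 ?; rewrite /c divff.
  have qE : q * 4 = k * ip M v v by rewrite /q mulfVK.
  have kE : k =
    match M with Euclidean => 0 | Spherical => 1 | Hyperbolic => -1 end by [].
  clear p0 c0 dc db da dp; clearbody a b c q k.
  have {nx0} nx0 : \forall t \near (0 : R), 0 < x 0 0 ->
      0 < (a t *: x + b t *: v) 0 0.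
    have [x0|x0] := ltP 0 (x 0 0); first by apply: filterS (nx0 x0) => t.
    by near=> t.
  near=> t.
  have pt : 0 < 1 + q * t ^+ 2 by near: t.
  have nx : 0 < x 0 0 -> 0 < (a t *: x + b t *: v) 0 0 by near: t.
  have {}ct := ct t pt; have {ipg} := ipg t; rewrite ac bc.
  move=> ipg; rewrite ac bc in nx *; set g := _ *: x + _ in nx ipg *.
  case: M Mx Tv qE kE nx ipg => /=; rewrite /model_tangent /ambient_normal/=
     => Mx Tv qE kE nx ipg.
  - have v0 : v 0 0 = 0.
      move: Tv; rewrite /ip !mxE eqxx /= !mul1r big1 ?addr0// => i i0.
      by rewrite mxE (negbTE i0) mul0r.
    by rewrite /g !mxE Mx v0 !mulr0 addr0.
  - rewrite ipg Mx Tv (_ : ip Spherical v v = q * 4); last first.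
      by rewrite qE kE mul1r.
    by transitivity (((1 + q * t ^+ 2) * c t) ^+ 2); [ring|rewrite ct expr1n].
  - case: Mx => Mx x0; split; last exact: nx.
    rewrite ipg Mx Tv (_ : ip Hyperbolic v v = - (q * 4)); last first.
      by rewrite qE kE mulN1r opprK.
    by transitivity (- ((1 + q * t ^+ 2) * c t) ^+ 2); [ring|rewrite ct expr1n].
- by rewrite /a /b c0 expr0n !mulr0 subr0 mul0r scale0r addr0 mul1r scale1r.
- have := is_deriveD (dZ _ _ x da) (dZ _ _ v db).
  by rewrite scale0r add0r scale1r.
Unshelve. all: by end_near. Qed.

Lemma covariant_derivative_linear M (a : R) (F G : E -> E) x v :
  smooth_on (model M) F -> smooth_on (model M) G ->
  model M x -> model_tangent M x v ->
  covariant_derivative M (model M) (a *: F + G) x v =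
  a *: covariant_derivative M (model M) F x v +
  covariant_derivative M (model M) G x v.
Proof.
move=> sF sG Mx Tv; have [g [Sg g0 dg]] := model_curve Mx Tv.
have [F' FE] := sF x Mx; have [G' GE] := sG x Mx.
rewrite /covariant_derivative.
rewrite (derive_alongE Sg g0 dg (local_extension_linear a FE GE)).
rewrite (derive_alongE Sg g0 dg FE) (derive_alongE Sg g0 dg GE).
have dF := local_extension_differentiable FE.
have dG := local_extension_differentiable GE.
rewrite -tangent_proj_linear; congr tangent_proj.
rewrite deriveD; [|exact/derivableZ/diff_derivable|exact/diff_derivable].
by rewrite deriveZ//; exact/diff_derivable.
Qed.

Lemma killing_eq_linear M (a : R) (F G : E -> E) x u v :
  let D := covariant_derivative M (model M) in
  smooth_on (model M) F -> smooth_on (model M) G ->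
  model M x -> model_tangent M x u -> model_tangent M x v ->
  ip M (D F x u) v + ip M u (D F x v) = 0 ->
  ip M (D G x u) v + ip M u (D G x v) = 0 ->
  ip M (D (a *: F + G) x u) v + ip M u (D (a *: F + G) x v) = 0.
Proof.
move=> D sF sG Mx Tu Tv eF eG; rewrite /D !covariant_derivative_linear//.
have h (p q r s : R) : p + r = 0 -> q + s = 0 -> a * p + q + (a * r + s) = 0.
  by move=> pr qs; rewrite addrACA -mulrDr pr qs mulr0 addr0.
by rewrite ip_linearl ip_linearr; exact: h eF eG.
Qed.

Lemma valL_linear (S : set E) (a : R) (Y Z : S -> E) :
  'valL_0 (a *: Y + Z) = a *: 'valL_0 Y + 'valL_0 Z :> (E -> E).
Proof.
apply/funext => x; rewrite !fctE /valL_ /=.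
by case: ('oinv_set_val x) => [y|] //=; rewrite scaler0 addr0.
Qed.

Lemma killing_submod_closed M : submod_closed (killing M).
Proof.
split=> [|a Y Z].
  have z : 'valL_0 (0 : model M -> E) = (0 : E -> E).
    by apply/funext => x; rewrite /valL_ /=; case: ('oinv_set_val x).
  have Ck0 U k : Ck U k (0 : E -> E).
    elim: k => [|k IH] /=; first by move=> x _; exact: cst_continuous.
    split=> [x _|v]; first exact: differentiable_cst.
    by rewrite (_ : 'D_v _ = 0)//; apply/funext => x; rewrite derive_cst.
  have s0 : smooth_on (model M) (0 : E -> E).
    by move=> x Mx; exists 0, setT; split => //; split => //; exact: openT.
  have ip0l u : ip M 0 u = 0 by rewrite -(scale0r 0) ipZl mul0r.
  apply/asboolP; rewrite /= z; split => //.
    by move=> x Mx; rewrite /model_tangent /mkset ipC;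
      case: ('oinv_set_val x) => [y|] /=; exact: ip0l.
  move=> x u v Mx Tu Tv.
  have cov0 w : model_tangent M x w ->
      covariant_derivative M (model M) 0 x w = 0.
    move=> Tw; have := covariant_derivative_linear (-1) s0 s0 Mx Tw.
    by rewrite scaler0 addr0 scaleN1r addNr.
  by rewrite !cov0// ip0l ipC ip0l addr0.
move=> /asboolP [sY tY kY] /asboolP [sZ tZ kZ]; apply/asboolP.
rewrite /= valL_linear; split.
- move=> x Mx; have [F FE] := sY x Mx; have [G GE] := sZ x Mx.
  by exists (a *: F + G); exact: local_extension_linear.
- move=> x Mx; have := tZ x Mx; have := tY x Mx.
  rewrite /model_tangent /mkset /=; case: ('oinv_set_val x) => [y|] //= eY eZ.
  by rewrite [LHS](ip_linearr M a (Y y) (Z y)) eY eZ mulr0 addr0.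
- move=> x u v Mx Tu Tv.
  exact: killing_eq_linear (kY x u v Mx Tu Tv) (kZ x u v Mx Tu Tv).
Qed.

HB.instance Definition _ M :=
  GRing.isSubmodClosed.Build R (model M -> E) (killing M)
    (killing_submod_closed M).

(* The vector space underlying the Lie algebra of Killing fields. *)
Record killing_field (M : spaceform) := KillingField {
  field_val :> model M -> E;
  _ : field_val \in killing M }.
HB.instance Definition _ M := [isSub for @field_val M].
HB.instance Definition _ M := [Choice of killing_field M by <:].
HB.instance Definition _ M := [SubChoice_isSubLmodule of killing_field M by <:].

End SpaceForms.
Arguments killing_field : clear implicits.

Section Surfaces.
Context {R : realType}.
Local Notation E := 'rV[R]_4.

(* Embedded smooth surface without boundary: near each of its points, the
   homeomorphic image of an open subset of the plane by a smooth immersion. *)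
Definition embedded_surface (Sigma : set E) : Prop :=
  forall p, Sigma p ->
    exists (U : set 'rV[R]_2) (V : set E) (X : 'rV[R]_2 -> E)
      (Xinv : E -> 'rV[R]_2),
    [/\ open U, open V /\ V p, smooth U X, X @` U = Sigma `&` V &
      [/\ forall u, U u -> injective ('d X u),
          forall u, U u -> Xinv (X u) = u &
          {within Sigma `&` V, continuous Xinv}]].

(* Velocities of curves in [S]. *)
Definition tangent_space (S : set E) (x : E) : set E :=
  [set v | exists (I : set R) (g : R -> E),
    [/\ open_nbhs 0 I, smooth I g, (forall t, I t -> S (g t)), g 0 = x &
        'D_1 g 0 = v]].

Definition unit_normal (M : spaceform) (Sigma : set E) (nu : E -> E) : Prop :=
  smooth_on Sigma nu /\
  forall p, Sigma p ->
    [/\ model_tangent M p (nu p), ip M (nu p) (nu p) = 1 &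
        forall v, tangent_space Sigma p v -> ip M (nu p) v = 0].

Definition orthonormal_frame (M : spaceform) (Sigma : set E) (p : E) :
    set (E * E) :=
  [set f | [/\ tangent_space Sigma p f.1, tangent_space Sigma p f.2,
     ip M f.1 f.1 = 1, ip M f.2 f.2 = 1 & ip M f.1 f.2 = 0]].

(* The divergence is a trace: it does not depend on the orthonormal frame. *)
Definition divergence (M : spaceform) (Sigma : set E) (F : E -> E)
    (p : E) : R :=
  let f := xget (0, 0) (orthonormal_frame M Sigma p) in
  let D := covariant_derivative M Sigma F p in
  ip M (D f.1) f.1 + ip M (D f.2) f.2.

Definition mean_curvature (M : spaceform) (Sigma : set E) (nu : E -> E)
    (p : E) : R :=
  divergence M Sigma nu p.

End Surfaces.

Section Chains.
Context {R : realType} {A : comNzRingType}.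
Local Notation E := 'rV[R]_4.

Definition stdsimplex (k : nat) : set 'rV[R]_k.+1 :=
  [set x | (forall i, 0 <= x 0 i) /\ \sum_i x 0 i = 1].
Arguments stdsimplex : clear implicits.

(* Singular simplices of the ambient space.  The smooth singular chains of a
   subset [X] are those satisfying [chain_in X]. *)
Definition simplex (k : nat) := stdsimplex k -> E.
HB.instance Definition _ k := Choice.on (simplex k).

Definition chain (k : nat) := {freeg (simplex k) / A}.
HB.instance Definition _ k := GRing.Lmodule.on (chain k).

Definition face (k : nat) (i : 'I_k.+2) (s : simplex k.+1) : simplex k :=
  fun x => 'valL_0 s (\row_j if unlift i j is Some l then val x 0 l else 0).

Definition boundary (k : nat) : chain k.+1 -> chain k :=
  fglift (fun s => \sum_(i < k.+2) (-1) ^+ i *: (<< face i s >> : chain k)).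

Definition smooth_simplex_in (k : nat) (X : set E) (s : simplex k) : Prop :=
  smooth_on (stdsimplex k) ('valL_0 s) /\ forall x, X (s x).

Definition chain_in (k : nat) (X : set E) (c : chain k) : Prop :=
  forall s, s \in dom c -> smooth_simplex_in X s.

Definition cycle_pred (X : set E) : {pred (chain 1)} :=
  fun c => `[< chain_in X c /\ boundary c = 0 >].
Arguments cycle_pred : clear implicits.

Lemma boundary_linear k (a : A) (c d : chain k.+1) :
  boundary (a *: c + d) = a *: boundary c + boundary d.
Proof.
rewrite /boundary; set f := fun s => _.
have fB u v : fglift f (u - v) = fglift f u - fglift f v.
  exact: (lift_is_additive f u v).
have f0 : fglift f 0 = 0 by rewrite -(subrr 0) fB subrr.
have fN u : fglift f (- u) = - fglift f u by rewrite -sub0r fB f0 sub0r.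
have fD u v : fglift f (u + v) = fglift f u + fglift f v.
  by rewrite -{1}[v]opprK fB fN opprK.
rewrite fD; congr (_ + _).
rewrite -[in RHS](freeg_sumE c) -[a *: c]/(fgscale a c) /fgscale.
elim: (dom c) => [|s r IH]; first by rewrite !big_nil f0 scaler0.
by rewrite !big_cons !fD scalerDr IH !liftU scalerA.
Qed.

Lemma chain_in_linear k (X : set E) (a : A) (c d : chain k) :
  chain_in X c -> chain_in X d -> chain_in X (a *: c + d).
Proof.
move=> Xc Xd s /domD_subset; rewrite mem_cat => /orP[/domZ_subset|].
  exact: Xc.
exact: Xd.
Qed.

Lemma chain_in0 k (X : set E) : chain_in X (0 : chain k).
Proof. by move=> s; rewrite dom0. Qed.

Lemma boundary0 k : boundary (0 : chain k.+1) = 0.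
Proof.
by have := boundary_linear (-1) (0 : chain k.+1) 0;
  rewrite scaler0 addr0 scaleN1r addNr.
Qed.

Lemma cycle_submod_closed X : submod_closed (cycle_pred X).
Proof.
split; first by apply/asboolP; split; [exact: chain_in0|exact: boundary0].
move=> a c d /asboolP[Xc bc] /asboolP[Xd bd]; apply/asboolP; split.
  exact: chain_in_linear.
by rewrite boundary_linear bc bd scaler0 addr0.
Qed.

HB.instance Definition _ X :=
  GRing.isSubmodClosed.Build A (chain 1) (cycle_pred X)
    (@cycle_submod_closed X).

Record smooth_cycle (X : set E) := SmoothCycle {
  cycle_val :> chain 1;
  _ : cycle_val \in cycle_pred X }.
HB.instance Definition _ X := [isSub for @cycle_val X].
HB.instance Definition _ X := [Choice of smooth_cycle X by <:].
HB.instance Definition _ X := [SubChoice_isSubLmodule of smooth_cycle X by <:].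

Definition null_homologous (X : set E) : {pred (smooth_cycle X)} :=
  fun c => `[< exists2 d : chain 2, chain_in X d & boundary d = c >].
Arguments null_homologous : clear implicits.

Lemma null_homologous_submod_closed X : submod_closed (null_homologous X).
Proof.
split.
  by apply/asboolP; exists 0; [exact: chain_in0|exact: boundary0].
move=> a c c' /asboolP[d Xd bd] /asboolP[d' Xd' bd']; apply/asboolP.
exists (a *: d + d'); first exact: chain_in_linear.
by rewrite boundary_linear bd bd'.
Qed.

HB.instance Definition _ X :=
  GRing.isSubmodClosed.Build A (smooth_cycle X) (null_homologous X)
    (@null_homologous_submod_closed X).

Definition homology1 (X : set E) := Quotient.quot (null_homologous X).
HB.instance Definition _ X := Quotient.on (homology1 X).
HB.instance Definition _ X := GRing.Zmodule.on (homology1 X).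

Definition homology_class (X : set E) (c : smooth_cycle X) : homology1 X :=
  \pi_(homology1 X)%qT c.

End Chains.
Arguments stdsimplex R k _ : clear implicits.
Arguments simplex R k : clear implicits.
Arguments chain R A k : clear implicits.
Arguments smooth_cycle {R} A X.
Arguments homology1 {R} A X.

Section HomologyModule.
Context {R : realType} {A : comNzRingType} (X : set 'rV[R]_4).
Local Notation H := (homology1 A X).

Definition homology_scale (a : A) (h : H) : H :=
  homology_class (a *: repr h).

Lemma homology_class_scale a (c : smooth_cycle A X) :
  homology_scale a (homology_class c) = homology_class (a *: c).
Proof.
apply/eqP; rewrite -Quotient.idealrBE -scalerBr.
by apply: rpredZ; rewrite Quotient.idealrBE reprK.
Qed.

Lemma homology_classD (c d : smooth_cycle A X) :
  homology_class (c + d) = homology_class c + homology_class d :> H.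
Proof. exact: Quotient.pi_add. Qed.

Lemma homology_classP (h : H) : exists c, h = homology_class c.
Proof. by exists (repr h); rewrite /homology_class reprK. Qed.

Lemma homology_scaleA a b h :
  homology_scale a (homology_scale b h) = homology_scale (a * b) h.
Proof.
by have [c ->] := homology_classP h; rewrite !homology_class_scale scalerA.
Qed.

Lemma homology_scale1 h : homology_scale 1 h = h.
Proof.
by have [c ->] := homology_classP h; rewrite homology_class_scale scale1r.
Qed.

Lemma homology_scaleDr : right_distributive homology_scale +%R.
Proof.
move=> a h h'; have [c ->] := homology_classP h.
have [d ->] := homology_classP h'.
by rewrite -homology_classD !homology_class_scale scalerDr homology_classD.
Qed.

Lemma homology_scaleDl h : {morph homology_scale^~ h : a b / a + b}.
Proof.
move=> a b; have [c ->] := homology_classP h.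
by rewrite !homology_class_scale scalerDl homology_classD.
Qed.

HB.instance Definition _ := GRing.Zmodule_isLmodule.Build A (homology1 A X)
  homology_scaleA homology_scale1 homology_scaleDr homology_scaleDl.

End HomologyModule.

Section Flux.
Context {R : realType}.
Local Notation E := 'rV[R]_4.
Local Notation mu := (@lebesgue_measure R).

Definition row_of (n : nat) (s : seq R) : 'rV[R]_n := \row_i s`_i.

(* Integral over a singular 1-simplex of the 1-form [a], where [a x v] is the
   value of the form at the point [x] on the tangent vector [v]. *)
Definition integral1 (a : E -> E -> R) (s : simplex R 1) : R :=
  let f := 'valL_0 s : 'rV[R]_2 -> E in
  let df := derive_along (stdsimplex R 1) f in
  \int[mu]_(t in `[0, 1])
    let x := row_of 2 [:: 1 - t; t] in
    a (f x) (df x (row_of 2 [:: -1; 1])).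

(* Integral of a 2-form over a singular 2-simplex; the standard 2-simplex is
   parametrized by its last two barycentric coordinates. *)
Definition integral2 (b : E -> E -> E -> R) (s : simplex R 2) : R :=
  let f := 'valL_0 s : 'rV[R]_3 -> E in
  let df := derive_along (stdsimplex R 2) f in
  \int[mu]_(t in `[0, 1]) \int[mu]_(u in `[0, 1 - t])
    let x := row_of 3 [:: 1 - t - u; t; u] in
    b (f x) (df x (row_of 3 [:: -1; 1; 0])) (df x (row_of 3 [:: -1; 0; 1])).

(* [iota] embeds the coefficients in the reals: integral chains correspond to
   [intr] and real chains to the identity. *)
Definition chain_integral (A : comNzRingType) (iota : {rmorphism A -> R})
    (k : nat) (I : simplex R k -> R) (c : chain R A k) : R :=
  \sum_(s <- dom c) iota (coeff s c) * I s.

(* The area form of [Sigma], oriented by its unit normal [nu]: a tangent basis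
   is positive when, followed by [nu], it is positive in [model M]. *)
Definition area (M : spaceform) (o : bool) (nu : E -> E) (x u v : E) : R :=
  vol M o x u v (nu x).

(* The 1-form i(Y^tan) dA, whose integral is that of the product of [Y] with the
   unit conormal. *)
Definition conormal_form (M : spaceform) (o : bool) (nu Y : E -> E)
    (x v : E) : R :=
  area M o nu x (Y x - ip M (Y x) (nu x) *: nu x) v.

Definition flux_form (M : spaceform) (o : bool) (Y : E -> E)
    (x u v : E) : R :=
  vol M o x (Y x) u v.

Definition weighted_flux (A : comNzRingType) (iota : {rmorphism A -> R})
    (M : spaceform) (o : bool) (nu : E -> E) (H : R)
    (Gamma : chain R A 1) (K : chain R A 2) (Y : model M -> E) : R :=
  chain_integral iota (integral1 (conormal_form M o nu ('valL_0 Y))) Gamma -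
  H * chain_integral iota (integral2 (flux_form M o ('valL_0 Y))) K.

Definition fills (A : comNzRingType) (M : spaceform) (Gamma : chain R A 1)
    (K : chain R A 2) : Prop :=
  chain_in (model M) K /\ boundary K = - Gamma.

Definition flux_well_defined (A : comNzRingType) (iota : {rmorphism A -> R})
    (M : spaceform) (o : bool) (Sigma : set E) (nu : E -> E) (H : R)
    (c : homology1 A Sigma) : Prop :=
  forall (Y : killing_field R M) (Gamma Gamma' : smooth_cycle A Sigma)
    (K K' : chain R A 2),
    homology_class Gamma = c -> homology_class Gamma' = c ->
    fills M Gamma K -> fills M Gamma' K' ->
    weighted_flux iota o nu H Gamma K Y =
    weighted_flux iota o nu H Gamma' K' Y.

End Flux.
Arguments flux_well_defined {R A} iota M o {Sigma} nu H c.
Arguments weighted_flux {R A} iota M o nu H Gamma K Y.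

(* Main.v *)
From HB Require Import structures.
From mathcomp Require Import all_boot all_order all_algebra.
From mathcomp Require Import all_classical all_reals all_analysis.
From mathcomp Require Import generic_quotient ring_quotient freeg perm ring lra.
Require Import Defs.
Import Order.TTheory GRing.Theory Num.Theory.
Import numFieldNormedType.Exports.

Set Implicit Arguments.
Unset Strict Implicit.
Unset Printing Implicit Defensive.

Local Open Scope classical_set_scope.
Local Open Scope ring_scope.

(* Every Killing field is the restriction of an affine field [b + x *m L] with [L]
   skew, so its flux form is exact on the space form, with an explicit primitive
   beta.  Stokes' theorem then turns the quantity of the theorem into the integral
   over Gamma of the single 1-form theta, the sum of the conormal form and of
   H beta, whatever the filling K.  On Sigma, d theta is (H - h) times the flux
   form; hence theta is closed when h = H.  Conversely, if the quantity is well
   defined, adding small triangles to Gamma shows that the integral of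
   (H - h) times the flux form over each of them vanishes, and a Killing field
   equal to nu at p gives h(p) = H.  Fillings are cones with an apex whose
   antipode is not on Sigma: Sigma is not the whole sphere, for nu would be
   tangent to it. *)

(** Three obstacles shape the proof. Chains live on closed simplices, whose boundary points admit
    only one-sided curves, while tangent vectors are velocities of two-sided ones: derivatives along
    a simplex are therefore controlled by convexity, and two integrands are compared at interior
    points only, which carry the whole integral. Forms are handled in ambient coordinates: a 1-form
    is a covector field on the four-dimensional space, differentiated through any local smooth
    extension, and its exterior derivative is meaningful on tangent vectors only. Finally, the
    hypothesis of the converse quantifies over fillings, so it says nothing about a cycle that
    bounds no chain of the space form: smooth fillings have to be produced before it can be used,
    and they also serve to define omega. The affine expression of a Killing field comes from a
    conservation law along straight segments of the ambient space, which makes the pairing of the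
    field at x with y skew in x and y, up to a translation in the flat case. *)

(** * Calculus of functions of class C^k *)

Section CkCalculus.
Context {R : realType}.
Implicit Types (V W : normedModType R) (k n : nat).

Lemma CkS V W (U : set V) k (f : V -> W) : Ck U k.+1 f -> Ck U k f.
Proof.
elim: k f => [|k IH] f [df Df].
  by move=> x Ux; exact/differentiable_continuous/df.
by split=> // v; exact/IH/Df.
Qed.

Lemma Ck_differentiable V W (U : set V) k (f : V -> W) x :
  Ck U k.+1 f -> U x -> differentiable f x.
Proof. by move=> [df _] /df. Qed.

Lemma Ck_derive V W (U : set V) k (f : V -> W) v :
  Ck U k.+1 f -> Ck U k ('D_v f).
Proof. by move=> [_]; exact. Qed.

Lemma Ck_continuous V W (U : set V) k (f : V -> W) x :
  Ck U k f -> U x -> {for x, continuous f}.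
Proof.
by elim: k => [|k IH] Cf Ux; [exact: Cf|exact: IH (CkS Cf) Ux].
Qed.

Lemma Ck_cst V W (U : set V) k (w : W) : Ck U k (fun _ => w).
Proof.
elim: k w => [|k IH] w /=; first by move=> x _; exact: cst_continuous.
split=> [x _|v]; first exact: differentiable_cst.
by rewrite (_ : 'D_v _ = fun=> 0)//; apply/funext => x; exact: derive_cst.
Qed.

Lemma Ck_linmap V W (U : set V) k (f : {linear V -> W}) :
  continuous f -> Ck U k f.
Proof.
move=> cf; case: k => [|k] /=; first by move=> x _; exact: cf.
split=> [x _|v]; first exact: linear_differentiable.
rewrite (_ : 'D_v _ = fun=> f v); first exact: Ck_cst.
apply/funext => x; rewrite deriveE; last exact: linear_differentiable.
by rewrite diff_lin.
Qed.

Lemma Ck_comp_linmap V W W' (U : set V) k (l : {linear W -> W'}) (f : V -> W) :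
  open U -> continuous l -> Ck U k f -> Ck U k (l \o f).
Proof.
move=> oU cl; elim: k f => [|k IH] f /=.
  by move=> cf x /cf cfx; apply: continuous_comp; [exact: cfx|exact: cl].
move=> [df Df]; split=> [x Ux|v].
  by apply: differentiable_comp; [exact: df|exact: linear_differentiable].
apply: eq_Ck oU _ (IH _ (Df v)) => x Ux.
rewrite [RHS]deriveE; last first.
  by apply: differentiable_comp; [exact: df|exact: linear_differentiable].
rewrite diff_comp; [|exact: df|exact: linear_differentiable].
by rewrite /= diff_lin// deriveE//; exact: df.
Qed.

Lemma CkD V W (U : set V) k (f g : V -> W) :
  open U -> Ck U k f -> Ck U k g -> Ck U k (f + g).
Proof. by move=> oU /(Ck_linear 1 oU) H /H; rewrite scale1r. Qed.

Lemma Ck_sum V W (U : set V) k (I : Type) (r : seq I) (P : pred I)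
    (f : I -> V -> W) :
  open U -> (forall i, P i -> Ck U k (f i)) ->
  Ck U k (\sum_(i <- r | P i) f i).
Proof.
move=> oU Cf; apply: (big_ind (Ck U k)) => //; first exact: Ck_cst.
by move=> ? ?; exact: CkD.
Qed.

Lemma CkZl V W (U : set V) k (c : V -> R) (w : W) :
  open U -> Ck U k c -> Ck U k (fun x => c x *: w).
Proof.
move=> oU; elim: k c => [|k IH] c /=.
  by move=> cc x Ux; apply: continuousZl; exact: cc.
move=> [dc Dc]; split=> [x Ux|v]; first by apply: differentiableZl; exact: dc.
apply: eq_Ck oU _ (IH _ (Dc v)) => x Ux.
rewrite [RHS]deriveE; last by apply: differentiableZl; exact: dc.
by rewrite diffZl; [rewrite deriveE//; exact: dc|exact: dc].
Qed.

Lemma CkM V (U : set V) k (f g : V -> R) :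
  open U -> Ck U k f -> Ck U k g -> Ck U k (f * g).
Proof.
move=> oU; elim: k f g => [|k IH] f g.
  by move=> cf cg x Ux; apply: continuousM; [exact: cf|exact: cg].
move=> Cf Cg; have [[df Df] [dg Dg]] := (Cf, Cg); split=> [x Ux|v].
  by apply: differentiableM; [exact: df|exact: dg].
have := CkD oU (IH _ _ (CkS Cf) (Dg v)) (IH _ _ (CkS Cg) (Df v)).
apply: eq_Ck oU _ => x Ux; rewrite [RHS]deriveM //.
  exact/diff_derivable/df.
exact/diff_derivable/dg.
Qed.

Lemma coord_linear_subproof n (i : 'I_n) : linear (fun u : 'rV[R]_n => u 0 i).
Proof. by move=> a u v; rewrite !mxE. Qed.

Definition row_coord n (i : 'I_n) (u : 'rV[R]_n) : R := u 0 i.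
HB.instance Definition _ n (i : 'I_n) :=
  GRing.isLinear.Build R 'rV[R]_n R _ (@row_coord n i) (coord_linear_subproof i).

Lemma row_coord_continuous n (i : 'I_n) : continuous (@row_coord n i).
Proof. exact: coord_continuous. Qed.

Lemma Ck_coord V (U : set V) k n (f : V -> 'rV[R]_n) (i : 'I_n) :
  open U -> Ck U k f -> Ck U k (fun x => f x 0 i).
Proof.
by move=> oU /(Ck_comp_linmap (l := @row_coord n i) oU); apply;
  exact: row_coord_continuous.
Qed.

Lemma rV_delta_sum V n (f : V -> 'rV[R]_n) :
  f = \sum_i (fun x => f x 0 i *: delta_mx 0 i).
Proof.
apply/funext => x; rewrite fct_sumE /= [LHS]row_sum_delta.
by apply: eq_bigr.
Qed.

Lemma Ck_rV V (U : set V) k n (f : V -> 'rV[R]_n) :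
  open U -> (forall i, Ck U k (fun x => f x 0 i)) -> Ck U k f.
Proof.
move=> oU Cf; rewrite (rV_delta_sum f); apply: Ck_sum => // i _.
exact: CkZl.
Qed.

Lemma CkZ V (U : set V) k n (c : V -> R) (f : V -> 'rV[R]_n) :
  open U -> Ck U k c -> Ck U k f -> Ck U k (fun x => c x *: f x).
Proof.
move=> oU Cc Cf; apply: Ck_rV => // i.
rewrite (_ : (fun x => _) = c * (fun x => f x 0 i)).
  by apply: CkM => //; exact: Ck_coord.
by apply/funext => x; rewrite mxE.
Qed.

Lemma derive_rV_sum V n (g : 'rV[R]_n -> V) x v :
  differentiable g x -> 'D_v g x = \sum_i v 0 i *: 'D_(delta_mx 0 i) g x.
Proof.
move=> dg; rewrite deriveE// [in LHS](row_sum_delta v) linear_sum.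
by apply: eq_bigr => i _; rewrite linearZ deriveE.
Qed.

(** The directions in [Ck] are constant, whereas the chain rule differentiates [g] in the direction
    ['D_v f x], which moves with [x]. Expanding that direction in coordinates leaves products of
    scalar functions, to which the induction applies; hence the scalar target here, and the passage
    to coordinates in [Ck_comp]. *)
Lemma Ck_compR V (U : set V) n (U' : set 'rV[R]_n) k
    (f : V -> 'rV[R]_n) (g : 'rV[R]_n -> R) :
  open U -> (forall x, U x -> U' (f x)) -> Ck U k f -> Ck U' k g ->
  Ck U k (g \o f).
Proof.
move=> oU fU; elim: k g => [|k IH] g.
  move=> cf cg x Ux; apply: continuous_comp; first exact: cf.
  exact/cg/fU.
move=> Cf Cg; have df x := Ck_differentiable (x := x) Cf.
have dg x := Ck_differentiable (x := x) Cg; split=> [x Ux|v].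
  by apply: differentiable_comp; [exact: df|exact/dg/fU].
have CD : Ck U k (\sum_i (fun x => ('D_v f x) 0 i) *
    ('D_(delta_mx 0 i) g \o f)).
  apply: Ck_sum => // i _; apply: CkM => //; last first.
    exact: IH (CkS Cf) (Ck_derive _ Cg).
  exact: Ck_coord (Ck_derive _ Cf).
apply: eq_Ck oU _ CD => x Ux; rewrite fct_sumE [RHS]deriveE; last first.
  by apply: differentiable_comp; [exact: df|exact/dg/fU].
rewrite diff_comp; [|exact: df|exact/dg/fU].
have E : 'd f x v = 'D_v f x by rewrite deriveE//; exact: df.
rewrite /= E -deriveE; last exact/dg/fU.
by rewrite derive_rV_sum//; exact/dg/fU.
Qed.

Lemma Ck_comp V (U : set V) n m (U' : set 'rV[R]_n) k
    (f : V -> 'rV[R]_n) (g : 'rV[R]_n -> 'rV[R]_m) :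
  open U -> open U' -> (forall x, U x -> U' (f x)) -> Ck U k f -> Ck U' k g ->
  Ck U k (g \o f).
Proof.
move=> oU oU' fU Cf Cg; apply: Ck_rV => // i.
exact: Ck_compR fU Cf (Ck_coord i oU' Cg).
Qed.

(** Expressing the derivative of f^(-1/2) as a polynomial in f^(-1/2) and the derivative of f lets
    the induction of [Ck_inv_sqrt] close. *)
Lemma derive_inv_sqrt V (f : V -> R) x v : 0 < f x -> differentiable f x ->
  let r y := (Num.sqrt (f y))^-1 in
  differentiable r x /\ 'D_v r x = - 2^-1 * (r x * (r x * (r x * 'D_v f x))).
Proof.
move=> f0 df r; pose g (y : R) := (Num.sqrt y)^-1 : R.
have s0 : 0 < Num.sqrt (f x) by rewrite sqrtr_gt0 f0.
have dg : is_derive (f x) 1 g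
    (- (Num.sqrt (f x)) ^- 2 *: (2 * Num.sqrt (f x))^-1).
  by apply: is_deriveV; [rewrite lt0r_neq0|exact: is_derive1_sqrt].
have dfg : differentiable g (f x) by apply/derivable1_diffP; case: dg.
have dr : differentiable r x by exact: (differentiable_comp df dfg).
split=> //; have -> : 'D_v r x = 'd g (f x) ('D_v f x : R).
  rewrite [LHS]deriveE// (diff_comp df dfg) /=.
  by congr ('d g (f x) _); rewrite -deriveE.
rewrite -[X in 'd g _ X]mulr1 -[X in 'd g _ X]/('D_v f x *: (1 : R)) linearZ.
rewrite -deriveE//; case: dg => _ ->.
have E (s d : R) : s != 0 ->
    d * (- s ^- 2 * (2 * s)^-1) = - 2^-1 * (s^-1 * (s^-1 * (s^-1 * d))).
  by move=> s_neq0; field.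
by apply: E; rewrite lt0r_neq0.
Qed.

Lemma Ck_inv_sqrt V (U : set V) k (f : V -> R) :
  open U -> (forall x, U x -> 0 < f x) -> Ck U k f ->
  Ck U k (fun x => (Num.sqrt (f x))^-1).
Proof.
move=> oU f0; elim: k => [|k IH] Cf.
  move=> x Ux; apply: continuousV; first by rewrite gt_eqF// sqrtr_gt0 f0.
  by apply: continuous_comp; [exact: Cf|exact: sqrt_continuous].
have df x := Ck_differentiable (x := x) Cf; have Cr := IH (CkS Cf).
split=> [x Ux|v]; first by have [] := derive_inv_sqrt 0 (f0 x Ux) (df x Ux).
have := CkM oU (Ck_cst U k (- 2^-1 : R))
  (CkM oU Cr (CkM oU Cr (CkM oU Cr (Ck_derive v Cf)))).
by apply: eq_Ck => // x Ux; have [_ ->] := derive_inv_sqrt v (f0 x Ux) (df x Ux).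
Qed.

Lemma open_preimage_in V W (U : set V) (U' : set W) (f : V -> W) :
  open U -> open U' -> (forall x, U x -> {for x, continuous f}) ->
  open (U `&` f @^-1` U').
Proof.
rewrite !openE => oU oU' cf x [Ux U'x]; apply: filterI; first exact: oU.
exact/(cf x Ux)/oU'.
Qed.

End CkCalculus.

(** * Functions smooth on an arbitrary subset *)

Section SmoothOn.
Context {R : realType}.
Implicit Types (V W : normedModType R) (n : nat).

Lemma smooth_smooth_on V W (S U : set V) (f : V -> W) :
  open U -> S `<=` U -> smooth U f -> smooth_on S f.
Proof. by move=> oU SU sf x /SU Ux; exists f, U. Qed.

Lemma eq_smooth_on V W (S : set V) (f g : V -> W) :
  (forall x, S x -> f x = g x) -> smooth_on S f -> smooth_on S g.
Proof.
move=> fg sf x Sx; have [F [U [oU sF eF]]] := sf x Sx.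
by exists F, U; split => // y Sy Uy; rewrite eF// fg.
Qed.

Lemma smooth_on_cst V W (S : set V) (w : W) : smooth_on S (fun _ => w).
Proof.
apply: (smooth_smooth_on openT) => // k; exact: Ck_cst.
Qed.

Lemma smooth_on_linmap V W (S : set V) (f : {linear V -> W}) :
  continuous f -> smooth_on S f.
Proof.
by move=> cf; apply: (smooth_smooth_on openT) => // k; exact: Ck_linmap.
Qed.

Lemma smooth_onD V W (S : set V) (f g : V -> W) :
  smooth_on S f -> smooth_on S g -> smooth_on S (f + g).
Proof.
move=> sf sg x Sx; have [F FE] := sf x Sx; have [G GE] := sg x Sx.
by exists (1 *: F + G); have := local_extension_linear 1 FE GE; rewrite scale1r.
Qed.

Lemma smooth_on_sum V W (S : set V) (I : Type) (r : seq I) (P : pred I)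
    (f : I -> V -> W) :
  (forall i, P i -> smooth_on S (f i)) ->
  smooth_on S (\sum_(i <- r | P i) f i).
Proof.
move=> Cf; apply: (big_ind (smooth_on S)) => //; first exact: smooth_on_cst.
by move=> ? ?; exact: smooth_onD.
Qed.

Lemma smooth_onM V (S : set V) (f g : V -> R) :
  smooth_on S f -> smooth_on S g -> smooth_on S (f * g).
Proof.
move=> sf sg x Sx; have [F [U [[oU Ux] sF eF]]] := sf x Sx.
have [G [U' [[oU' Ux'] sG eG]]] := sg x Sx.
have oUU' := openI oU oU'; exists (F * G), (U `&` U'); split=> //.
  by move=> k; apply: CkM => //; [apply: CkW (sF k)|apply: CkW (sG k)] => y [].
by move=> y Sy [Uy Uy']; rewrite !fctE eF// eG.
Qed.

Lemma smooth_onZl V W (S : set V) (c : V -> R) (w : W) :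
  smooth_on S c -> smooth_on S (fun x => c x *: w).
Proof.
move=> sc x Sx; have [F [U [[oU Ux] sF eF]]] := sc x Sx.
exists (fun x => F x *: w), U; split=> [//|k|y Sy Uy]; first exact: CkZl.
by rewrite eF.
Qed.

Lemma smooth_on_rV V (S : set V) n (f : V -> 'rV[R]_n) :
  (forall i, smooth_on S (fun x => f x 0 i)) -> smooth_on S f.
Proof.
move=> Cf; rewrite (rV_delta_sum f); apply: smooth_on_sum => // i _.
exact: smooth_onZl.
Qed.

Lemma smooth_on_coord V (S : set V) n (f : V -> 'rV[R]_n) i :
  smooth_on S f -> smooth_on S (fun x => f x 0 i).
Proof.
move=> sf x Sx; have [F [U [[oU Ux] sF eF]]] := sf x Sx.
exists (fun y => F y 0 i), U; split=> [//|k|y Sy Uy]; first exact: Ck_coord.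
by rewrite eF.
Qed.

Lemma smooth_onZ V (S : set V) n (c : V -> R) (f : V -> 'rV[R]_n) :
  smooth_on S c -> smooth_on S f -> smooth_on S (fun x => c x *: f x).
Proof.
move=> sc sf; apply: smooth_on_rV => i.
rewrite (_ : (fun x => _) = c * (fun x => f x 0 i)).
  by apply: smooth_onM => //; exact: smooth_on_coord.
by apply/funext => x; rewrite mxE.
Qed.

Lemma local_extension_comp V n m (S : set V) (S' : set 'rV[R]_n)
    (f F : V -> 'rV[R]_n) (g G : 'rV[R]_n -> 'rV[R]_m) x :
  (forall y, S y -> S' (f y)) -> S x ->
  local_extension S f x F -> local_extension S' g (f x) G ->
  local_extension S (g \o f) x (G \o F).
Proof.
move=> SS' Sx [U [[oU Ux] sF eF]] [U' [[oU' U'x] sG eG]].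
have oP := open_preimage_in oU oU' (sF 0%N).
exists (U `&` F @^-1` U'); split=> [|k|y Sy [Uy U'y]].
- by split=> //; split=> //=; rewrite eF.
- by apply: Ck_comp (sG k) => //; [move=> y []|apply: CkW (sF k) => y []].
- by rewrite /= -(eF _ Sy Uy) eG// eF//; exact: SS'.
Qed.

Lemma smooth_on_comp V n m (S : set V) (S' : set 'rV[R]_n)
    (f : V -> 'rV[R]_n) (g : 'rV[R]_n -> 'rV[R]_m) :
  (forall y, S y -> S' (f y)) -> smooth_on S f -> smooth_on S' g ->
  smooth_on S (g \o f).
Proof.
move=> SS' sf sg x Sx; have [F FE] := sf x Sx.
have [G GE] := sg (f x) (SS' x Sx); exists (G \o F).
exact: local_extension_comp GE.
Qed.

Lemma local_extension_continuous V W (S : set V) (f F : V -> W) x :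
  local_extension S f x F -> {for x, continuous F}.
Proof. by move=> /local_extension_differentiable/differentiable_continuous. Qed.

Lemma smooth_on_continuous V W (S : set V) (f : V -> W) :
  smooth_on S f -> {within S, continuous f}.
Proof.
move=> sf; apply/subspace_continuousP => x Sx.
have [F FE] := sf x Sx; have cF := local_extension_continuous FE.
have [U [oUx _ eF]] := FE; have Ux := oUx.2.
change (f @ within S (nbhs x) --> f x).
rewrite -(eF x Sx Ux).
have cFS : F y @[y --> within S (nbhs x)] --> F x.
  by apply: cvg_trans cF; apply: cvg_app; exact: cvg_within.
apply: cvg_trans cFS.
apply: near_eq_cvg; rewrite near_withinE; near=> y => Sy; apply: eF => //.
by near: y; exact: open_nbhs_nbhs.
Unshelve. all: by end_near. Qed.

Lemma derive_comp V W W' (f : V -> W) (g : W -> W') x v :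
  differentiable f x -> differentiable g (f x) ->
  'D_v (g \o f) x = 'D_('D_v f x) g (f x).
Proof.
move=> df dg; rewrite deriveE; last exact: differentiable_comp.
by rewrite diff_comp//= deriveE// deriveE.
Qed.

Lemma derive_dir_linear V W (f : V -> W) x a v w : differentiable f x ->
  'D_(a *: v + w) f x = a *: 'D_v f x + 'D_w f x.
Proof. by move=> df; rewrite !deriveE// linearP. Qed.

Lemma derive_dirB V W (f : V -> W) x v w : differentiable f x ->
  'D_(v - w) f x = 'D_v f x - 'D_w f x.
Proof. by move=> df; rewrite !deriveE// linearB. Qed.

(** A two-sided limit is also a right limit, and right limits are unique. This is what remains at a
    boundary point of a simplex, where only half of a line stays inside. *)
Lemma eq_derive_right V W (f g : V -> W) x v :
  f x = g x -> (\forall t \near 0^'+, f (t *: v + x) = g (t *: v + x)) ->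
  derivable f x v -> derivable g x v -> 'D_v f x = 'D_v g x.
Proof.
move=> fgx fg /cvg_dnbhs_at_right df /cvg_dnbhs_at_right dg.
apply: (cvg_unique _ df); first exact: norm_hausdorff.
apply: cvg_trans dg; apply: near_eq_cvg.
by apply: filterS fg => t /= e; rewrite e fgx.
Qed.

End SmoothOn.

(** * Derivatives along convex sets *)

Section ConvexDerivative.
Context {R : realType}.
Implicit Types (V W : normedModType R).

Definition convex_subset V (S : set V) :=
  forall x y (t : R), S x -> S y -> 0 <= t <= 1 -> S (x + t *: (y - x)).

Lemma local_extension_derive_convex V W (S : set V) (f F G : V -> W) x y :
  convex_subset S -> S x -> S y ->
  local_extension S f x F -> local_extension S f x G ->
  'D_(y - x) F x = 'D_(y - x) G x.
Proof.
move=> cS Sx Sy FE GE.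
have /diff_derivable dF := local_extension_differentiable FE.
have /diff_derivable dG := local_extension_differentiable GE.
have [U [oU sF eF]] := FE; have [U' [oU' sG eG]] := GE.
have [Ux U'x] := (oU.2, oU'.2).
apply: eq_derive_right => //; first by rewrite eF// eG.
have c : t *: (y - x) + x @[t --> (0 : R)] --> x.
  rewrite -[X in _ --> X]add0r -[X in _ --> X + _](scale0r (y - x)).
  apply: cvgD; last exact: cvg_cst.
  by apply: scalel_continuous.
have /cvg_at_right_filter/(_ _ (open_nbhs_nbhs oU)) nU := c.
have /cvg_at_right_filter/(_ _ (open_nbhs_nbhs oU')) nU' := c.
near=> t; have St : S (t *: (y - x) + x).
  rewrite addrC; apply: cS => //; apply/andP; split.
    by near: t; exact: nbhs_right_ge.
  by near: t; exact: nbhs_right_le.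
by rewrite eF//; [rewrite eG//; near: t|near: t].
Unshelve. all: by end_near. Qed.

(** At a boundary point the line in the direction [y - z] may leave [S] on both sides, but [y - z]
    is the difference of [y - x] and [z - x], which both point into [S]. Linearity of the derivative
    of a smooth extension then makes it independent of the extension selected by [derive_along]. *)
Lemma derive_along_convex V W (S : set V) (f F : V -> W) x y z :
  convex_subset S -> S x -> S y -> S z -> local_extension S f x F ->
  derive_along S f x (y - z) = 'D_(y - z) F x.
Proof.
move=> cS Sx Sy Sz FE; rewrite /derive_along.
set G := xget f _; have GE : local_extension S f x G by apply: xgetPex; exists F.
have dF := local_extension_differentiable FE.
have dG := local_extension_differentiable GE.
have -> : y - z = (y - x) - (z - x) by rewrite opprB addrA subrK.
rewrite [LHS]derive_dirB// [RHS]derive_dirB//.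
by rewrite -!(local_extension_derive_convex (G := G) cS Sx _ FE).
Qed.

Lemma local_extension_derive V W (S : set V) (f F : V -> W) x y z :
  convex_subset S -> S y -> S z -> local_extension S f x F ->
  local_extension S (derive_along S f ^~ (y - z)) x ('D_(y - z) F).
Proof.
move=> cS Sy Sz [U [[oU Ux] sF eF]]; exists U; split=> [//|k|w Sw Uw].
  exact: Ck_derive (sF k.+1).
by rewrite (derive_along_convex (F := F))//; exists U.
Qed.

Lemma smooth_on_derive V W (S : set V) (f : V -> W) y z :
  convex_subset S -> S y -> S z -> smooth_on S f ->
  smooth_on S (derive_along S f ^~ (y - z)).
Proof.
move=> cS Sy Sz sf x Sx; have [F FE] := sf x Sx.
by exists ('D_(y - z) F); exact: local_extension_derive.
Qed.

End ConvexDerivative.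

(** * Symmetry of second derivatives *)

Section Schwarz.
Context {R : realType}.
Implicit Types (V W : normedModType R).

Lemma is_derive_affine V (y w : V) (t : R) :
  is_derive t 1 (fun s : R => y + s *: w) w.
Proof.
have dw : differentiable (fun s : R => s *: w) t.
  by have [] := is_diff_scalel t w.
have d : differentiable (fun s : R => y + s *: w) t.
  by apply: differentiableD => //; exact: differentiable_cst.
apply: DeriveDef; first exact/derivable1_diffP.
rewrite (_ : (fun s : R => y + s *: w) = cst y + (fun s : R => s *: w))//.
rewrite deriveD//; last exact/derivable1_diffP.
rewrite derive_cst add0r deriveE//.
by have [_ ->] := is_diff_scalel t w; rewrite scale1r.
Qed.

Lemma is_derive_comp_curve V W (F : V -> W) (g : R -> V) (v : V) (t : R) :
  differentiable F (g t) -> is_derive t 1 g v ->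
  is_derive t 1 (F \o g) ('D_v F (g t)).
Proof.
move=> dF [/derivable1_diffP dg <-].
have dFg := differentiable_comp dg dF.
by apply: DeriveDef; [exact/derivable1_diffP|rewrite derive_comp].
Qed.

Lemma is_derive_line V W (F : V -> W) (y w : V) (t : R) :
  differentiable F (y + t *: w) ->
  is_derive t 1 (fun s : R => F (y + s *: w)) ('D_w F (y + t *: w)).
Proof.
move=> dF; apply: (@is_derive_comp_curve V W F (fun s => y + s *: w)) => //.
exact: is_derive_affine.
Qed.

Lemma MVT_line V (F : V -> R) (y w : V) (h : R) : 0 < h ->
  (forall t, 0 <= t <= h -> differentiable F (y + t *: w)) ->
  exists2 t, 0 <= t <= h & F (y + h *: w) - F y = 'D_w F (y + t *: w) * h.
Proof.
move=> h0 dF; pose f (t : R) : R := F (y + t *: w).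
have df (t : R) : 0 <= t <= h -> is_derive t 1 f ('D_w F (y + t *: w)).
  by move=> /dF; exact: is_derive_line.
have [| |c ch] := @MVT R f (fun t => 'D_w F (y + t *: w)) 0 h h0.
- by move=> t; rewrite in_itv /= => /andP[t0 th]; apply: df; rewrite !ltW.
- apply: derivable_within_continuous => t; rewrite in_itv /= => tab.
  by have [] := df t tab.
rewrite /f scale0r addr0 subr0 => ->; exists c => //.
by move: ch; rewrite in_itv /= => /andP[? ?]; rewrite !ltW.
Qed.

(** Mean value theorem twice: in the direction [u] for the increment of [f] over [h *: v], then in
    the direction [v] for ['D_u f]. The second difference itself is symmetric in [u] and [v]. *)
Lemma second_difference V (U : set V) (f : V -> R) (x u v : V) (h : R) :
  Ck U 2 f -> 0 < h ->
  (forall a b, 0 <= a <= h -> 0 <= b <= h -> U (x + a *: u + b *: v)) ->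
  exists a b, [/\ 0 <= a <= h, 0 <= b <= h &
    f (x + h *: u + h *: v) - f (x + h *: u) - f (x + h *: v) + f x =
    'D_v ('D_u f) (x + a *: u + b *: v) * h * h].
Proof.
move=> Cf h0 Uh.
have hh : 0 <= h <= h by rewrite lexx ltW.
have h00 : 0 <= (0 : R) <= h by rewrite lexx ltW.
pose g : V -> V := fun y => y + h *: v.
have dg y : is_derive y u g u.
  have dgy : differentiable g y.
    by apply: differentiableD => //; exact: differentiable_cst.
  apply: DeriveDef; first exact/diff_derivable.
  rewrite (_ : g = id + cst (h *: v))// deriveD//.
  by rewrite derive_id derive_cst addr0.
pose F := f \o g - f.
have dgy y : differentiable g y.
  by apply: differentiableD => //; exact: differentiable_cst.
have df a b : 0 <= a <= h -> 0 <= b <= h ->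
    differentiable f (x + a *: u + b *: v).
  by move=> ah bh; exact: Ck_differentiable Cf (Uh a b ah bh).
have df0 a : 0 <= a <= h -> differentiable f (x + a *: u).
  by move=> ah; rewrite -[_ + _](addr0) -(scale0r v); exact: df.
have [|a ah] := @MVT_line V F x u h h0.
  move=> t th; apply: differentiableB; last exact: df0.
  by apply: differentiable_comp => //; exact: df.
have -> : 'D_u F (x + a *: u) =
    'D_u f (x + a *: u + h *: v) - 'D_u f (x + a *: u).
  have dfg : differentiable (f \o g) (x + a *: u).
    by apply: differentiable_comp => //; exact: df.
  rewrite deriveB; [|exact/diff_derivable|exact/diff_derivable/df0].
  rewrite derive_comp//; last exact: df.
  by have [_ ->] := dg (x + a *: u).
have [|b bh ->] := @MVT_line V ('D_u f) (x + a *: u) v h h0.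
  move=> t th; apply: (Ck_differentiable (Ck_derive u Cf)).
  exact: Uh.
move=> e; exists a, b; split=> //; rewrite -e /F !fctE /= /g.
by rewrite opprB addrA addrAC.
Qed.

Lemma eq_continuous_meet V (A B : V -> R) x :
  {for x, continuous A} -> {for x, continuous B} ->
  (forall N, nbhs x N -> exists y z, [/\ N y, N z & A y = B z]) -> A x = B x.
Proof.
move=> /cvgrPdist_lt cA /cvgrPdist_lt cB H.
apply/eqP; rewrite -subr_eq0 -normr_le0; apply/ler_addgt0Pr => e e0.
rewrite add0r; have e2 : 0 < e / 2 by rewrite divr_gt0.
have [y [z [[yA _] [_ zB] yz]]] := H _ (filterI (cA _ e2) (cB _ e2)).
rewrite (_ : A x - B x = A x - A y - (B x - B z)); last by rewrite yz; ring.
apply: le_trans (ler_normB _ _) _.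
by rewrite [leRHS](splitr e) lerD// ltW.
Qed.

Lemma parallelogram_nbhs V (x u v : V) (N : set V) : nbhs x N ->
  exists2 h : R, 0 < h & forall a b, 0 <= a <= h -> 0 <= b <= h ->
    N (x + a *: u + b *: v).
Proof.
move=> /nbhs_ballP[r /= r0 rN]; have s0 : 0 <= `|u| + `|v| by rewrite addr_ge0.
(* The summand 1 keeps the denominator positive when [u] and [v] both vanish. *)
pose h := r / (2 * (1 + (`|u| + `|v|))).
have d0 : 0 < 2 * (1 + (`|u| + `|v|)) by rewrite mulr_gt0// ltr_pwDl.
have h0 : 0 < h by rewrite divr_gt0.
exists h => // a b /andP[a0 ah] /andP[b0 bh]; apply: rN.
rewrite -ball_normE /ball_/= -addrA opprD addrA subrr sub0r normrN.
apply: le_lt_trans (ler_normD _ _) _; rewrite !normrZ !ger0_norm//.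
apply: (@le_lt_trans _ _ (h * (`|u| + `|v|))).
  by rewrite mulrDr lerD// ler_wpM2r.
have -> : r = h * (2 * (1 + (`|u| + `|v|))) by rewrite mulfVK ?gt_eqF.
by rewrite ltr_pM2l//; lra.
Qed.

(** The same second difference, divided by h^2, is a value of either mixed derivative at some point
    of an arbitrarily small parallelogram at [x]; continuity brings the two points back to [x]. *)
Lemma derive_schwarz_real V (U : set V) (f : V -> R) (x u v : V) :
  open U -> Ck U 2 f -> U x -> 'D_v ('D_u f) x = 'D_u ('D_v f) x.
Proof.
move=> oU Cf Ux.
apply: (@eq_continuous_meet V ('D_v ('D_u f)) ('D_u ('D_v f))).
- exact: Ck_continuous (Ck_derive v (Ck_derive u Cf)) Ux.
- exact: Ck_continuous (Ck_derive u (Ck_derive v Cf)) Ux.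
move=> N nN.
have nNU : nbhs x (N `&` U) by apply: filterI => //; exact: open_nbhs_nbhs.
have [h h0 hN] := parallelogram_nbhs u v nNU.
have Uh a b : 0 <= a <= h -> 0 <= b <= h -> U (x + a *: u + b *: v).
  by move=> ah bh; have [] := hN a b ah bh.
have [a [b [ah bh E]]] := second_difference Cf h0 Uh.
have Uh' a' b' : 0 <= a' <= h -> 0 <= b' <= h -> U (x + a' *: v + b' *: u).
  by move=> ? ?; rewrite addrAC; exact: Uh.
have [c [d [ch dh E']]] := second_difference Cf h0 Uh'.
exists (x + a *: u + b *: v), (x + c *: v + d *: u); split.
- by have [] := hN a b ah bh.
- by rewrite addrAC; have [] := hN d c dh ch.
have hn0 : h != 0 by rewrite gt_eqF.
have cancel (p q r s : R) : r = p * h * h -> s = q * h * h -> r = s -> p = q.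
  by move=> -> -> /(mulIf hn0)/(mulIf hn0).
apply: cancel E E' _; rewrite [X in f X - _ - _]addrAC.
have ac (p q r s : R) : p - q - r + s = p - r - q + s by ring.
exact: ac.
Qed.

Lemma derive_coord V n (f : V -> 'rV[R]_n) (i : 'I_n) x v :
  differentiable f x -> 'D_v (fun y => f y 0 i) x = ('D_v f x) 0 i.
Proof.
move=> df; have dc : differentiable (@row_coord R n i) (f x).
  by apply: linear_differentiable; exact: row_coord_continuous.
rewrite -[LHS]/('D_v (row_coord i \o f) x) derive_comp// deriveE//.
by rewrite diff_lin//; exact: row_coord_continuous.
Qed.

Lemma derive_schwarz V n (U : set V) (f : V -> 'rV[R]_n) (x u v : V) :
  open U -> Ck U 2 f -> U x -> 'D_v ('D_u f) x = 'D_u ('D_v f) x.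
Proof.
move=> oU Cf Ux; apply/rowP => i.
pose g : V -> R := fun y => f y 0 i.
have Cg : Ck U 2 g by exact: Ck_coord.
have E w w' : ('D_w ('D_w' f) x) 0 i = 'D_w ('D_w' g) x.
  have d1 : differentiable ('D_w' f) x.
    exact: Ck_differentiable (Ck_derive _ Cf) Ux.
  rewrite -(derive_coord i w d1).
  apply: near_eq_derive; have := open_nbhs_nbhs (conj oU Ux).
  apply: filterS => y Uy.
  by rewrite -(derive_coord i w' (Ck_differentiable Cf Uy)).
apply: etrans (E v u) _; apply: etrans (esym (E u v)).
exact: derive_schwarz_real oU Cg Ux.
Qed.

End Schwarz.

(** * Fubini's theorem on a triangle *)

Section TriangleFubini.
Context {R : realType}.
Local Notation mu := (@lebesgue_measure R).
Local Notation RR := (measurableTypeR R * measurableTypeR R)%type.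

Lemma open_rectangle (O : set (R * R)) (z : R * R) : open O -> O z ->
  exists q : rat * rat * (rat * rat),
    (z.1 \in `](ratr q.1.1), (ratr q.1.2)[) /\
    (z.2 \in `](ratr q.2.1), (ratr q.2.2)[) /\
    (`](ratr q.1.1), (ratr q.1.2)[ `*` `](ratr q.2.1), (ratr q.2.2)[ `<=` O).
Proof.
move=> oO Oz; have /nbhs_ballP[e /= e0 eO] := open_nbhs_nbhs (conj oO Oz).
have rat_near (a : R) : exists q : rat * rat,
    [/\ a - e < ratr q.1, ratr q.1 < a, a < ratr q.2 & ratr q.2 < a + e].
  have [p] : exists p : rat, ratr p \in `]a - e, a[.
    by apply: rat_in_itvoo; rewrite ltrBlDr ltrDl.
  have [q] : exists q : rat, ratr q \in `]a, a + e[.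
    by apply: rat_in_itvoo; rewrite ltrDl.
  rewrite !in_itv /= => /andP[h1 h2] /andP[h3 h4].
  by exists (p, q).
have [q [q1 q2 q3 q4]] := rat_near z.1.
have [p [p1 p2 p3 p4]] := rat_near z.2.
exists (q, p); rewrite !in_itv /= q2 q3 p2 p3; split=> //; split=> //.
move=> [s t] [] /=; rewrite !in_itv /= => /andP[s1 s2] /andP[t1 t2].
by apply: eO; split => /=; rewrite -ball_normE /ball_/= ltr_distlC; apply/andP;
  split; lra.
Qed.

(** The sigma-algebra of the plane is here the product one; an open set belongs to it as the union
    of the countably many rectangles with rational corners that it contains. *)
Lemma open_pair_measurable (O : set (R * R)) :
  open O -> measurable (O : set RR).
Proof.
move=> oO.
pose A (q : rat * rat * (rat * rat)) : set RR :=
  [set z | (`](ratr q.1.1), (ratr q.1.2)[ `*`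
    `](ratr q.2.1), (ratr q.2.2)[ `<=` O) /\
   (`](ratr q.1.1), (ratr q.1.2)[ `*` `](ratr q.2.1), (ratr q.2.2)[) z].
have -> : O = \bigcup_q A q.
  apply/seteqP; split=> [z Oz|z [q _] [sub zq]]; last exact: sub.
  by have [q [q1 [q2 q3]]] := open_rectangle oO Oz; exists q.
apply: countable_bigcupT_measurable; first exact: countableP.
move=> q; have [sub|nsub] := pselect (`](ratr q.1.1 : R), (ratr q.1.2)[ `*`
    `](ratr q.2.1), (ratr q.2.2)[ `<=` O); last first.
  by rewrite (_ : A q = set0)//; apply/seteqP; split=> z // [].
rewrite (_ : A q = `](ratr q.1.1), (ratr q.1.2)[ `*`
    `](ratr q.2.1), (ratr q.2.2)[); last first.
  by apply/seteqP; split=> z //= [].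
by apply: measurableX; exact: measurable_itv.
Qed.

Lemma continuous_pair_measurable (g : R * R -> R) :
  continuous g -> measurable_fun setT (g : RR -> measurableTypeR R).
Proof.
move=> cg.
apply: (measurability _ (measurable_realfun.RGenOInfty.measurableE R)).
move=> _ [_ [a ->] <-]; rewrite setTI.
apply: open_pair_measurable; apply: open_comp => [z _|]; first exact: cg.
exact: interval_open.
Qed.

Definition triangle : set (R * R) := [set z | [/\ 0 <= z.1, 0 <= z.2 & z.1 + z.2 <= 1]].

Lemma triangle_measurable : measurable (triangle : set RR).
Proof.
have h (f : R * R -> R) : continuous f -> measurable ([set z | 0 <= f z] : set RR).
  move=> cf; rewrite (_ : [set z | 0 <= f z] = ~` (f @^-1` `]-oo, 0[)).
    apply: measurableC; apply: open_pair_measurable.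
    by apply: open_comp => [z _|]; [exact: cf|exact: interval_open].
  by apply/seteqP; split=> z /=; rewrite in_itv /= leNgt => /negP.
have -> : triangle = [set z | 0 <= z.1] `&` [set z | 0 <= z.2] `&`
    [set z | 0 <= 1 - z.1 - z.2].
  apply/seteqP; split=> z /=.
    by move=> [? ? ?]; split => //; lra.
  by move=> [[? ?] ?]; split => //; lra.
apply: measurableI; first apply: measurableI; apply: h => z.
- exact: cvg_fst.
- exact: cvg_snd.
- apply: cvgB; last exact: cvg_snd.
  by apply: cvgB; [exact: cvg_cst|exact: cvg_fst].
Qed.

(** A function continuous on the plane is bounded on the compact unit square, which contains the
    triangle and has finite measure. *)
Lemma triangle_integrable (g : R * R -> R) : continuous g ->
  (mu \x mu)%E.-integrable setT (EFin \o (g \_ triangle) : RR -> \bar R).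
Proof.
move=> cg; have -> : EFin \o g \_ triangle = (EFin \o g) \_ triangle.
  by apply/funext => z; rewrite /patch /=; case: ifP.
rewrite -integrable_mkcond; last exact: triangle_measurable.
pose I : set (measurableTypeR R) := `[0, 1]%classic.
have sub : triangle `<=` I `*` I.
  by move=> z [z1 z2 z3]; split; rewrite /I /= in_itv /=; apply/andP; split; lra.
apply: measurable_bounded_integrable.
- exact: triangle_measurable.
- have mT : ((mu \x mu)%E (I `*` I : set RR) < +oo)%E.
    rewrite product_measure1E; [|exact: measurable_itv|exact: measurable_itv].
    have m1 : mu I = 1%E.
      by rewrite lebesgue_measure_itv /= lte_fin ltr01 oppr0 adde0.
    rewrite [X in (X * _)%E]m1 [X in (_ * X)%E]m1 mule1; exact: ltry.
  apply: le_lt_trans mT; apply: le_measure; rewrite ?inE.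
  + exact: triangle_measurable.
  + by apply: measurableX; exact: measurable_itv.
  + exact: sub.
- apply: measurable_funTS; exact: continuous_pair_measurable.
- have cK : compact (`[0, 1] `*` `[0, 1] : set (R * R)).
    by apply: compact_setX; exact: segment_compact.
  have := compact_bounded (continuous_compact (continuous_subspaceT cg) cK).
  move=> [M [Mr MM]]; exists M; split=> // N MN z /sub Kz.
  by apply: (MM N MN); exists z.
Qed.

Lemma triangle_section1 (g : R * R -> R) t : 0 <= t <= 1 ->
  (\int[mu]_u ((g \_ triangle) (t, u))%:E =
   \int[mu]_(u in `[0%R, (1 - t)%R]) (g (t, u))%:E)%E.
Proof.
move=> /andP[t0 t1]; rewrite [RHS]integral_mkcond; apply: eq_integral => u _.
rewrite /patch; case: ifPn => [|] /=; rewrite ?inE ?notin_setE /=.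
  move=> [] /= _ u0 tu; rewrite ifT// inE /= in_itv /=; apply/andP; split; lra.
move=> nT; rewrite ifF//; apply/negbTE; rewrite notin_setE /= in_itv /=.
move=> /andP[u0 u1]; apply: nT; split => //=; lra.
Qed.

Lemma triangle_section1_out (g : R * R -> R) t : ~~ (0 <= t <= 1) ->
  (\int[mu]_u ((g \_ triangle) (t, u))%:E = 0)%E.
Proof.
move=> tn; apply: integral0_eq => u _; rewrite /patch ifF//.
apply/negbTE; rewrite notin_setE => -[/= t0 u0 tu]; move/negP: tn; apply.
by apply/andP; split; lra.
Qed.

Lemma triangle_swap (g : R * R -> R) t u :
  (g \_ triangle) (t, u) = ((g \o (fun z => (z.2, z.1))) \_ triangle) (u, t).
Proof.
rewrite /patch /=; congr (if _ then _ else _); apply/idP/idP; rewrite !inE;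
  by move=> [/= ? ? ?]; split => //=; rewrite addrC.
Qed.

Lemma triangle_fubini_F (g : R * R -> R) :
  (fubini_F mu (EFin \o (g \_ triangle) : RR -> \bar R) =
   (fun t : R => (\int[mu]_(u in `[0%R, (1 - t)%R]) (g (t, u))%:E)%E) \_
     `[0%R, 1%R])%E.
Proof.
apply/funext => t; rewrite /fubini_F /patch; case: ifPn; rewrite ?inE ?notin_setE /=.
  by rewrite in_itv /= => /triangle_section1 <-.
by rewrite in_itv /= => /negP; exact: triangle_section1_out.
Qed.

Lemma triangle_inner_integral (g : R * R -> R) t : continuous g ->
  (\int[mu]_(u in `[0%R, (1 - t)%R]) (g (t, u))%:E =
   (\int[mu]_(u in `[0%R, (1 - t)%R]) g (t, u))%R%:E)%E.
Proof.
move=> cg; rewrite /Rintegral fineK//; apply: integrable_fin_num => //.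
apply: continuous_compact_integrable; first exact: segment_compact.
apply: continuous_subspaceT => u.
have cp : (t, v) @[v --> u] --> (t, u).
  by apply: (@cvg_pair _ _ _ _ (nbhs t) (nbhs u)); [exact: cvg_cst|exact: cvg_id].
exact: cvg_comp cp (cg _).
Qed.

Lemma triangle_integral_integrable (g : R * R -> R) : continuous g ->
  mu.-integrable `[0, 1]
    (EFin \o (fun t => \int[mu]_(u in `[0, 1 - t]) g (t, u))).
Proof.
move=> cg; have := integrable_fubini_F (triangle_integrable cg).
rewrite triangle_fubini_F -integrable_mkcond//.
by apply: eq_integrable => // t _; rewrite triangle_inner_integral.
Qed.

Lemma triangle_iterated_integral (h : R * R -> R) : continuous h ->
  \int[mu]_(t in `[0, 1]) \int[mu]_(u in `[0, 1 - t]) h (t, u) =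
  fine (\int[mu]_t fubini_F mu (EFin \o (h \_ triangle) : RR -> \bar R) t)%E.
Proof.
move=> ch; rewrite {1}/Rintegral triangle_fubini_F -integral_mkcond.
by congr fine; apply: eq_integral => t _; rewrite triangle_inner_integral.
Qed.

Lemma triangle_fubini (g : R * R -> R) : continuous g ->
  \int[mu]_(t in `[0, 1]) \int[mu]_(u in `[0, 1 - t]) g (t, u) =
  \int[mu]_(u in `[0, 1]) \int[mu]_(t in `[0, 1 - u]) g (t, u).
Proof.
move=> cg; pose g' := g \o (fun z => (z.2, z.1)).
have cg' : continuous g'.
  move=> z; have cs : (y.2, y.1) @[y --> z] --> (z.2, z.1).
    by apply: (@cvg_pair _ _ _ _ (nbhs z.2) (nbhs z.1)); [exact: cvg_snd|exact: cvg_fst].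
  exact: cvg_comp cs (cg _).
rewrite !triangle_iterated_integral//.
rewrite [RHS](triangle_iterated_integral cg').
rewrite integral12_prod_meas1; last exact: triangle_integrable.
rewrite -integral21_prod_meas1; last exact: triangle_integrable.
congr fine; apply: eq_integral => u _; apply: eq_integral => t _ /=.
by rewrite triangle_swap.
Qed.

End TriangleFubini.

(** * Fundamental theorem of calculus along a segment *)

Section Line.
Context {R : realType}.
Implicit Types (V W : normedModType R).
Local Notation mu := (@lebesgue_measure R).

Lemma within_continuous_comp (X Y Z : topologicalType) (A : set X) (S : set Y)
    (g : X -> Y) (f : Y -> Z) :
  {within S, continuous f} -> (forall x, A x -> S (g x)) -> continuous g ->
  {within A, continuous (fun x => f (g x))}.
Proof.
move=> /subspace_continuousP cf AS cg; apply/subspace_continuousP => x Ax.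
have cl : g z @[z --> within A (nbhs x)] --> within S (nbhs (g x)).
  move=> N nN; change (nbhs x [set z | A z -> N (g z)]).
  have cgx : nbhs x (g @^-1` [set y | S y -> N y]) := cg x _ nN.
  by apply: filterS cgx => z NS Az; exact: NS (AS z Az).
exact: cvg_comp cl (cf _ (AS x Ax)).
Qed.

Lemma affine_continuous V (y w : V) : continuous (fun t : R => y + t *: w).
Proof.
move=> t.
by have [/derivable1_diffP/differentiable_continuous] := is_derive_affine y w t.
Qed.

Lemma continuous_on_line V W (S : set V) (f : V -> W) (y w : V) (A : set R) :
  {within S, continuous f} -> (forall t, A t -> S (y + t *: w)) ->
  {within A, continuous (fun t => f (y + t *: w))}.
Proof.
by move=> cf AS; apply: within_continuous_comp cf AS _; exact: affine_continuous.
Qed.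

(** Near each parameter of the open interval, [f] coincides along the segment with a smooth
    extension, whose derivative is [df]; at the two ends continuity is enough. *)
Lemma integral_derive_line V (S : set V) (f df : V -> R) (y p q : V) (L : R) :
  convex_subset S -> S p -> S q -> smooth_on S f ->
  (forall x, df x = derive_along S f x (p - q)) -> 0 <= L ->
  (forall t, 0 <= t <= L -> S (y + t *: (p - q))) ->
  \int[mu]_(t in `[0, L]) df (y + t *: (p - q)) =
  f (y + L *: (p - q)) - f y.
Proof.
move=> cS Sp Sq sf dfE; rewrite le_eqVlt => /predU1P[<-|L0] SL.
  by rewrite set_itv1 Rintegral_set1 scale0r addr0 subrr.
set w := p - q in SL *.
have SI (A : set R) : A `<=` `[0, L] -> forall t, A t -> S (y + t *: w).
  by move=> AL t /AL; rewrite /= in_itv /=; exact: SL.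
pose F (t : R) := f (y + t *: w).
pose dF (t : R) := df (y + t *: w).
have cF : {within `[0, L], continuous F}.
  exact: continuous_on_line (smooth_on_continuous sf) (SI _ (@subset_refl _ _)).
have cdF : {within `[0, L], continuous dF}.
  have sdf : smooth_on S df.
    by apply: eq_smooth_on (smooth_on_derive cS Sp Sq sf) => x _; rewrite dfE.
  exact: continuous_on_line (smooth_on_continuous sdf) (SI _ (@subset_refl _ _)).
have dFE (t : R) : t \in `]0, L[ -> is_derive t 1 F (dF t).
  move=> tL; have St : S (y + t *: w).
    by apply: SL; move: tL; rewrite in_itv /= => /andP[? ?]; rewrite !ltW.
  have [G GE] := sf _ St; rewrite /dF dfE (derive_along_convex cS St Sp Sq GE).
  have dG := is_derive_line (local_extension_differentiable GE).
  have [U [[oU Ux] sG eG]] := GE.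
  have nFG : \forall s \near t, G (y + s *: w) = F s.
    have nU := @affine_continuous _ y w t _ (open_nbhs_nbhs (conj oU Ux)).
    have nI : \forall s \near t, s \in `]0, L[ by exact: near_in_itvoo.
    near=> s; apply: eG; last by near: s.
    apply: SL; have : s \in `]0, L[ by near: s.
    by rewrite in_itv /= => /andP[? ?]; rewrite !ltW.
  case: dG => dG <-; apply: DeriveDef.
    by apply/derivable1_diffP; apply: near_eq_differentiable nFG _;
      exact/derivable1_diffP.
  by apply/esym; exact: near_eq_derive.
have := @continuous_FTC2 R dF F 0 L L0 cdF; rewrite /Rintegral => ->//=.
- by rewrite /F scale0r addr0.
- have [c0 cL dL] := proj1 (continuous_within_itvP F L0) cF; split=> //.
  by move=> t /dFE[].
- by move=> t /dFE[_ <-]; rewrite derive1E.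
Unshelve. all: by end_near. Qed.

End Line.

(** * Standard simplices in barycentric coordinates *)

Section StandardSimplex.
Context {R : realType}.
Local Notation E := 'rV[R]_4.
Local Notation mu := (@lebesgue_measure R).

Lemma stdsimplex_vertex k (i : 'I_k.+1) : stdsimplex R k (delta_mx 0 i).
Proof.
split=> [j|]; first by rewrite mxE eqxx; case: eqP.
rewrite (bigD1 i)//= big1 ?mxE ?eqxx ?addr0// => j ji.
by rewrite mxE eqxx (negbTE ji).
Qed.

Lemma stdsimplex_convex k : convex_subset (stdsimplex R k).
Proof.
move=> x y t [x0 x1] [y0 y1] /andP[t0 t1]; split=> [i|].
  rewrite !mxE (_ : _ + _ = (1 - t) * x 0 i + t * y 0 i); last by ring.
  by rewrite addr_ge0// mulr_ge0// subr_ge0.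
under eq_bigr do rewrite !mxE.
by rewrite big_split/= -mulr_sumr sumrB x1 y1 subrr mulr0 addr0.
Qed.

Lemma valL_set_val (T W : Type) (w : W) (S : set T) (f : S -> W) (x : S) :
  'valL_w f (val x) = f x.
Proof. exact: (congr1 (fun g => g f x) (sigL_valL w)). Qed.

Lemma simplex_in_valL k (X : set E) (s : simplex R k) x :
  (forall y, X (s y)) -> stdsimplex R k x -> X ('valL_0 s x).
Proof.
by move=> Xs Sx; rewrite -[x]/(val (SigSub (mem_set Sx))) valL_set_val.
Qed.

Definition vertex3 (i : nat) : 'rV[R]_3 := delta_mx 0 (inord i).

Lemma row_of3 (a b c : R) :
  row_of 3 [:: a; b; c] = a *: vertex3 0 + b *: vertex3 1 + c *: vertex3 2.
Proof.
apply/rowP => j; rewrite !mxE -!val_eqE /= !inordK//.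
by case: j => [[|[|[|//]]] ?] /=; rewrite ?mulr0 ?mulr1 ?addr0 ?add0r.
Qed.

Lemma barycentric3 (t u : R) : row_of 3 [:: 1 - t - u; t; u] =
  vertex3 0 + t *: (vertex3 1 - vertex3 0) + u *: (vertex3 2 - vertex3 0).
Proof.
by apply/rowP => j; rewrite row_of3 !mxE; ring.
Qed.

Lemma vertex3_in i : stdsimplex R 2 (vertex3 i).
Proof. exact: stdsimplex_vertex. Qed.

Lemma row_of3_1 : row_of 3 [:: -1; 1; 0] = vertex3 1 - vertex3 0.
Proof. by rewrite row_of3 scaleN1r scale1r scale0r addr0 addrC. Qed.

Lemma row_of3_2 : row_of 3 [:: -1; 0; 1] = vertex3 2 - vertex3 0.
Proof. by rewrite row_of3 scaleN1r scale1r scale0r addr0 addrC. Qed.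

Lemma barycentric3_in (t u : R) : 0 <= t -> 0 <= u -> t + u <= 1 ->
  stdsimplex R 2 (row_of 3 [:: 1 - t - u; t; u]).
Proof.
move=> t0 u0 tu; split=> [i|].
  by rewrite mxE; case: i => [[|[|[|//]]] ?] /=; lra.
by rewrite !big_ord_recl big_ord0 !mxE /=; ring.
Qed.

Definition clamp (a x : R) : R := Num.max 0 (Num.min a x).

Lemma clamp_continuous (T : topologicalType) (a x : T -> R) :
  continuous a -> continuous x -> continuous (fun z => clamp (a z) (x z)).
Proof.
move=> ca cx.
have cmin : continuous (fun z => Num.min (a z) (x z)).
  move=> z; have p : (a y, x y) @[y --> z] --> (a z, x z).
    by apply: (@cvg_pair _ _ _ _ (nbhs (a z)) (nbhs (x z))); [exact: ca|exact: cx].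
  exact: cvg_comp p (@min_continuous _ R (a z, x z)).
move=> z; have p : (0, Num.min (a y) (x y)) @[y --> z] -->
    ((0 : R), Num.min (a z) (x z)).
  apply: (@cvg_pair _ _ _ _ (nbhs (0 : R)) (nbhs (Num.min (a z) (x z)))).
    exact: cvg_cst.
  exact: cmin.
exact: cvg_comp p (@max_continuous _ R (0, Num.min (a z) (x z))).
Qed.

Lemma clamp_id (a x : R) : 0 <= x <= a -> clamp a x = x.
Proof. by move=> /andP[x0 xa]; rewrite /clamp min_r// max_r. Qed.

Lemma clamp_in (a x : R) : 0 <= a -> 0 <= clamp a x <= a.
Proof. by move=> a0; rewrite /clamp le_max lexx/= ge_max a0 ge_min lexx. Qed.

Lemma barycentric3_continuous (T : topologicalType) (t u : T -> R) :
  continuous t -> continuous u ->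
  continuous (fun z => row_of 3 [:: 1 - t z - u z; t z; u z]).
Proof.
move=> ct cu z; rewrite (_ : (fun _ => _) = fun z => vertex3 0 +
  t z *: (vertex3 1 - vertex3 0) + u z *: (vertex3 2 - vertex3 0)); last first.
  by apply/funext => y; rewrite barycentric3.
apply: cvgD; first apply: cvgD; first exact: cvg_cst.
  by apply: continuousZl; exact: ct.
by apply: continuousZl; exact: cu.
Qed.

(* Retraction of the plane on the triangle: a continuous function on the closed
   simplex becomes one to which Fubini's theorem on the plane applies. *)
Lemma simplex_function_extension (W : topologicalType) (f : 'rV[R]_3 -> W) :
  {within stdsimplex R 2, continuous f} ->
  exists2 g : R * R -> W, continuous g & forall t u, 0 <= t -> 0 <= u ->
    t + u <= 1 -> g (t, u) = f (row_of 3 [:: 1 - t - u; t; u]).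
Proof.
move=> cf; pose a (z : R * R) := clamp 1 z.1.
(* The second bound depends on the first coordinate, so that the pair always falls in the triangle
   and is left unchanged when it is already there. *)
pose b (z : R * R) := clamp (1 - a z) z.2.
have ca : continuous a.
  by apply: clamp_continuous => z; [exact: cvg_cst|exact: cvg_fst].
have cb : continuous b.
  apply: clamp_continuous => z; last exact: cvg_snd.
  by apply: cvgB; [exact: cvg_cst|exact: ca].
have a01 z : 0 <= a z <= 1 by exact: clamp_in.
have b01 z : 0 <= b z <= 1 - a z.
  by apply: clamp_in; rewrite subr_ge0; have /andP[] := a01 z.
pose p z := row_of 3 [:: 1 - a z - b z; a z; b z].
have Sp z : stdsimplex R 2 (p z).
  have /andP[? ?] := a01 z; have /andP[? ?] := b01 z.
  by apply: barycentric3_in => //; lra.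
exists (f \o p).
  apply/continuous_subspace_setT; apply: within_continuous_comp cf _ _ => //.
  exact: barycentric3_continuous.
move=> t u t0 u0 tu; rewrite /= /p /b /a /= (@clamp_id 1 t); last lra.
by rewrite clamp_id//; lra.
Qed.

End StandardSimplex.

(** * Green's formula on the standard triangle *)

Section TriangleGreen.
Context {R : realType}.
Local Notation mu := (@lebesgue_measure R).
Local Notation S2 := (stdsimplex R 2).
Local Notation pt t u := (row_of 3 [:: 1 - t - u; t; u]).

Lemma eq_Rintegral_itv (a b : R) (f g : R -> R) :
  (forall t, a <= t <= b -> f t = g t) ->
  \int[mu]_(t in `[a, b]) f t = \int[mu]_(t in `[a, b]) g t.
Proof. by move=> fg; apply: eq_Rintegral => t; rewrite inE /= in_itv; exact: fg. Qed.

Lemma continuous_itv_integrable (a b : R) (f : R -> R) :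
  {within `[a, b], continuous f} -> mu.-integrable `[a, b] (EFin \o f).
Proof. by move=> cf; apply: continuous_compact_integrable => //; exact: segment_compact. Qed.

Lemma simplex_inner_integrable (f : 'rV[R]_3 -> R) (t : R) :
  {within S2, continuous f} -> 0 <= t ->
  mu.-integrable `[0, 1 - t] (EFin \o (fun u => f (pt t u))).
Proof.
move=> cf t0; apply: continuous_itv_integrable.
apply: within_continuous_comp cf _ _ => [u /=|].
  by rewrite in_itv /= => /andP[u0 u1]; apply: barycentric3_in => //; lra.
by apply: barycentric3_continuous => x; [exact: cvg_cst|exact: cvg_id].
Qed.

Lemma simplex_outer_integrable (f : 'rV[R]_3 -> R) :
  {within S2, continuous f} ->
  mu.-integrable `[0, 1]
    (EFin \o (fun t => \int[mu]_(u in `[0, 1 - t]) f (pt t u))).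
Proof.
move=> /simplex_function_extension[g cg gE].
apply: eq_integrable (triangle_integral_integrable cg) => // t.
rewrite inE /= in_itv /= => /andP[t0 t1]; congr EFin.
by apply: eq_Rintegral_itv => u /andP[u0 u1]; rewrite gE//; lra.
Qed.

Lemma simplex_fubini (f : 'rV[R]_3 -> R) : {within S2, continuous f} ->
  \int[mu]_(t in `[0, 1]) \int[mu]_(u in `[0, 1 - t]) f (pt t u) =
  \int[mu]_(u in `[0, 1]) \int[mu]_(t in `[0, 1 - u]) f (pt t u).
Proof.
move=> /simplex_function_extension[g cg gE].
transitivity (\int[mu]_(t in `[0, 1]) \int[mu]_(u in `[0, 1 - t]) g (t, u)).
  apply: eq_Rintegral_itv => t /andP[t0 t1].
  by apply: eq_Rintegral_itv => u /andP[u0 u1]; rewrite gE//; lra.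
rewrite triangle_fubini//; apply: eq_Rintegral_itv => u /andP[u0 u1].
by apply: eq_Rintegral_itv => t /andP[t0 t1]; rewrite gE//; lra.
Qed.

Lemma simplex_integralB (f g : 'rV[R]_3 -> R) :
  {within S2, continuous f} -> {within S2, continuous g} ->
  \int[mu]_(t in `[0, 1]) \int[mu]_(u in `[0, 1 - t])
    (f (pt t u) - g (pt t u)) =
  \int[mu]_(t in `[0, 1]) \int[mu]_(u in `[0, 1 - t]) f (pt t u) -
  \int[mu]_(t in `[0, 1]) \int[mu]_(u in `[0, 1 - t]) g (pt t u).
Proof.
move=> cf cg; rewrite -RintegralB//; last 2 first.
- exact: simplex_outer_integrable.
- exact: simplex_outer_integrable.
apply: eq_Rintegral_itv => t /andP[t0 t1].
by rewrite RintegralB//; exact: simplex_inner_integrable.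
Qed.

Lemma simplex_path_continuous (f : 'rV[R]_3 -> R) (t u : R -> R) :
  {within S2, continuous f} -> continuous t -> continuous u ->
  (forall s, 0 <= s <= 1 -> [/\ 0 <= t s, 0 <= u s & t s + u s <= 1]) ->
  {within `[0, 1], continuous (fun s => f (pt (t s) (u s)))}.
Proof.
move=> cf ct cu tu.
apply: within_continuous_comp cf _ _ => [s /=|]; last exact: barycentric3_continuous.
by rewrite in_itv /= => /tu[? ? ?]; exact: barycentric3_in.
Qed.

(** Each term is integrated first in the variable in which it is a derivative, which for [dq]
    requires exchanging the two integrals. The inner integrals run from a leg of the triangle to its
    hypotenuse, so the hypotenuse occurs for both [p] and [q] and each leg for one of them. *)
Lemma simplex_green (p q dp dq : 'rV[R]_3 -> R) :
  smooth_on S2 p -> smooth_on S2 q ->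
  (forall x, dp x = derive_along S2 p x (vertex3 2 - vertex3 0)) ->
  (forall x, dq x = derive_along S2 q x (vertex3 1 - vertex3 0)) ->
  \int[mu]_(t in `[0, 1]) \int[mu]_(u in `[0, 1 - t])
    (dq (pt t u) - dp (pt t u)) =
  \int[mu]_(t in `[0, 1])
    (q (row_of 3 [:: 0; 1 - t; t]) - p (row_of 3 [:: 0; 1 - t; t])) -
  \int[mu]_(t in `[0, 1]) q (row_of 3 [:: 1 - t; 0; t]) +
  \int[mu]_(t in `[0, 1]) p (row_of 3 [:: 1 - t; t; 0]).
Proof.
move=> sp sq dpE dqE; have cS := @stdsimplex_convex R 2.
have cdq : {within S2, continuous dq}.
  apply/smooth_on_continuous/eq_smooth_on/(smooth_on_derive cS _ _ sq).
  - by move=> x _; rewrite dqE.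
  - exact: vertex3_in.
  - exact: vertex3_in.
have cdp : {within S2, continuous dp}.
  apply/smooth_on_continuous/eq_smooth_on/(smooth_on_derive cS _ _ sp).
  - by move=> x _; rewrite dpE.
  - exact: vertex3_in.
  - exact: vertex3_in.
rewrite (simplex_integralB cdq cdp) (simplex_fubini cdq).
have cpt (t u : R -> R) (f : 'rV[R]_3 -> R) : smooth_on S2 f -> continuous t ->
    continuous u -> (forall s, 0 <= s <= 1 -> [/\ 0 <= t s, 0 <= u s & t s + u s <= 1]) ->
    mu.-integrable `[0, 1] (EFin \o (fun s => f (pt (t s) (u s)))).
  move=> /smooth_on_continuous cf ct cu tu; apply: continuous_itv_integrable.
  exact: simplex_path_continuous.
have c1B : continuous (fun s : R => 1 - s).
  by move=> s; apply: cvgB; [exact: cvg_cst|exact: cvg_id].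
have c0 : continuous (fun s : R => 0 : R) by move=> s; exact: cvg_cst.
have cid : continuous (fun s : R => s) by move=> s; exact: cvg_id.
have e0 (s : R) : pt (1 - s) s = row_of 3 [:: 0; 1 - s; s].
  by congr (row_of 3 [:: _; _; _]); ring.
have e1 (s : R) : pt 0 s = row_of 3 [:: 1 - s; 0; s].
  by congr (row_of 3 [:: _; _; _]); ring.
have e2 (s : R) : pt s 0 = row_of 3 [:: 1 - s; s; 0].
  by congr (row_of 3 [:: _; _; _]); ring.
have iq0 : mu.-integrable `[0, 1] (EFin \o (fun s => q (row_of 3 [:: 0; 1 - s; s]))).
  apply: eq_integrable (cpt _ _ q sq c1B cid _) => //= [s _|s /andP[? ?]].
    by rewrite e0.
  by split; lra.
have ip0 : mu.-integrable `[0, 1] (EFin \o (fun s => p (row_of 3 [:: 0; 1 - s; s]))).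
  apply: eq_integrable (cpt _ _ p sp c1B cid _) => //= [s _|s /andP[? ?]].
    by rewrite e0.
  by split; lra.
have iq1 : mu.-integrable `[0, 1] (EFin \o (fun s => q (row_of 3 [:: 1 - s; 0; s]))).
  apply: eq_integrable (cpt _ _ q sq c0 cid _) => //= [s _|s /andP[? ?]].
    by rewrite e1.
  by split; lra.
have ip2 : mu.-integrable `[0, 1] (EFin \o (fun s => p (row_of 3 [:: 1 - s; s; 0]))).
  apply: eq_integrable (cpt _ _ p sp cid c0 _) => //= [s _|s /andP[? ?]].
    by rewrite e2.
  by split; lra.
have ip0' : mu.-integrable `[0, 1]
    (EFin \o (fun s => p (row_of 3 [:: 0; s; 1 - s]))).
  apply: eq_integrable (cpt _ _ p sp cid c1B _) => //= [s _|s /andP[? ?]].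
    by congr (p (row_of 3 [:: _; _; _]))%:E; ring.
  by split; lra.
(* Integrating [dp] runs through the hypotenuse in the direction opposite to its parametrization as
   a face. *)
have rev : \int[mu]_(t in `[0, 1]) p (row_of 3 [:: 0; t; 1 - t]) =
    \int[mu]_(t in `[0, 1]) p (row_of 3 [:: 0; 1 - t; t]).
  have c : {within `[0, 1], continuous (fun t => p (row_of 3 [:: 0; t; 1 - t]))}.
    have := simplex_path_continuous (smooth_on_continuous sp) cid c1B.
    rewrite (_ : (fun s => _) = (fun t => p (row_of 3 [:: 0; t; 1 - t]))).
      by apply=> s /andP[? ?]; split; lra.
    by apply/funext => s; congr (p (row_of 3 [:: _; _; _])); ring.
  rewrite (Rintegration_by_substitution_onem _ c) ?ler01 ?lexx//.
  rewrite [X in `[X, 1]](subrr 1 : 1 - 1 = 0).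
  by apply: eq_Rintegral_itv => s _; congr (p (row_of 3 [:: _; _; _])); exact: subKr.
have I1 : \int[mu]_(u in `[0, 1]) \int[mu]_(t in `[0, 1 - u])
      dq (pt t u) =
    \int[mu]_(u in `[0, 1]) (q (row_of 3 [:: 0; 1 - u; u]) -
      q (row_of 3 [:: 1 - u; 0; u])).
  apply: eq_Rintegral_itv => u /andP[u0 u1].
  have pE (t : R) : pt t u = pt 0 u + t *: (vertex3 1 - vertex3 0).
    by rewrite !barycentric3 scale0r addr0 addrAC.
  under eq_Rintegral do rewrite pE.
  rewrite (integral_derive_line cS _ _ sq dqE)//; first 1 last.
  - exact: vertex3_in.
  - exact: vertex3_in.
  - by rewrite subr_ge0.
  - by move=> t /andP[t0 t1]; rewrite -pE; apply: barycentric3_in => //; lra.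
  by rewrite -pE e0 e1.
have I2 : \int[mu]_(t in `[0, 1]) \int[mu]_(u in `[0, 1 - t])
      dp (pt t u) =
    \int[mu]_(t in `[0, 1]) (p (row_of 3 [:: 0; t; 1 - t]) -
      p (row_of 3 [:: 1 - t; t; 0])).
  apply: eq_Rintegral_itv => t /andP[t0 t1].
  have pE (u : R) : pt t u = pt t 0 + u *: (vertex3 2 - vertex3 0).
    by rewrite !barycentric3 scale0r addr0.
  under eq_Rintegral do rewrite pE.
  rewrite (integral_derive_line cS _ _ sp dpE)//; first 1 last.
  - exact: vertex3_in.
  - exact: vertex3_in.
  - by rewrite subr_ge0.
  - by move=> u /andP[u0 u1]; rewrite -pE; apply: barycentric3_in => //; lra.
  by rewrite -pE e2; congr (p _ - _); congr (row_of 3 [:: _; _; _]); ring.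
rewrite I1 I2 [in LHS]RintegralB// [in LHS]RintegralB//.
rewrite [in RHS]RintegralB// rev; ring.
Qed.

End TriangleGreen.

(** * Pull-back of a 1-form and its exterior derivative *)

Section PulledBackForms.
Context {R : realType}.
Implicit Types (V : normedModType R) (n : nat).

Definition dotv n (a v : 'rV[R]_n) : R := \sum_i a 0 i * v 0 i.

Lemma dotvBr n (a u v : 'rV[R]_n) : dotv a (u - v) = dotv a u - dotv a v.
Proof. by rewrite -sumrB; apply: eq_bigr => i _; rewrite !mxE mulrBr. Qed.

Lemma dotvZr n (a v : 'rV[R]_n) c : dotv a (c *: v) = c * dotv a v.
Proof. by rewrite mulr_sumr; apply: eq_bigr => i _; rewrite mxE mulrCA. Qed.

Lemma dotvDl n (a b v : 'rV[R]_n) : dotv (a + b) v = dotv a v + dotv b v.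
Proof. by rewrite -big_split; apply: eq_bigr => i _; rewrite mxE mulrDl. Qed.

Lemma dotvZl n (a v : 'rV[R]_n) c : dotv (c *: a) v = c * dotv a v.
Proof. by rewrite mulr_sumr; apply: eq_bigr => i _; rewrite mxE mulrA. Qed.

Lemma dotv_fctE V n (f g : V -> 'rV[R]_n) :
  (fun x => dotv (f x) (g x)) =
  \sum_i (fun x => f x 0 i) * (fun x => g x 0 i).
Proof. by apply/funext => x; rewrite fct_sumE. Qed.

Lemma Ck_dotv V n (U : set V) k (f g : V -> 'rV[R]_n) : open U ->
  Ck U k f -> Ck U k g -> Ck U k (fun x => dotv (f x) (g x)).
Proof.
move=> oU Cf Cg; rewrite dotv_fctE; apply: Ck_sum => // i _.
by apply: CkM => //; exact: Ck_coord.
Qed.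

Lemma differentiable_dotv V n (f g : V -> 'rV[R]_n) x :
  differentiable f x -> differentiable g x ->
  differentiable (fun x => dotv (f x) (g x)) x.
Proof.
move=> df dg; rewrite dotv_fctE; apply: differentiable_sum => i.
have dc (h : V -> 'rV[R]_n) : differentiable h x ->
    differentiable (fun x => h x 0 i) x.
  move=> dh; apply: (@differentiable_comp _ _ _ _ h (@row_coord R n i)) => //.
  by apply: linear_differentiable; exact: row_coord_continuous.
by apply: differentiableM; exact: dc.
Qed.

Lemma derive_dotv V n (f g : V -> 'rV[R]_n) x v :
  differentiable f x -> differentiable g x ->
  'D_v (fun y => dotv (f y) (g y)) x =
  dotv ('D_v f x) (g x) + dotv (f x) ('D_v g x).
Proof.
move=> df dg.
have dc (h : V -> 'rV[R]_n) i : differentiable h x ->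
    derivable (fun x => h x 0 i) x v.
  move=> dh; apply: diff_derivable.
  apply: (@differentiable_comp _ _ _ _ h (@row_coord R n i)) => //.
  by apply: linear_differentiable; exact: row_coord_continuous.
rewrite dotv_fctE derive_sum; last first.
  by move=> i; apply: derivableM; exact: dc.
rewrite /dotv -big_split; apply: eq_bigr => i _.
rewrite deriveM; [|exact: dc|exact: dc].
rewrite !derive_coord// addrC; congr (_ + _).
by rewrite mulrC.
Qed.

Lemma local_extension_dotv V n (S : set V) (f g F G : V -> 'rV[R]_n) x :
  local_extension S f x F -> local_extension S g x G ->
  local_extension S (fun y => dotv (f y) (g y)) x (fun y => dotv (F y) (G y)).
Proof.
move=> [U [[oU Ux] sF eF]] [U' [[oU' Ux'] sG eG]].
have oUU' := openI oU oU'; exists (U `&` U'); split=> //.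
  by move=> k; apply: Ck_dotv => //;
    [apply: CkW (sF k)|apply: CkW (sG k)] => y [].
by move=> y Sy [Uy Uy']; rewrite eF// eG.
Qed.

Lemma smooth_on_dotv V n (S : set V) (f g : V -> 'rV[R]_n) :
  smooth_on S f -> smooth_on S g -> smooth_on S (fun x => dotv (f x) (g x)).
Proof.
move=> sf sg x Sx; have [F FE] := sf x Sx; have [G GE] := sg x Sx.
by exists (fun y => dotv (F y) (G y)); exact: local_extension_dotv.
Qed.

(** The exterior derivative commutes with pull-back: besides the derivatives of the form, the
    product rule leaves the mixed second derivatives of [f], which cancel by symmetry. The
    right-hand side uses an extension [A] of [alpha], since on the boundary of [S] the velocities of
    [f] need not be velocities of two-sided curves in [X]. *)
Lemma pullback_derive m n (S : set 'rV[R]_m) (X : set 'rV[R]_n)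
    (f : 'rV[R]_m -> 'rV[R]_n) (alpha A : 'rV[R]_n -> 'rV[R]_n)
    (x p q p' q' : 'rV[R]_m) :
  convex_subset S -> S p -> S q -> S p' -> S q' -> S x ->
  smooth_on S f -> (forall y, S y -> X (f y)) ->
  local_extension X alpha (f x) A ->
  let df y := derive_along S f y in
  derive_along S (fun y => dotv (alpha (f y)) (df y (p' - q'))) x (p - q) -
  derive_along S (fun y => dotv (alpha (f y)) (df y (p - q))) x (p' - q') =
  dotv ('D_(df x (p - q)) A (f x)) (df x (p' - q')) -
  dotv ('D_(df x (p' - q')) A (f x)) (df x (p - q)).
Proof.
move=> cS Sp Sq Sp' Sq' Sx sf fX AE df.
have [F FE] := sf x Sx; have dF := local_extension_differentiable FE.
have [U [[oU Ux] sF eF]] := FE.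
have AF := local_extension_comp fX Sx FE AE.
have dAF := local_extension_differentiable AF.
have FfE : F x = f x by rewrite eF.
have dfE a b : S a -> S b -> df x (a - b) = 'D_(a - b) F x.
  by move=> Sa Sb; rewrite /df (derive_along_convex (F := F)).
have D a b a' b' : S a -> S b -> S a' -> S b' ->
    derive_along S (fun y => dotv (alpha (f y)) (df y (a' - b'))) x (a - b) =
    dotv ('D_(df x (a - b)) A (f x)) (df x (a' - b')) +
    dotv (A (f x)) ('D_(a - b) ('D_(a' - b') F) x).
  move=> Sa Sb Sa' Sb'.
  have FE' := local_extension_derive cS Sa' Sb' FE.
  rewrite (derive_along_convex cS Sx Sa Sb (local_extension_dotv AF FE')).
  rewrite derive_dotv//; last exact: local_extension_differentiable FE'.
  rewrite derive_comp//; last by rewrite FfE; exact: local_extension_differentiable AE.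
  by rewrite !dfE//= FfE.
have cancel (a b c d r s : R) : a = c + r -> b = d + s -> r = s ->
    a - b = c - d by move=> -> -> ->; ring.
apply: cancel (D p q p' q' Sp Sq Sp' Sq') (D p' q' p q Sp' Sq' Sp Sq) _.
have sch := derive_schwarz (p' - q') (p - q) oU (sF 2%N) Ux.
exact: (congr1 (dotv (A (f x))) sch).
Qed.

End PulledBackForms.

Lemma Ck_affine_line (R : realType) (V : normedModType R) (U : set R) n (x w : V) :
  Ck U n (fun t : R => x + t *: w).
Proof.
have Cid : Ck setT n (fun t : R => t).
  by apply: (Ck_linmap _ _ (f := idfun)) => t; exact: cvg_id.
apply: (@CkW _ _ _ setT) => //.
exact: CkD openT (Ck_cst _ _ x) (CkZl w openT Cid).
Qed.

(** * Tangent vectors at interior points of a simplex *)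

Section SimplexStokes.
Context {R : realType}.
Local Notation E := 'rV[R]_4.
Local Notation mu := (@lebesgue_measure R).

(** The coordinates of the direction sum to 0, so from a point with positive coordinates the line
    stays in the simplex for small parameters of both signs; its image is the required curve. *)
Lemma simplex_tangent k (X : set E) (s : simplex R k) x (i j : 'I_k.+1) :
  smooth_simplex_in X s -> stdsimplex R k x -> (forall l, 0 < x 0 l) ->
  tangent_space X ('valL_0 s x)
    (derive_along (stdsimplex R k) ('valL_0 s) x (delta_mx 0 i - delta_mx 0 j)).
Proof.
move=> [ss sX] Sx x0; have [F FE] := ss x Sx.
have cS := @stdsimplex_convex R k.
have Si := @stdsimplex_vertex R k i; have Sj := @stdsimplex_vertex R k j.
rewrite (derive_along_convex cS Sx Si Sj FE).
set w := delta_mx 0 i - delta_mx 0 j.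
have [U [[oU Ux] sF eF]] := FE.
pose g (t : R) := x + t *: w.
have cg : continuous g by exact: affine_continuous.
have w0 : \sum_l w 0 l = 0.
  have sd a : \sum_l (delta_mx 0 a : 'rV[R]_k.+1) 0 l = 1.
    by have [] := @stdsimplex_vertex R k a.
  transitivity (\sum_l (delta_mx 0 i : 'rV[R]_k.+1) 0 l -
    \sum_l (delta_mx 0 j : 'rV[R]_k.+1) 0 l); last by rewrite !sd subrr.
  by rewrite -sumrB; apply: eq_bigr => l _; rewrite [LHS]mxE [X in _ + X]mxE.
pose I := U `&` [set y : 'rV[R]_k.+1 | forall l, 0 < y 0 l].
have oI : open I.
  rewrite openE => y [Uy y0]; apply: filterI; first exact: open_nbhs_nbhs.
  have nl l : nbhs y [set z : 'rV[R]_k.+1 | 0 < z 0 l].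
    have c : z 0 l @[z --> y] --> y 0 l by exact: coord_continuous.
    exact: cvgr_gt c 0 (y0 l).
  exact: filter_forall nl.
have SI t : I (g t) -> stdsimplex R k (g t).
  move=> [_ Iy]; split=> [l|]; first exact/ltW/Iy.
  under eq_bigr do rewrite mxE [X in _ + X]mxE.
  by rewrite big_split/= -mulr_sumr w0 mulr0 addr0; case: Sx.
exists (g @^-1` I), (F \o g); split.
- split; first by apply: open_comp => // t _; exact: cg.
  by rewrite /= /g scale0r addr0; split.
- have oJ : open (g @^-1` I) by apply: open_comp => // t _; exact: cg.
  move=> n; apply: Ck_comp (sF n) => //; first by move=> t [].
  exact: Ck_affine_line.
- by move=> t It; rewrite /= eF; [apply: simplex_in_valL sX _|..]; first exact: SI;
    [exact: SI|case: It].
- by rewrite /= /g scale0r addr0 eF.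
- have g0 : g 0 = x by rewrite /g scale0r addr0.
  have [/derivable1_diffP dg eg] := is_derive_affine x w 0.
  rewrite derive_comp//; last by rewrite g0; exact: local_extension_differentiable FE.
  by rewrite eg g0.
Qed.

End SimplexStokes.

Lemma smooth_onB (R : realType) (V W : normedModType R) (S : set V) (f g : V -> W) :
  smooth_on S f -> smooth_on S g -> smooth_on S (fun x => f x - g x).
Proof.
move=> sf sg x Sx; have [F FE] := sf x Sx; have [G GE] := sg x Sx.
exists (-1 *: G + F); have := local_extension_linear (-1) GE FE.
by congr local_extension; apply/funext => y; rewrite !fctE scaleN1r addrC.
Qed.

Lemma derive_along_convexB (R : realType) (V W : normedModType R) (S : set V)
    (f F : V -> W) x p q r :
  convex_subset S -> S x -> S p -> S q -> S r -> local_extension S f x F ->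
  derive_along S f x (p - q) =
  derive_along S f x (p - r) - derive_along S f x (q - r).
Proof.
move=> cS Sx Sp Sq Sr FE; rewrite !(derive_along_convex cS Sx _ _ FE)//.
have dF := local_extension_differentiable FE.
by rewrite -derive_dirB// opprB addrA subrK.
Qed.

(** * Faces of smooth simplices *)

Section Faces.
Context {R : realType}.
Local Notation E := 'rV[R]_4.

(** The inclusion of a face, as a linear map between the ambient coordinate spaces, to which the
    chain rule applies. *)
Definition face_map k (i : 'I_k.+2) (x : 'rV[R]_k.+1) : 'rV[R]_k.+2 :=
  \row_j if unlift i j is Some l then x 0 l else 0.

Lemma face_map_linear_subproof k (i : 'I_k.+2) : linear (face_map i).
Proof.
move=> a x y; apply/rowP => j; rewrite !mxE; case: unlift => [l|]; rewrite ?mxE//.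
by rewrite mulr0 addr0.
Qed.

HB.instance Definition _ k (i : 'I_k.+2) := GRing.isLinear.Build R 'rV[R]_k.+1
  'rV[R]_k.+2 _ (face_map i) (face_map_linear_subproof i).

Lemma face_map_Ck k (i : 'I_k.+2) U n : open U -> Ck U n (face_map i).
Proof.
move=> oU; apply: Ck_rV => // j.
rewrite (_ : (fun x => _) = fun x : 'rV[R]_k.+1 =>
  if unlift i j is Some l then x 0 l else 0); last first.
  by apply/funext => x; rewrite mxE.
case: unlift => [l|]; last exact: Ck_cst.
by apply: (Ck_linmap _ _ (f := @row_coord R _ l)); exact: row_coord_continuous.
Qed.

Lemma face_map_continuous k (i : 'I_k.+2) : continuous (face_map i).
Proof. by move=> x; exact: (face_map_Ck i 0 openT). Qed.

Lemma face_map_in k (i : 'I_k.+2) x :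
  stdsimplex R k x -> stdsimplex R k.+1 (face_map i x).
Proof.
move=> [x0 x1]; split=> [j|]; first by rewrite mxE; case: unlift.
rewrite (bigD1_ord i)//= mxE unlift_none add0r -x1.
by apply: eq_bigr => l _; rewrite mxE liftK.
Qed.

Lemma face_valL k (i : 'I_k.+2) (s : simplex R k.+1) x : stdsimplex R k x ->
  'valL_0 (face i s) x = 'valL_0 s (face_map i x).
Proof. by move=> Sx; rewrite -[x]/(val (SigSub (mem_set Sx))) valL_set_val. Qed.

Lemma face_local_extension k (i : 'I_k.+2) (s : simplex R k.+1) x F :
  stdsimplex R k x ->
  local_extension (stdsimplex R k.+1) ('valL_0 s) (face_map i x) F ->
  local_extension (stdsimplex R k) ('valL_0 (face i s)) x (F \o face_map i).
Proof.
move=> Sx [U [[oU Ux] sF eF]]; have oP : open (face_map i @^-1` U).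
  by apply: open_comp => // y _; exact: face_map_continuous.
exists (face_map i @^-1` U); split=> // [n|y Sy Uy].
  by apply: Ck_comp (sF n) => //; exact: face_map_Ck.
by rewrite face_valL// /= eF//; exact: face_map_in.
Qed.

Lemma smooth_simplex_face k (X : set E) (i : 'I_k.+2) (s : simplex R k.+1) :
  smooth_simplex_in X s -> smooth_simplex_in X (face i s).
Proof.
move=> [ss sX]; split=> [x Sx|x].
  have [F FE] := ss _ (face_map_in i Sx).
  by exists (F \o face_map i); exact: face_local_extension.
apply: simplex_in_valL sX _; apply: face_map_in.
by have := valP x; rewrite inE.
Qed.

Lemma face_derive k (X : set E) (i : 'I_k.+2) (s : simplex R k.+1) x p q :
  smooth_simplex_in X s -> stdsimplex R k x -> stdsimplex R k p ->
  stdsimplex R k q ->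
  derive_along (stdsimplex R k) ('valL_0 (face i s)) x (p - q) =
  derive_along (stdsimplex R k.+1) ('valL_0 s) (face_map i x)
    (face_map i p - face_map i q).
Proof.
move=> [ss _] Sx Sp Sq; have Six := face_map_in i Sx.
have [F FE] := ss _ Six; have FiE := face_local_extension Sx FE.
rewrite (derive_along_convex (@stdsimplex_convex R _) Sx Sp Sq FiE).
rewrite (derive_along_convex (@stdsimplex_convex R _) Six _ _ FE)//;
  [|exact: face_map_in|exact: face_map_in].
have di : differentiable (face_map i) x.
  exact: Ck_differentiable (face_map_Ck i 1 openT) _.
have dF := local_extension_differentiable FE.
have Di : 'D_(p - q) (face_map i) x = face_map i p - face_map i q.
  apply: etrans (deriveE _ di) _.
  have -> := diff_lin x (@face_map_continuous k i).
  exact: linearB.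
apply: etrans (derive_comp _ di dF) _.
exact: (congr1 (fun w => 'D_w F (face_map i x)) Di).
Qed.

End Faces.

(** * Stokes' theorem on a simplex *)

Section SimplexStokes.
Context {R : realType}.
Local Notation E := 'rV[R]_4.
Local Notation mu := (@lebesgue_measure R).
Local Notation S2 := (stdsimplex R 2).
Local Notation pt t u := (row_of 3 [:: 1 - t - u; t; u]).

(** A 1-form is given by a covector field, which can be extended and differentiated like any
    vector-valued function. *)
Definition one_form (alpha : E -> E) (x v : E) : R := dotv (alpha x) v.

(** Meaningful for [u] and [v] tangent to [X]: in other directions [derive_along] may depend on the
    extension it selects. *)
Definition exterior_derivative (X : set E) (alpha : E -> E) (x u v : E) : R :=
  dotv (derive_along X alpha x u) v - dotv (derive_along X alpha x v) u.

Lemma derive_along_tangent (X : set E) (f F : E -> E) x v :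
  local_extension X f x F -> tangent_space X x v ->
  derive_along X f x v = 'D_v F x.
Proof.
move=> FE [I [g [I0 sg gX g0 <-]]].
apply: (derive_alongE (g := g)) FE => //.
  by apply: filterS (open_nbhs_nbhs I0) => t; exact: gX.
apply: DeriveDef => //; apply/diff_derivable.
exact: Ck_differentiable (sg 1%N) I0.2.
Qed.

(** The two endpoints are negligible, and the measurability of [g] is inherited from [f] on the open
    interval. On a simplex, identities between forms are available at interior points, where the
    velocities are tangent vectors. *)
Lemma eq_Rintegral_oo (a b : R) (f g : R -> R) :
  (forall t, a < t < b -> f t = g t) ->
  mu.-integrable `[a, b] (EFin \o f) ->
  \int[mu]_(t in `[a, b]) f t = \int[mu]_(t in `[a, b]) g t.
Proof.
move=> fg fi.
have oo (h : R -> R) : mu.-integrable `]a, b[ (EFin \o h) ->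
    \int[mu]_(t in `[a, b]) h t = \int[mu]_(t in `]a, b[) h t.
  by move=> hi; rewrite /Rintegral integral_itv_bndoo//; exact: measurable_int hi.
have fo : mu.-integrable `]a, b[ (EFin \o f).
  apply: integrableS fi => //; exact: subset_itv_oo_cc.
rewrite !oo//.
  by apply: eq_Rintegral => t; rewrite inE /= in_itv; exact: fg.
by apply: eq_integrable fo => // t; rewrite inE /= in_itv /= => /fg ->.
Qed.

Lemma row_of2_in (a b : R) : 0 <= a -> 0 <= b -> a + b = 1 ->
  stdsimplex R 1 (row_of 2 [:: a; b]).
Proof.
move=> a0 b0 ab; split=> [j|]; first by rewrite mxE; case: j => [[|[|//]] ?].
by rewrite !big_ord_recl big_ord0 !mxE /= addr0.
Qed.

Lemma integral1_face (X : set E) (alpha : E -> E) (s : simplex R 2) (i : 'I_3) :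
  smooth_simplex_in X s ->
  integral1 (one_form alpha) (face i s) =
  \int[mu]_(t in `[0, 1])
    one_form alpha ('valL_0 s (face_map i (row_of 2 [:: 1 - t; t])))
      (derive_along S2 ('valL_0 s) (face_map i (row_of 2 [:: 1 - t; t]))
         (face_map i (row_of 2 [:: 0; 1]) - face_map i (row_of 2 [:: 1; 0]))).
Proof.
move=> sX; apply: eq_Rintegral_itv => t /andP[t0 t1].
rewrite (_ : row_of 2 [:: -1; 1] = row_of 2 [:: 0; 1] - row_of 2 [:: 1; 0]).
  cbv zeta; rewrite (face_derive i sX) ?face_valL//; apply: row_of2_in => //; lra.
by apply/rowP => -[[|[|//]] ?]; rewrite !mxE /= ?sub0r ?subr0.
Qed.

Lemma face_map_row (a b : R) :
  [/\ face_map 0 (row_of 2 [:: a; b]) = row_of 3 [:: 0; a; b],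
      face_map 1 (row_of 2 [:: a; b]) = row_of 3 [:: a; 0; b] &
      face_map 2 (row_of 2 [:: a; b]) = row_of 3 [:: a; b; 0]].
Proof.
by split; apply/rowP => j; rewrite !mxE; case: unliftP => [[[|[|//]] ?] ->|->];
  rewrite /= ?mxE.
Qed.

Lemma alternating_sum3 (F : 'I_3 -> R) :
  \sum_(i < 3) (-1) ^+ i * F i = F 0 - F 1 + F 2.
Proof.
rewrite !big_ord_recl big_ord0.
have -> : fintype.lift ord0 ord0 = 1 :> 'I_3 by exact: val_inj.
have -> : fintype.lift ord0 (fintype.lift ord0 ord0) = 2 :> 'I_3 by exact: val_inj.
by rewrite expr0 expr1 expr2; ring.
Qed.

(** In the coordinates t, u of the triangle the pull-back of the form is [p] dt + [q] du. Green's
    formula applies to it, and at interior points its exterior derivative is the pull-back of that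
    of [alpha]. *)
Lemma stokes_simplex (X : set E) (alpha : E -> E) (s : simplex R 2) :
  smooth_on X alpha -> smooth_simplex_in X s ->
  \sum_(i < 3) (-1) ^+ i * integral1 (one_form alpha) (face i s) =
  integral2 (exterior_derivative X alpha) s.
Proof.
move=> sa sX; have [ss Xs] := sX; set f := 'valL_0 s : 'rV[R]_3 -> E.
have cS := @stdsimplex_convex R 2.
have v3 := @vertex3_in R.
have fX y : S2 y -> X (f y) by move=> Sy; exact: simplex_in_valL Xs Sy.
pose d1 : 'rV[R]_3 := vertex3 1 - vertex3 0.
pose d2 : 'rV[R]_3 := vertex3 2 - vertex3 0.
pose p x : R := dotv (alpha (f x)) (derive_along S2 f x d1).
pose q x : R := dotv (alpha (f x)) (derive_along S2 f x d2).
have sp : smooth_on S2 p.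
  by apply: smooth_on_dotv; [exact: smooth_on_comp fX ss sa|exact: smooth_on_derive].
have sq : smooth_on S2 q.
  by apply: smooth_on_dotv; [exact: smooth_on_comp fX ss sa|exact: smooth_on_derive].
pose dp x : R := derive_along S2 p x d2.
pose dq x : R := derive_along S2 q x d1.
have cdq : {within S2, continuous dq}.
  by apply/smooth_on_continuous; exact: smooth_on_derive.
have cdp : {within S2, continuous dp}.
  by apply/smooth_on_continuous; exact: smooth_on_derive.
have cdqp : {within S2, continuous (fun x => dq x - dp x)}.
  by apply/smooth_on_continuous/smooth_onB; exact: smooth_on_derive.
have interior t u : 0 < t -> 0 < u -> t + u < 1 ->
    dq (pt t u) - dp (pt t u) =
    exterior_derivative X alpha (f (pt t u)) (derive_along S2 f (pt t u) d1)
      (derive_along S2 f (pt t u) d2).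
  move=> t0 u0 tu.
  have Sx : S2 (pt t u) by apply: barycentric3_in; lra.
  have [A AE] := sa _ (fX _ Sx).
  have T i j : tangent_space X (f (pt t u))
      (derive_along S2 f (pt t u) (delta_mx 0 i - delta_mx 0 j)).
    apply: simplex_tangent sX Sx _ => l.
    by rewrite mxE; case: l => [[|[|[|//]]] ?] /=; lra.
  have E1 := derive_along_tangent AE (T (inord 1) (inord 0)).
  have E2 := derive_along_tangent AE (T (inord 2) (inord 0)).
  have PB := pullback_derive cS (v3 1%N) (v3 0%N) (v3 2%N) (v3 0%N) Sx ss fX AE.
  apply: etrans PB _; rewrite /exterior_derivative.
  have sub (a b c d : R) : a = c -> b = d -> a - b = c - d by move=> -> ->.
  apply: sub.
    exact: (congr1 (fun w => dotv w _) (esym E1)).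
  exact: (congr1 (fun w => dotv w _) (esym E2)).
have -> : integral2 (exterior_derivative X alpha) s =
    \int[mu]_(t in `[0, 1]) \int[mu]_(u in `[0, 1 - t])
      (dq (pt t u) - dp (pt t u)).
  rewrite /integral2 row_of3_1 row_of3_2; apply/esym; apply: eq_Rintegral_oo.
    move=> t /andP[t0 t1]; apply: eq_Rintegral_oo.
      by move=> u /andP[u0 u1]; apply: interior => //; lra.
    exact: simplex_inner_integrable cdqp (ltW t0).
  exact: simplex_outer_integrable cdqp.
rewrite (simplex_green sp sq)//.
have F0 t := face_map_row (1 - t) t; have [F1a F1b F1c] := face_map_row 0 1.
have [F2a F2b F2c] := face_map_row 1 0.
have rv1 : row_of 3 [:: 0; 1; 0] = vertex3 1 :> 'rV[R]_3.
  by rewrite row_of3 !scale0r scale1r add0r addr0.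
have rv2 : row_of 3 [:: 0; 0; 1] = vertex3 2 :> 'rV[R]_3.
  by rewrite row_of3 !scale0r scale1r !add0r.
have rv0 : row_of 3 [:: 1; 0; 0] = vertex3 0 :> 'rV[R]_3.
  by rewrite row_of3 !scale0r scale1r !addr0.
have I0 : integral1 (one_form alpha) (face 0 s) = \int[mu]_(t in `[0, 1])
    (q (row_of 3 [:: 0; 1 - t; t]) - p (row_of 3 [:: 0; 1 - t; t])).
  rewrite (integral1_face _ _ sX); apply: eq_Rintegral_itv => t /andP[t0 t1].
  have [-> _ _] := F0 t; rewrite F1a F2a rv1 rv2.
  rewrite /q /p; set x := row_of 3 _.
  have Sx : S2 x.
    have [x0 _ _] := F0 t; rewrite /x -x0; apply: face_map_in.
    by apply: row_of2_in => //; lra.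
  have [F FE] := ss x Sx.
  (* On the side opposite to the vertex 0 the velocity is the difference of the two basic
     directions, whence the integrand [q - p]. *)
  have DB := derive_along_convexB cS Sx (v3 2%N) (v3 1%N) (v3 0%N) FE.
  apply: etrans (congr1 (fun w : E => dotv (alpha (f x)) w) DB) _.
  exact: dotvBr.
have I1 : integral1 (one_form alpha) (face 1 s) =
    \int[mu]_(t in `[0, 1]) q (row_of 3 [:: 1 - t; 0; t]).
  rewrite (integral1_face _ _ sX); apply: eq_Rintegral_itv => t /andP[t0 t1].
  by have [_ -> _] := F0 t; rewrite F1b F2b rv0 rv2.
have I2 : integral1 (one_form alpha) (face 2 s) =
    \int[mu]_(t in `[0, 1]) p (row_of 3 [:: 1 - t; t; 0]).
  rewrite (integral1_face _ _ sX); apply: eq_Rintegral_itv => t /andP[t0 t1].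
  by have [_ _ ->] := F0 t; rewrite F1c F2c rv0 rv1.
by apply: etrans (alternating_sum3 _) _; rewrite I0 I1 I2.
Qed.

End SimplexStokes.

(** * Integration over chains *)

Section Chains.
Context {R : realType} {A : comNzRingType} (iota : {rmorphism A -> R}).
Local Notation E := 'rV[R]_4.
Local Notation chain k := (chain R A k).

Lemma fglift_linear k (W : lmodType A) (f : simplex R k -> W) (a : A)
    (c d : chain k) : fglift f (a *: c + d) = a *: fglift f c + fglift f d.
Proof.
have fB u v : fglift f (u - v) = fglift f u - fglift f v.
  exact: (lift_is_additive f u v).
have f0 : fglift f 0 = 0 by rewrite -(subrr 0) fB subrr.
have fD u v : fglift f (u + v) = fglift f u + fglift f v.
  by rewrite -{1}[v]opprK fB -sub0r fB f0 sub0r opprK.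
rewrite fD; congr (_ + _).
rewrite -[in RHS](freeg_sumE c) -[a *: c]/(fgscale a c) /fgscale.
elim: (dom c) => [|s r IH]; first by rewrite !big_nil f0 scaler0.
by rewrite !big_cons !fD scalerDr IH !liftU scalerA.
Qed.

Lemma fglift0 k (W : lmodType A) (f : simplex R k -> W) : fglift f 0 = 0.
Proof.
by have := fglift_linear f (-1) 0 0; rewrite scaler0 addr0 scaleN1r addNr.
Qed.

Lemma fglift_sum k (W : lmodType A) (f : simplex R k -> W) (c : chain k) :
  fglift f c = \sum_(s <- dom c) coeff s c *: f s.
Proof.
rewrite -{1}(freeg_sumE c); elim: (dom c) => [|s r IH].
  by rewrite !big_nil fglift0.
rewrite !big_cons -[X in X + _]scale1r fglift_linear scale1r liftU.
by congr (_ + _).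
Qed.

Lemma chain_sum k (c : chain k) : c = \sum_(s <- dom c) coeff s c *: << s >>.
Proof.
rewrite -{1}(freeg_sumE c); apply: eq_bigr => s _; apply/eqP/freeg_eqP => s'.
by rewrite coeffZ !coeffU mul1r.
Qed.

Lemma linear_sum_chain k (I : Type) (r : seq I) (P : pred I) (a : I -> A)
    (c : I -> chain k) (W : lmodType A) (phi : chain k -> W) :
  (forall a c d, phi (a *: c + d) = a *: phi c + phi d) ->
  phi (\sum_(i <- r | P i) a i *: c i) = \sum_(i <- r | P i) a i *: phi (c i).
Proof.
move=> lphi; have phi0 : phi 0 = 0.
  by have := lphi (-1) 0 0; rewrite scaler0 addr0 scaleN1r addNr.
by elim/big_rec2: _ => [//|i x y _ <-].
Qed.

Lemma chain_in_sum k (X : set E) (I : eqType) (r : seq I) (a : I -> A)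
    (c : I -> chain k) : (forall i, i \in r -> chain_in X (c i)) ->
  chain_in X (\sum_(i <- r) a i *: c i).
Proof.
elim: r => [|i r IH] Xc; first by rewrite big_nil; exact: chain_in0.
rewrite big_cons; apply: chain_in_linear; first by apply: Xc; rewrite mem_head.
by apply: IH => j jr; apply: Xc; rewrite inE jr orbT.
Qed.

Lemma chain_inU k (X : set E) (s : simplex R k) :
  smooth_simplex_in X s -> chain_in X (<< s >> : chain k).
Proof.
by move=> Xs s'; rewrite mem_dom coeffU mul1r; case: (eqVneq s s') => [<-//|_];
  rewrite /= eqxx.
Qed.

(** Coefficients may cancel, so the support of a sum is not determined by the supports of its terms.
    Summing over a list common to several chains makes the linearity of the integral visible. *)
Lemma chain_integral_sub k (I : simplex R k -> R) (c : chain k)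
    (r : seq (simplex R k)) : uniq r -> {subset dom c <= r} ->
  chain_integral iota I c = \sum_(s <- r) iota (coeff s c) * I s.
Proof.
move=> ur sub; rewrite /chain_integral [RHS](bigID (mem (dom c)))/=.
rewrite [X in _ + X]big1 ?addr0; last first.
  by move=> s /coeff_outdom ->; rewrite rmorph0 mul0r.
rewrite -[RHS]big_filter; apply: perm_big.
apply: uniq_perm; [exact: uniq_dom|exact: filter_uniq|].
by move=> s; rewrite mem_filter; case: (boolP (s \in dom c)) => //= /sub ->.
Qed.

Lemma chain_integral_linear k (I : simplex R k -> R) (a : A) (c d : chain k) :
  chain_integral iota I (a *: c + d) =
  iota a * chain_integral iota I c + chain_integral iota I d.
Proof.
pose r := undup (dom c ++ dom d).
have ur : uniq r by exact: undup_uniq.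
rewrite !(@chain_integral_sub _ _ _ r)//.
- rewrite mulr_sumr -big_split; apply: eq_bigr => s _.
  by rewrite coeffD coeffZ rmorphD rmorphM mulrDl mulrA.
- by move=> s sd; rewrite mem_undup mem_cat sd orbT.
- by move=> s sd; rewrite mem_undup mem_cat sd.
- move=> s /domD_subset; rewrite mem_undup !mem_cat => /orP[/domZ_subset->//|->].
  by rewrite orbT.
Qed.

Lemma chain_integral0 k (I : simplex R k -> R) :
  chain_integral iota I (0 : chain k) = 0.
Proof. by rewrite /chain_integral dom0 big_nil. Qed.

Lemma chain_integralN k (I : simplex R k -> R) (c : chain k) :
  chain_integral iota I (- c) = - chain_integral iota I c.
Proof.
have := chain_integral_linear I (-1) c 0.
by rewrite scaleN1r rmorphN1 mulN1r chain_integral0 !addr0.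
Qed.

Lemma chain_integralU k (I : simplex R k -> R) (s : simplex R k) :
  chain_integral iota I (<< s >> : chain k) = I s.
Proof.
rewrite (@chain_integral_sub _ _ _ [:: s])//.
  by rewrite big_seq1 coeffU eqxx mulr1 rmorph1 mul1r.
by move=> s'; rewrite mem_dom coeffU inE mul1r eq_sym; case: (eqVneq s' s) => //= _;
  rewrite eqxx.
Qed.

Lemma chain_integral_sum k (I : simplex R k -> R) (J : Type) (r : seq J)
    (a : J -> A) (c : J -> chain k) :
  chain_integral iota I (\sum_(j <- r) a j *: c j) =
  \sum_(j <- r) iota (a j) * chain_integral iota I (c j).
Proof.
elim: r => [|j r IH]; first by rewrite !big_nil chain_integral0.
by rewrite !big_cons chain_integral_linear IH.
Qed.

Lemma boundary_sum k (c : chain k.+1) : boundary c =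
  \sum_(s <- dom c) coeff s c *: \sum_(i < k.+2) (-1) ^+ i *: << face i s >>.
Proof. exact: fglift_sum. Qed.

Lemma chain_integral_boundary k (I : simplex R k -> R) (c : chain k.+1) :
  chain_integral iota I (boundary c) =
  chain_integral iota
    (fun s => \sum_(i < k.+2) (-1) ^+ i * I (face i s)) c.
Proof.
rewrite boundary_sum chain_integral_sum; apply: eq_bigr => s _; congr (_ * _).
rewrite chain_integral_sum; apply: eq_bigr => i _.
by rewrite rmorphXn rmorphN1 chain_integralU.
Qed.

Lemma eq_chain_integral k (X : set E) (I J : simplex R k -> R) (c : chain k) :
  chain_in X c -> (forall s, smooth_simplex_in X s -> I s = J s) ->
  chain_integral iota I c = chain_integral iota J c.
Proof.
move=> Xc IJ; rewrite /chain_integral big_seq [RHS]big_seq.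
by apply: eq_bigr => s /Xc /IJ ->.
Qed.

Lemma stokes (X : set E) (alpha : E -> E) (c : chain 2) :
  smooth_on X alpha -> chain_in X c ->
  chain_integral iota (integral1 (one_form alpha)) (boundary c) =
  chain_integral iota (integral2 (exterior_derivative X alpha)) c.
Proof.
move=> sa Xc; rewrite chain_integral_boundary.
by apply: eq_chain_integral Xc _ => s Xs; exact: stokes_simplex.
Qed.

Lemma boundary_in k (X : set E) (c : chain k.+1) :
  chain_in X c -> chain_in X (boundary c).
Proof.
move=> Xc; rewrite boundary_sum; apply: chain_in_sum => s /Xc Xs.
by apply: chain_in_sum => i _; apply: chain_inU; exact: smooth_simplex_face.
Qed.

Lemma boundaryU k (s : simplex R k.+1) : boundary (<< s >> : chain k.+1) =
  \sum_(i < k.+2) (-1) ^+ i *: << face i s >>.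
Proof. by rewrite /boundary liftU scale1r. Qed.

End Chains.

(** * The boundary of a boundary in dimension two *)

Section LowDimensionalFaces.
Context {R : realType} {A : comNzRingType}.
Local Notation E := 'rV[R]_4.
Local Notation chain k := (chain R A k).

Lemma sub_row_of2 (x : 'rV[R]_2) : x = row_of 2 [:: x 0 0; x 0 1].
Proof.
by apply/rowP => -[[|[|//]] ?]; rewrite !mxE /=; congr (x 0 _); exact: val_inj.
Qed.

Lemma stdsimplex0 (x : stdsimplex R 0) : val x = row_of 1 [:: 1].
Proof.
have := valP x; rewrite inE => -[_]; rewrite big_ord1 => x1.
by apply/rowP => i; rewrite (ord1 i) x1 mxE.
Qed.

Lemma face_map_row1 (a : R) : face_map 0 (row_of 1 [:: a]) = row_of 2 [:: 0; a] /\
  face_map 1 (row_of 1 [:: a]) = row_of 2 [:: a; 0].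
Proof.
by split; apply/rowP => j; rewrite !mxE; case: unliftP => [[[|//] ?] ->|->];
  rewrite /= ?mxE.
Qed.

Lemma faceE k (i : 'I_k.+2) (s : simplex R k.+1) x :
  face i s x = 'valL_0 s (face_map i (val x)).
Proof. by []. Qed.

Lemma face_faceE k (i : 'I_k.+3) (j : 'I_k.+2) (s : simplex R k.+2) x :
  face j (face i s) x = 'valL_0 s (face_map i (face_map j (val x))).
Proof.
rewrite faceE face_valL//; apply: face_map_in.
by have := valP x; rewrite inE.
Qed.

Lemma boundary1 (s : simplex R 1) :
  boundary (<< s >> : chain 1) = << face 0 s >> - << face 1 s >>.
Proof.
rewrite boundaryU !big_ord_recl big_ord0 expr0 expr1 scale1r scaleN1r addr0.
by congr (_ - << face _ s >>); exact: val_inj.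
Qed.

Lemma boundary2 (s : simplex R 2) :
  boundary (<< s >> : chain 2) = << face 0 s >> - << face 1 s >> + << face 2 s >>.
Proof.
rewrite boundaryU !big_ord_recl big_ord0 expr0 expr1 scale1r scaleN1r addr0.
rewrite expr2 mulrNN mulr1 scale1r addrA.
by congr (_ - << face _ s >> + << face _ s >>); exact: val_inj.
Qed.

(** The six ends of the three sides match in pairs; two of them are compared at the only point of
    the standard 0-simplex. *)
Lemma boundary_boundary (c : chain 2) : boundary (boundary c) = 0.
Proof.
rewrite (boundary_sum c).
apply: etrans (linear_sum_chain _ _ _ _ (@boundary_linear R A 0)) _.
rewrite big1// => s _; rewrite -boundaryU boundary2.
have bB (u v : chain 1) : boundary (u - v) = boundary u - boundary v.
  by rewrite -scaleN1r addrC boundary_linear scaleN1r addrC.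
have bD (u v : chain 1) : boundary (u + v) = boundary u + boundary v.
  by rewrite -[u]scale1r boundary_linear !scale1r.
rewrite bD bB !boundary1.
have [F0 F1] := face_map_row1 1; have [G0 G1 G2] := face_map_row 0 (1 : R).
have [H0 H1 H2] := face_map_row (1 : R) 0.
have -> : face 0 (face 0 s) = face 0 (face 1 s).
  by apply/funext => x; rewrite !face_faceE stdsimplex0 F0 G0 G1.
have -> : face 1 (face 0 s) = face 0 (face 2 s).
  by apply/funext => x; rewrite !face_faceE stdsimplex0 F0 F1 H0 G2.
have -> : face 1 (face 1 s) = face 1 (face 2 s).
  by apply/funext => x; rewrite !face_faceE stdsimplex0 F1 H1 H2.
have abel (V : zmodType) (u v w : V) : u - v - (u - w) + (v - w) = 0.
  have -> : u - v - (u - w) = w - v by rewrite opprB addrC addrA subrK.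
  by rewrite addrA subrK subrr.
by rewrite abel scaler0.
Qed.

End LowDimensionalFaces.

(** * Filling a cycle by a cone *)

Section ConeFilling.
Context {R : realType} {A : comNzRingType}.
Local Notation E := 'rV[R]_4.
Local Notation chain k := (chain R A k).
Context (X Y C : set E) (nrm : E -> E) (q : E).
Context (nrm_smooth : smooth_on C nrm)
  (XC : forall x (t : R), X x -> 0 <= t <= 1 -> C ((1 - t) *: x + t *: q))
  (nrmY : forall y, C y -> Y (nrm y)) (nrm_id : forall x, X x -> nrm x = x)
  (nrm_q : nrm q = q) (Cq : C q).

(** The ambient segment from [x] to the apex [q], brought back by [nrm]. In the application [X] is
    the surface, [Y] the space form, and [nrm] the radial projection, smooth on [C]. *)
Definition cone_map (t : R) (x : E) : E := nrm ((1 - t) *: x + t *: q).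

Definition pulled_simplex m k (s : simplex R k) (t : 'rV[R]_m.+1 -> R)
    (l : 'rV[R]_m.+1 -> 'rV[R]_k.+1) : simplex R m :=
  fun x => cone_map (t (val x)) ('valL_0 s (l (val x))).

Lemma pulled_simplex_in m k (s : simplex R k) (t : 'rV[R]_m.+1 -> R)
    (l : 'rV[R]_m.+1 -> 'rV[R]_k.+1) :
  smooth_simplex_in X s -> smooth_on (stdsimplex R m) t ->
  smooth_on (stdsimplex R m) l ->
  (forall x, stdsimplex R m x -> 0 <= t x <= 1) ->
  (forall x, stdsimplex R m x -> stdsimplex R k (l x)) ->
  smooth_simplex_in Y (pulled_simplex s t l).
Proof.
move=> [ss sX] st sl t01 lS.
have Cx x : stdsimplex R m x ->
    C ((1 - t x) *: 'valL_0 s (l x) + t x *: q).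
  by move=> Sx; apply: XC; [apply: simplex_in_valL sX _; exact: lS|exact: t01].
split=> [|x]; last by apply/nrmY/Cx; have := valP x; rewrite inE.
pose g x := (1 - t x) *: 'valL_0 s (l x) + t x *: q.
apply: (@eq_smooth_on _ _ _ _ (nrm \o g)).
  by move=> x Sx; rewrite -[x]/(val (SigSub (mem_set Sx))) valL_set_val.
apply: smooth_on_comp Cx _ nrm_smooth.
apply: smooth_onD; last exact: smooth_onZl.
apply: smooth_onZ; first by apply: smooth_onB => //; exact: smooth_on_cst.
exact: smooth_on_comp lS sl ss.
Qed.

Lemma face_pulled_simplex m k (s : simplex R k) t l (i : 'I_m.+2) x :
  face i (pulled_simplex s t l) x =
  cone_map (t (face_map i (val x))) ('valL_0 s (l (face_map i (val x)))).
Proof.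
rewrite faceE; have Sx : stdsimplex R m.+1 (face_map i (val x)).
  by apply: face_map_in; have := valP x; rewrite inE.
by rewrite -[face_map _ _]/(val (SigSub (mem_set Sx))) valL_set_val.
Qed.

(** The cone over a 1-simplex is parametrized by a square with one side collapsed to [q], cut along
    a diagonal into [cone_upper] and [cone_lower]. A single triangle with a vertex at the apex would
    evaluate [s] at barycentric coordinates divided by 1 - t, and smoothness could fail at the
    apex. *)
Definition cone_point (s : simplex R 0) : simplex R 1 :=
  pulled_simplex s (fun y => y 0 1) (fun=> row_of 1 [:: 1]).
Definition cone_upper (s : simplex R 1) : simplex R 2 :=
  pulled_simplex s (fun x => x 0 1 + x 0 2)
    (fun x => row_of 2 [:: x 0 0 + x 0 1; x 0 2]).
Definition cone_lower (s : simplex R 1) : simplex R 2 :=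
  pulled_simplex s (fun x => x 0 2)
    (fun x => row_of 2 [:: x 0 0; x 0 1 + x 0 2]).
Definition cone_apex k : simplex R k := fun=> q.

(** Of the six sides, the diagonal occurs twice and cancels, one is collapsed to [q], one is [s],
    and two are the segments joining the ends of [s] to [q]. *)
Lemma cone_prism_boundary (s : simplex R 1) : smooth_simplex_in X s ->
  boundary (<< cone_upper s >> - << cone_lower s >> : chain 2) =
  << @cone_apex 1%N >> - << s >> -
  (<< cone_point (face 0 s) >> - << cone_point (face 1 s) >>).
Proof.
move=> [ss sX].
have bB (u v : chain 2) : boundary (u - v) = boundary u - boundary v.
  by rewrite -scaleN1r addrC boundary_linear scaleN1r addrC.
rewrite bB !boundary2.
have x2 (x : stdsimplex R 1) : val x = row_of 2 [:: (val x) 0 0; (val x) 0 1].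
  exact: sub_row_of2.
have x01 (x : stdsimplex R 1) : (val x) 0 0 + (val x) 0 1 = 1.
  have := valP x; rewrite inE => -[_]; rewrite !big_ord_recl big_ord0 addr0 => <-.
  by congr (_ + (val x) 0 _); exact: val_inj.
have fm (x : stdsimplex R 1) :
    [/\ face_map 0 (val x) = row_of 3 [:: 0; (val x) 0 0; (val x) 0 1],
    face_map 1 (val x) = row_of 3 [:: (val x) 0 0; 0; (val x) 0 1] &
    face_map 2 (val x) = row_of 3 [:: (val x) 0 0; (val x) 0 1; 0]].
  have [e0 e1 e2] := face_map_row ((val x) 0 0) ((val x) 0 1).
  by rewrite -x2 in e0 e1 e2.
have pE (i : 'I_2) (x : stdsimplex R 1) : cone_point (face i s) x =
    cone_map ((val x) 0 1) ('valL_0 s (face_map i (row_of 1 [:: 1]))).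
  rewrite /cone_point /pulled_simplex; congr cone_map.
  apply: face_valL; split=> [j|]; last by rewrite big_ord1 mxE.
  by rewrite (ord1 j) mxE ler01.
have [F0 F1] := face_map_row1 (1 : R).
have -> : face 0 (cone_upper s) = @cone_apex 1.
  apply/funext => x; rewrite face_pulled_simplex.
  have [-> _ _] := fm x.
  by rewrite !mxE /= x01 /cone_map subrr scale0r scale1r add0r nrm_q.
have -> : face 1 (cone_upper s) = face 1 (cone_lower s).
  apply/funext => x; rewrite !face_pulled_simplex.
  have [_ -> _] := fm x.
  by rewrite !mxE /= add0r addr0.
have -> : face 2 (cone_upper s) = cone_point (face 1 s).
  apply/funext => x; rewrite pE face_pulled_simplex.
  have [_ _ ->] := fm x.
  by rewrite !mxE /= addr0 x01 F1.
have -> : face 0 (cone_lower s) = cone_point (face 0 s).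
  apply/funext => x; rewrite pE face_pulled_simplex.
  have [-> _ _] := fm x.
  by rewrite !mxE /= x01 F0.
have -> : face 2 (cone_lower s) = s.
  apply/funext => x; rewrite face_pulled_simplex.
  have [_ _ ->] := fm x.
  rewrite !mxE /= addr0 -x2 /cone_map subr0 scale1r scale0r addr0.
  have vx : 'valL_0 s (val x) = s x by exact: valL_set_val.
  by move: vx; rewrite /valL_ /= => ->; rewrite nrm_id.
have abel (V : zmodType) (a b c d e : V) :
    a - b + c - (d - b + e) = a - e - (d - c).
  rewrite opprD opprB addrA (addrAC a) addrA subrK.
  by rewrite opprB (addrAC a (- e)) addrA.
exact: abel.
Qed.

Lemma cone_filling (c : chain 1) : chain_in X c -> boundary c = 0 ->
  exists2 K : chain 2, chain_in Y K & boundary K = - c.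
Proof.
move=> Xc bc; have smooth_on_add m (a b : 'rV[R]_m.+1 -> R) : smooth_on (stdsimplex R m) a ->
    smooth_on (stdsimplex R m) b -> smooth_on (stdsimplex R m) (fun x => a x + b x).
  by move=> sa sb; exact: smooth_onD sa sb.
(* [N] is the total coefficient. Each prism leaves a constant 1-simplex at [q], which is the
   boundary of the constant 2-simplex because 1 - 1 + 1 = 1; hence the correction by [N] such
   simplices. *)
pose N := \sum_(s <- dom c) coeff s c.
pose prism (s : simplex R 1) : chain 2 := << cone_upper s >> - << cone_lower s >>.
pose fan (s : simplex R 0) : chain 1 := << cone_point s >>.
pose P := \sum_(s <- dom c) coeff s c *: prism s.
have smooth_coord m (i : 'I_m.+1) :
    smooth_on (stdsimplex R m) (fun x : 'rV[R]_m.+1 => x 0 i).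
  apply: smooth_on_coord; apply: (smooth_on_linmap _ (f := idfun)) => x.
  exact: cvg_id.
have smooth_row2 m (a b : 'rV[R]_m.+1 -> R) : smooth_on (stdsimplex R m) a ->
    smooth_on (stdsimplex R m) b ->
    smooth_on (stdsimplex R m) (fun x => row_of 2 [:: a x; b x]).
  move=> sa sb; apply: smooth_on_rV => -[[|[|//]] ?].
    by apply: eq_smooth_on sa => x _; rewrite mxE.
  by apply: eq_smooth_on sb => x _; rewrite mxE.
have sum3 (x : 'rV[R]_3) : stdsimplex R 2 x -> x 0 0 + x 0 1 + x 0 2 = 1.
  move=> [_]; rewrite !big_ord_recl big_ord0 addr0 addrA => <-.
  by congr (_ + x 0 _ + x 0 _); exact: val_inj.
have upper_in s : smooth_simplex_in X s -> smooth_simplex_in Y (cone_upper s).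
  move=> Xs; apply: pulled_simplex_in => //.
  - by apply: smooth_on_add; exact: smooth_coord.
  - apply: smooth_row2 => //.
    by apply: smooth_on_add; exact: smooth_coord.
  - move=> x Sx; have := sum3 x Sx; have [x0 _] := Sx.
    by have := x0 0; have := x0 1; have := x0 2; move: (x 0 0) (x 0 1) (x 0 2) => a b d; lra.
  - move=> x Sx; have := sum3 x Sx; have [x0 _] := Sx => e.
    by apply: row_of2_in => //; exact: addr_ge0.
have lower_in s : smooth_simplex_in X s -> smooth_simplex_in Y (cone_lower s).
  move=> Xs; apply: pulled_simplex_in => //.
  - apply: smooth_row2 => //.
    by apply: smooth_on_add; exact: smooth_coord.
  - move=> x Sx; have := sum3 x Sx; have [x0 _] := Sx.
    by have := x0 0; have := x0 1; have := x0 2; move: (x 0 0) (x 0 1) (x 0 2) => a b d; lra.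
  - move=> x Sx; have := sum3 x Sx; have [x0 _] := Sx => e.
    by apply: row_of2_in; rewrite ?addr_ge0// addrA.
exists (P - N *: << @cone_apex 2%N >>).
  rewrite addrC -scaleNr; apply: chain_in_linear.
    apply: chain_inU; split=> [|x]; last by rewrite /cone_apex -nrm_q; exact: nrmY.
    apply: (@eq_smooth_on _ _ _ _ (fun=> q)) => [x Sx|]; last exact: smooth_on_cst.
    by rewrite -[x]/(val (SigSub (mem_set Sx))) valL_set_val.
  rewrite /P; apply: chain_in_sum => s /Xc Xs; rewrite /prism addrC -scaleN1r.
  by apply: chain_in_linear; apply: chain_inU; [exact: lower_in|exact: upper_in].
have bPN : boundary (P - N *: << @cone_apex 2%N >>) =
    boundary P - N *: boundary << @cone_apex 2%N >>.
  by rewrite addrC -scaleNr boundary_linear scaleNr addrC.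
have apexE k (i : 'I_k.+2) : face i (@cone_apex k.+1) = @cone_apex k.
  apply/funext => x; rewrite faceE.
  have Sx : stdsimplex R k.+1 (face_map i (val x)).
    by apply: face_map_in; have := valP x; rewrite inE.
  by rewrite -[face_map _ _]/(val (SigSub (mem_set Sx))) valL_set_val.
have bP : boundary P = N *: << @cone_apex 1%N >> - c.
  rewrite /P (linear_sum_chain _ _ _ _ (@boundary_linear R A 1)).
  transitivity (\sum_(s <- dom c) coeff s c *: (<< @cone_apex 1%N >> -
      << s >> - fglift fan (boundary << s >>))).
    rewrite big_seq [RHS]big_seq; apply: eq_bigr => s /Xc Xs.
    rewrite (cone_prism_boundary Xs) boundary1; congr (_ *: (_ - _)).
    rewrite -[in RHS]scaleN1r [in RHS]addrC fglift_linear scaleN1r !liftU !scale1r.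
    by rewrite addrC.
  transitivity (\sum_(s <- dom c) coeff s c *: << @cone_apex 1%N >> -
    \sum_(s <- dom c) coeff s c *: << s >> -
    \sum_(s <- dom c) coeff s c *: fglift fan (boundary << s >>)).
    by rewrite -!sumrB; apply: eq_bigr => s _; rewrite !scalerBr.
  rewrite -scaler_suml -chain_sum.
  (* The segments towards [q] form the image of [boundary c] under the linear extension of [fan], so
     they disappear for a cycle. *)
  have <- := linear_sum_chain (dom c) xpredT (fun s => coeff s c)
    (fun s => boundary << s >>) (fglift_linear fan).
  have <- := linear_sum_chain (dom c) xpredT (fun s => coeff s c)
    (fun s => << s >>) (@boundary_linear R A 0).
  by rewrite -chain_sum bc fglift0 subr0.
by rewrite bPN bP boundary2 !apexE subrr add0r addrC addKr.
Qed.

End ConeFilling.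

(** * Determinants and inner products in dimension four *)

Section FourDimensionalAlgebra.
Context {R : realType}.
Local Notation E := 'rV[R]_4.
Implicit Types (M : spaceform) (a b c d f n u v w x : E).

Definition rows4 a b c d : 'M[R]_4 := \matrix_(i < 4) [:: a; b; c; d]`_i.

Definition det4 a b c d : R := \det (rows4 a b c d).

(** Indices in [nat] give each coordinate a single syntactic form, so that [ring] can decide
    polynomial identities in them. *)
Definition entry (x : E) (i : nat) : R := x 0 (inord i).

Lemma entryE x (i : 'I_4) : x 0 i = entry x i.
Proof. by rewrite /entry inord_val. Qed.

Lemma entry_row_of (s : seq R) i : (i < 4)%N -> entry (row_of 4 s) i = s`_i.
Proof. by move=> i4; rewrite /entry mxE inordK. Qed.

Lemma entryD x y i : entry (x + y) i = entry x i + entry y i.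
Proof. by rewrite /entry mxE. Qed.

Lemma entryZ k x i : entry (k *: x) i = k * entry x i.
Proof. by rewrite /entry mxE. Qed.

Lemma row4P x y : (forall i, (i < 4)%N -> entry x i = entry y i) -> x = y.
Proof. by move=> xy; apply/rowP => i; rewrite !entryE xy. Qed.

Lemma det_expand_nat (n : nat) (f : nat -> nat -> R) :
  \det (\matrix_(i < n.+1, j < n.+1) f i j) = \sum_(k < n.+1)
    f 0%N k * ((-1) ^+ k * \det (\matrix_(i < n, j < n) f i.+1 (bump k j))).
Proof.
rewrite (expand_det_row _ 0); apply: eq_bigr => k _; rewrite mxE /cofactor add0n.
congr (_ * (_ * \det _)); by apply/matrixP => i j; rewrite !mxE.
Qed.

Lemma det2_nat (f : nat -> nat -> R) : \det (\matrix_(i < 2, j < 2) f i j) =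
  f 0%N 0%N * f 1%N 1%N - f 0%N 1%N * f 1%N 0%N.
Proof.
rewrite (@det_expand_nat 1 f) !big_ord_recl big_ord0 !det_mx11 !mxE /= /bump /=.
by ring.
Qed.

Lemma det3_nat (f : nat -> nat -> R) : \det (\matrix_(i < 3, j < 3) f i j) =
  let m j k := f 1%N j * f 2%N k - f 1%N k * f 2%N j in
  f 0%N 0%N * m 1%N 2%N - f 0%N 1%N * m 0%N 2%N + f 0%N 2%N * m 0%N 1%N.
Proof.
rewrite (@det_expand_nat 2 f) !big_ord_recl big_ord0.
do 3! (rewrite (det2_nat (fun i j => f i.+1 (bump _ j)))).
by rewrite /= /bump /=; ring.
Qed.

Lemma det4_nat (f : nat -> nat -> R) : \det (\matrix_(i < 4, j < 4) f i j) =
  let m i j := f 2%N i * f 3%N j - f 2%N j * f 3%N i in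
  let m3 i j k := f 1%N i * m j k - f 1%N j * m i k + f 1%N k * m i j in
  f 0%N 0%N * m3 1%N 2%N 3%N - f 0%N 1%N * m3 0%N 2%N 3%N +
  f 0%N 2%N * m3 0%N 1%N 3%N - f 0%N 3%N * m3 0%N 1%N 2%N.
Proof.
rewrite (@det_expand_nat 3 f) !big_ord_recl big_ord0.
do 4! (rewrite (det3_nat (fun i j => f i.+1 (bump _ j)))).
by rewrite /= /bump /=; ring.
Qed.

Lemma det4E a b c d : det4 a b c d =
  let m2 i j := entry c i * entry d j - entry c j * entry d i in
  let m3 i j k := entry b i * m2 j k - entry b j * m2 i k + entry b k * m2 i j in
  entry a 0 * m3 1%N 2%N 3%N - entry a 1 * m3 0%N 2%N 3%N +
  entry a 2 * m3 0%N 1%N 3%N - entry a 3 * m3 0%N 1%N 2%N.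
Proof.
rewrite /det4 (_ : rows4 a b c d =
    \matrix_(i < 4, j < 4) entry [:: a; b; c; d]`_i j); last first.
  by apply/matrixP => i j; rewrite !mxE entryE.
exact: (det4_nat (fun i j => entry [:: a; b; c; d]`_i j)).
Qed.

Lemma ipE M x y : ip M x y =
  (if M is Hyperbolic then -1 else 1) * (entry x 0 * entry y 0) +
  (entry x 1 * entry y 1 + entry x 2 * entry y 2 + entry x 3 * entry y 3).
Proof.
rewrite /ip (entryE x) (entryE y); congr (_ + _).
rewrite !big_mkcond !big_ord_recl big_ord0 /= !entryE /=; ring.
Qed.

Lemma ipDl M x y z : ip M (x + y) z = ip M x z + ip M y z.
Proof. by rewrite !ipE !entryD; ring. Qed.

Lemma ipDr M x y z : ip M z (x + y) = ip M z x + ip M z y.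
Proof. by rewrite !ipE !entryD; ring. Qed.

Lemma ipZr M k x z : ip M z (k *: x) = k * ip M z x.
Proof. by rewrite !ipE !entryZ; ring. Qed.

(** Cramer's rule cleared of denominators, a polynomial identity that holds for dependent vectors
    too. Pairing it with a suitable vector gives [det4_orthogonal] and [det4_wedge]. *)
Lemma det4_cramer a b c d x : det4 a b c d *: x =
  det4 x b c d *: a + det4 a x c d *: b + det4 a b x d *: c + det4 a b c x *: d.
Proof.
apply: row4P => i i4; rewrite !entryD !entryZ !det4E /=.
by case: i i4 => [|[|[|[|//]]]] _; ring.
Qed.

Definition gram M : 'M[R]_4 :=
  diag_mx (row_of 4 [:: if M is Hyperbolic then -1 else 1; 1; 1; 1]).

Lemma ip_mx M x y : ip M x y = (x *m gram M *m y^T) 0 0.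
Proof.
rewrite mxE !big_ord_recl big_ord0 /gram !mul_mx_diag !mxE /= ipE !entryE.
by case: M; rewrite /= /bump /= ?add1n; ring.
Qed.

Definition comb (a b c d : E) (s : seq R) : E :=
  s`_0 *: a + s`_1 *: b + s`_2 *: c + s`_3 *: d.

Lemma comb_mx a b c d s : comb a b c d s = row_of 4 s *m rows4 a b c d.
Proof.
apply/rowP => j; rewrite [RHS]mxE !big_ord_recl big_ord0 /comb !mxE /=; ring.
Qed.

Lemma det4_comb a b c d (r s t u : seq R) :
  det4 (comb a b c d r) (comb a b c d s) (comb a b c d t) (comb a b c d u) =
  det4 (row_of 4 r) (row_of 4 s) (row_of 4 t) (row_of 4 u) * det4 a b c d.
Proof.
rewrite /det4 -det_mulmx; congr (\det _); apply/row_matrixP => i.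
rewrite row_mul !rowK.
by case: i => [[|[|[|[|//]]]] ?] /=; rewrite comb_mx.
Qed.

(** [n] stands for the normal of the space form in the ambient space, whose square is -1 on the
    hyperboloid; it is only required to be non-isotropic. *)
Definition orthonormal_basis M n f1 f2 f3 := [/\ ip M n n != 0,
  [/\ ip M n f1 = 0, ip M n f2 = 0 & ip M n f3 = 0],
  [/\ ip M f1 f1 = 1, ip M f2 f2 = 1 & ip M f3 f3 = 1] &
  [/\ ip M f1 f2 = 0, ip M f1 f3 = 0 & ip M f2 f3 = 0]].

(** The Gram matrix of the four vectors is diagonal with nonzero entries, and its determinant is the
    square of theirs times that of [gram M]. *)
Lemma orthonormal_basis_det M n f1 f2 f3 :
  orthonormal_basis M n f1 f2 f3 -> det4 n f1 f2 f3 != 0.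
Proof.
move=> [n0 [nf1 nf2 nf3] [f11 f22 f33] [f12 f13 f23]].
pose B := rows4 n f1 f2 f3; apply/eqP => B0.
have E : B *m gram M *m B^T = diag_mx (row_of 4 [:: ip M n n; 1; 1; 1]).
  apply/matrixP => i j.
  have -> : (B *m gram M *m B^T) i j =
      ip M [:: n; f1; f2; f3]`_i [:: n; f1; f2; f3]`_j.
    have rE (l : 'I_4) : [:: n; f1; f2; f3]`_l = row l B by rewrite rowK.
    rewrite !rE ip_mx -row_mul [LHS]mxE [RHS]mxE; apply: eq_bigr => k _.
    by congr (_ * _); rewrite !mxE.
  rewrite !mxE -val_eqE.
  case: i j => [[|[|[|[|//]]]] ?] [[|[|[|[|//]]]] ?] /=; rewrite ?mulr1n ?mulr0n//;
    by rewrite ipC.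
have : \det (B *m gram M *m B^T) = 0.
  by rewrite !det_mulmx -/(det4 n f1 f2 f3) B0 !mul0r.
rewrite E det_diag !big_ord_recl big_ord0 !mxE /= !mulr1 => /eqP.
by rewrite (negbTE n0).
Qed.

Lemma orthonormal_basis_expand M n f1 f2 f3 u : orthonormal_basis M n f1 f2 f3 ->
  u = comb n f1 f2 f3 [:: ip M n u / ip M n n; ip M f1 u; ip M f2 u; ip M f3 u].
Proof.
move=> onb; have D0 := orthonormal_basis_det onb.
have [n0 [nf1 nf2 nf3] [f11 f22 f33] [f12 f13 f23]] := onb.
have [s uE] : exists s, u = comb n f1 f2 f3 s.
  set D := det4 n f1 f2 f3 in D0.
  exists [:: det4 u f1 f2 f3 / D; det4 n u f2 f3 / D; det4 n f1 u f3 / D;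
    det4 n f1 f2 u / D].
  apply: (scalerI D0); rewrite det4_cramer /comb !scalerDr !scalerA /=.
  by rewrite !(mulrC D) !mulfVK.
have fn1 : ip M f1 n = 0 by rewrite ipC.
have fn2 : ip M f2 n = 0 by rewrite ipC.
have fn3 : ip M f3 n = 0 by rewrite ipC.
have f21 : ip M f2 f1 = 0 by rewrite ipC.
have f31 : ip M f3 f1 = 0 by rewrite ipC.
have f32 : ip M f3 f2 = 0 by rewrite ipC.
rewrite {1}uE /comb /=; congr (_ *: _ + _ *: _ + _ *: _ + _ *: _).
- by rewrite uE /comb !ipDr !ipZr nf1 nf2 nf3 !mulr0 !addr0 mulfK.
- by rewrite uE /comb !ipDr !ipZr fn1 f11 f12 f13 !mulr0 mulr1 !addr0 add0r.
- by rewrite uE /comb !ipDr !ipZr fn2 f21 f22 f23 !mulr0 mulr1 !addr0 !add0r.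
- by rewrite uE /comb !ipDr !ipZr fn3 f31 f32 f33 !mulr0 mulr1 !addr0 !add0r.
Qed.

(** Four vectors in the hyperplane orthogonal to [n] are dependent: express [n] by Cramer's identity
    and pair the result with [n]. *)
Lemma det4_orthogonal M n a b c d : ip M n n != 0 -> ip M n a = 0 ->
  ip M n b = 0 -> ip M n c = 0 -> ip M n d = 0 -> det4 a b c d = 0.
Proof.
move=> n0 na nb nc nd; apply/eqP; rewrite -(mulIr_eq0 _ (mulIf n0)) -ipZr.
by rewrite det4_cramer !ipDr !ipZr na nb nc nd !mulr0 !addr0.
Qed.

Lemma volE M o x u v w :
  vol M o x u v w = (-1) ^+ o * det4 (ambient_normal M x) u v w.
Proof. by []. Qed.

End FourDimensionalAlgebra.

(** * Differentiation of determinants *)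

Section Det4Calculus.
Context {R : realType}.
Local Notation E := 'rV[R]_4.
Implicit Types (V : normedModType R).

Lemma det4_leibniz (a b c d : E) : det4 a b c d =
  \sum_(s : 'S_4) (-1) ^+ s * (a 0 (s 0) * (b 0 (s 1) * (c 0 (s 2) * d 0 (s 3)))).
Proof.
apply: eq_bigr => s _; congr (_ * _).
rewrite !big_ord_recl big_ord0 mulr1 !mxE /=.
have -> : fintype.lift ord0 ord0 = 1 :> 'I_4 by exact: val_inj.
have -> : fintype.lift ord0 (fintype.lift ord0 ord0) = 2 :> 'I_4 by exact: val_inj.
by have -> : fintype.lift ord0 (fintype.lift ord0 (fintype.lift ord0 ord0)) = 3 :> 'I_4
  by exact: val_inj.
Qed.

(** In Leibniz form a determinant of vector functions is a sum of products of coordinates, covered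
    by the rules for sums and products. *)
Lemma det4_fctE V (f1 f2 f3 f4 : V -> E) :
  (fun x => det4 (f1 x) (f2 x) (f3 x) (f4 x)) =
  \sum_(s : 'S_4) ((fun=> (-1) ^+ s) * ((fun x => f1 x 0 (s 0)) *
    ((fun x => f2 x 0 (s 1)) * ((fun x => f3 x 0 (s 2)) * (fun x => f4 x 0 (s 3)))))).
Proof. by apply/funext => x; rewrite det4_leibniz fct_sumE. Qed.

Lemma Ck_det4 V (U : set V) k (f1 f2 f3 f4 : V -> E) : open U ->
  Ck U k f1 -> Ck U k f2 -> Ck U k f3 -> Ck U k f4 ->
  Ck U k (fun x => det4 (f1 x) (f2 x) (f3 x) (f4 x)).
Proof.
move=> oU C1 C2 C3 C4; rewrite det4_fctE; apply: Ck_sum => // s _.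
by repeat (apply: CkM => //); (exact: Ck_cst || exact: Ck_coord).
Qed.

Lemma derive_big_sum V (I : Type) (r : seq I) (f : I -> V -> R) x v :
  (forall i, derivable (f i) x v) ->
  derivable (\sum_(i <- r) f i) x v /\
  'D_v (\sum_(i <- r) f i) x = \sum_(i <- r) 'D_v (f i) x.
Proof.
move=> df; elim: r => [|i r [dr Dr]].
  by rewrite !big_nil; split; [exact: derivable_cst|exact: derive_cst].
rewrite !big_cons; split; first exact: derivableD (df i) dr.
by rewrite (deriveD (df i) dr) Dr.
Qed.

Lemma derive_det4 V (f1 f2 f3 f4 : V -> E) x v :
  differentiable f1 x -> differentiable f2 x -> differentiable f3 x ->
  differentiable f4 x ->
  'D_v (fun x => det4 (f1 x) (f2 x) (f3 x) (f4 x)) x =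
  det4 ('D_v f1 x) (f2 x) (f3 x) (f4 x) + det4 (f1 x) ('D_v f2 x) (f3 x) (f4 x) +
  det4 (f1 x) (f2 x) ('D_v f3 x) (f4 x) + det4 (f1 x) (f2 x) (f3 x) ('D_v f4 x).
Proof.
move=> d1 d2 d3 d4.
have dc (h : V -> E) i : differentiable h x -> derivable (fun x => h x 0 i) x v.
  move=> dh; apply: diff_derivable.
  apply: (@differentiable_comp _ _ _ _ h (@row_coord R 4 i)) => //.
  by apply: linear_differentiable; exact: row_coord_continuous.
have dM (f g : V -> R) : derivable f x v -> derivable g x v -> derivable (f * g) x v.
  exact: derivableM.
have D34 (s : {perm 'I_4}) := dM _ _ (dc f3 (s 2) d3) (dc f4 (s 3) d4).
have D234 (s : {perm 'I_4}) := dM _ _ (dc f2 (s 1) d2) (D34 s).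
have D1234 (s : {perm 'I_4}) := dM _ _ (dc f1 (s 0) d1) (D234 s).
rewrite det4_fctE; apply: etrans (derive_big_sum _ _).2 _ => [s|].
  by apply: (dM) (D1234 s); exact: derivable_cst.
rewrite !det4_leibniz -!big_split; apply: eq_bigr => s _ /=.
rewrite deriveM; [|exact: derivable_cst|exact: D1234].
rewrite (deriveM (dc f1 (s 0) d1) (D234 s)) (deriveM (dc f2 (s 1) d2) (D34 s)).
rewrite (deriveM (dc f3 (s 2) d3) (dc f4 (s 3) d4)) derive_cst !derive_coord//.
rewrite !fctE /GRing.scale /=; have leibniz (e a b c d a' b' c' d' : R) :
    e * (a * (b * (c * d' + d * c') + c * d * b') + b * (c * d) * a') +
    a * (b * (c * d)) * 0 = e * (a' * (b * (c * d))) + e * (a * (b' * (c * d))) +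
    e * (a * (b * (c' * d))) + e * (a * (b * (c * d'))) by ring.
exact: leibniz.
Qed.

End Det4Calculus.

(** * Linear geometry of the three models *)

Section ModelGeometry.
Context {R : realType}.
Local Notation E := 'rV[R]_4.
Implicit Types (M : spaceform) (V : normedModType R) (L : 'M[R]_4)
  (u v w x y : E).

(** The constant square of the ambient normal along the model, see [ambient_normal_sqr]. *)
Definition model_sign M : R := if M is Hyperbolic then -1 else 1.

Lemma model_sign_sqr M : model_sign M * model_sign M = 1.
Proof. by case: M; rewrite /model_sign ?mulrNN mulr1. Qed.

Lemma ipNl M u v : ip M (- u) v = - ip M u v.
Proof. by rewrite -scaleN1r ipZl mulN1r. Qed.

Lemma ipNr M u v : ip M u (- v) = - ip M u v.
Proof. by rewrite ipC ipNl ipC. Qed.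

Lemma ipBr M u v w : ip M u (v - w) = ip M u v - ip M u w.
Proof. by rewrite ipDr ipNr. Qed.

Lemma ipBl M u v w : ip M (v - w) u = ip M v u - ip M w u.
Proof. by rewrite ipDl ipNl. Qed.

Lemma ip0r M u : ip M u 0 = 0.
Proof. by rewrite -(subrr u) ipBr subrr. Qed.

Lemma ip0l M u : ip M 0 u = 0.
Proof. by rewrite ipC ip0r. Qed.

Lemma entry_delta i j : (i < 4)%N -> (j < 4)%N ->
  entry (delta_mx 0 (inord j) : E) i = (i == j)%:R.
Proof. by move=> i4 j4; rewrite /entry mxE eqxx -val_eqE /= !inordK. Qed.

Lemma entry_delta0 i : (i < 4)%N -> entry (delta_mx 0 0 : E) i = (i == 0%N)%:R.
Proof.
move=> i4; rewrite -(entry_delta i4 (ltn0Sn 3)); congr (entry (delta_mx 0 _)).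
by apply: val_inj; rewrite /= inordK.
Qed.

Lemma ambient_normal_sqr M x : model M x ->
  ip M (ambient_normal M x) (ambient_normal M x) = model_sign M.
Proof.
case: M => /=; last by case.
- by move=> _; rewrite ipE !entry_delta0//= !mulr0 !addr0 !mul1r.
- exact.
Qed.

Lemma model_sign_neq0 M : model_sign M != 0.
Proof. by case: M; rewrite /model_sign ?oppr_eq0 oner_eq0. Qed.

Lemma ambient_normal_sqr_neq0 M x : model M x ->
  ip M (ambient_normal M x) (ambient_normal M x) != 0.
Proof. by move=> /ambient_normal_sqr ->; exact: model_sign_neq0. Qed.

(** In Minkowski space the vectors orthogonal to a timelike vector are spacelike. Explicitly, for
    (p, x') on the hyperboloid and (a, v') tangent there, Lagrange's identity gives p^2 (|v'|^2 -
    a^2) = |v'|^2 + |x' cross v'|^2. *)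
Lemma ip_tangent_gt0 M x v : model M x -> model_tangent M x v -> v != 0 ->
  0 < ip M v v.
Proof.
move=> Mx; rewrite /model_tangent /= => Tv v0.
rewrite ltNge; apply: contra_neqN v0 => v_le0.
have sq0 (a : R) : a ^+ 2 <= 0 -> a = 0.
  by move=> a0; apply/eqP; rewrite -sqrf_eq0 eq_le a0 sqr_ge0.
have sum0 (a b c d : R) : a ^+ 2 + (b ^+ 2 + c ^+ 2 + d ^+ 2) <= 0 ->
    [/\ a = 0, b = 0, c = 0 & d = 0].
  have := sqr_ge0 a; have := sqr_ge0 b; have := sqr_ge0 c; have := sqr_ge0 d.
  by move=> ? ? ? ? ?; split; apply: sq0; lra.
suff [e0 e1 e2 e3] : [/\ entry v 0 = 0, entry v 1 = 0, entry v 2 = 0 & entry v 3 = 0].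
  by apply: row4P => -[|[|[|[|//]]]] _; rewrite ?e0 ?e1 ?e2 ?e3 /entry mxE.
move: Mx Tv v_le0; rewrite !ipE.
move: (entry v 0) (entry v 1) (entry v 2) (entry v 3) => a b c d.
case: M; rewrite /model /ambient_normal /=.
- rewrite !entry_delta0//= => _ a0 le0; apply: sum0; nra.
- by move=> _ _ le0; apply: sum0; nra.
rewrite ipE entryE; case; move: (entry x 0) (entry x 1) (entry x 2) (entry x 3).
move=> p q r s xx x0 xv le0.
have lagr : p ^+ 2 * (b ^+ 2 + c ^+ 2 + d ^+ 2 - a ^+ 2) =
    b ^+ 2 + c ^+ 2 + d ^+ 2 +
    ((q * c - r * b) ^+ 2 + ((q * d - s * b) ^+ 2 + (r * d - s * c) ^+ 2)).
  have pa : p * a = q * b + r * c + s * d by lra.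
  have pp : p ^+ 2 = 1 + q ^+ 2 + r ^+ 2 + s ^+ 2 by lra.
  transitivity (p ^+ 2 * (b ^+ 2 + c ^+ 2 + d ^+ 2) - (p * a) ^+ 2); first by ring.
  by rewrite pa pp; ring.
have [_ b0 c0 d0] : [/\ (0 : R) = 0, b = 0, c = 0 & d = 0].
  apply: sum0; rewrite expr0n add0r; have := sqr_ge0 (q * c - r * b).
  have := sqr_ge0 (q * d - s * b); have := sqr_ge0 (r * d - s * c).
  suff : p ^+ 2 * (b ^+ 2 + c ^+ 2 + d ^+ 2 - a ^+ 2) <= 0 by lra.
  by apply: mulr_ge0_le0; [exact: sqr_ge0|lra].
split=> //; apply: sq0.
move: xv; rewrite b0 c0 d0 !mulr0 !addr0 mulN1r => /eqP; rewrite oppr_eq0 mulf_eq0.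
by rewrite (gt_eqF x0)/= => /eqP ->; rewrite expr0n.
Qed.

End ModelGeometry.

(** * Affine fields and derivatives of inner products *)

Section ModelCalculus.
Context {R : realType}.
Local Notation E := 'rV[R]_4.
Implicit Types (M : spaceform) (V : normedModType R) (L : 'M[R]_4)
  (u v w : E).

Definition mulr_map L (x : E) : E := x *m L.

Lemma mulr_map_linear_subproof L : linear (mulr_map L).
Proof. by move=> a x y; rewrite /mulr_map mulmxDl scalemxAl. Qed.

HB.instance Definition _ L := GRing.isLinear.Build R 'rV[R]_4 'rV[R]_4 _
  (mulr_map L) (mulr_map_linear_subproof L).

Lemma mulr_map_continuous L : continuous (mulr_map L).
Proof.
have CL : Ck setT 0 (mulr_map L).
  apply: Ck_rV; first exact: openT.
  move=> i; rewrite (_ : (fun x => _) = \sum_j (fun x : E => x 0 j) * (fun=> L j i)).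
    apply: Ck_sum; first exact: openT.
    move=> j _; apply: CkM; [exact: openT| |exact: Ck_cst].
    by apply: (Ck_linmap _ _ (f := @row_coord R 4 j)); exact: row_coord_continuous.
  by apply/funext => x; rewrite mxE fct_sumE.
by move=> x; exact: CL.
Qed.

Lemma differentiable_mulr_map L x : differentiable (mulr_map L) x.
Proof. by apply: linear_differentiable; exact: mulr_map_continuous. Qed.

Lemma derive_mulr_map L (x v : E) : 'D_v (mulr_map L) x = v *m L.
Proof.
apply: etrans (deriveE _ (differentiable_mulr_map L x)) _.
by have -> := diff_lin x (@mulr_map_continuous L).
Qed.

Lemma Ck_affine (U : set E) k (b : E) L : open U -> Ck U k (fun x => b + x *m L).
Proof.
move=> oU; apply: (@CkD _ _ _ U k (fun=> b) (mulr_map L)) => //.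
  exact: Ck_cst.
exact: (Ck_linmap U k (f := mulr_map L) (@mulr_map_continuous L)).
Qed.

Lemma derive_affine (b : E) L (x v : E) :
  differentiable (fun x : E => b + x *m L) x /\
  'D_v (fun x : E => b + x *m L) x = v *m L.
Proof.
have dl := differentiable_mulr_map L x.
have db : differentiable (fun=> b : E) x by exact: differentiable_cst.
split; first exact: differentiableD db dl.
apply: etrans (deriveD (diff_derivable db) (diff_derivable dl)) _.
by rewrite derive_cst add0r derive_mulr_map.
Qed.

Lemma derive_mulmxr V (f : V -> E) L (x v : V) : differentiable f x ->
  differentiable (fun y => f y *m L) x /\
  'D_v (fun y => f y *m L) x = 'D_v f x *m L.
Proof.
move=> df; have dl := differentiable_mulr_map L (f x).
split; first exact: (differentiable_comp df dl).
rewrite -(derive_mulr_map L (f x)).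
exact: (derive_comp v df dl).
Qed.

Lemma ip_dotv M u v : ip M u v = dotv (u *m gram M) v.
Proof. by rewrite ip_mx mxE; apply: eq_bigr => i _; rewrite [v^T _ _]mxE. Qed.

Lemma derive_ip V M (f g : V -> E) (x v : V) :
  differentiable f x -> differentiable g x ->
  differentiable (fun y => ip M (f y) (g y)) x /\
  'D_v (fun y => ip M (f y) (g y)) x = ip M ('D_v f x) (g x) + ip M (f x) ('D_v g x).
Proof.
move=> df dg; have [dfG DfG] := derive_mulmxr (gram M) v df.
have -> : (fun y => ip M (f y) (g y)) = (fun y => dotv (f y *m gram M) (g y)).
  by apply/funext => y; exact: ip_dotv.
split; first exact: differentiable_dotv.
by rewrite derive_dotv// DfG !ip_dotv.
Qed.

Lemma Ck_ip V (U : set V) k M (f g : V -> E) : open U ->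
  Ck U k f -> Ck U k g -> Ck U k (fun y => ip M (f y) (g y)).
Proof.
move=> oU Cf Cg.
have -> : (fun y => ip M (f y) (g y)) = (fun y => dotv (f y *m gram M) (g y)).
  by apply/funext => y; exact: ip_dotv.
apply: Ck_dotv => //.
exact: (Ck_comp_linmap (l := mulr_map (gram M)) oU (@mulr_map_continuous (gram M))).
Qed.

(** The ambient normal is an affine function of the point in all three models, which allows a
    uniform treatment of its derivative. *)
Definition ambient_normal_mx M : 'M[R]_4 := if M is Euclidean then 0 else 1%:M.
Definition ambient_normal_cst M : E := if M is Euclidean then delta_mx 0 0 else 0.

Lemma ambient_normal_affine M :
  ambient_normal M = fun x => ambient_normal_cst M + x *m ambient_normal_mx M.
Proof.
by apply/funext => x; case: M; rewrite /ambient_normal /= ?mulmx0 ?addr0 ?mulmx1 ?add0r.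
Qed.

Lemma ip_const M (f : R -> E) (c t v : R) : differentiable f t ->
  (\forall s \near t, ip M (f s) (f s) = c) -> ip M (f t) ('D_v f t) = 0.
Proof.
move=> df fc; have [_ D] := derive_ip M v df df.
have : 'D_v (fun s => ip M (f s) (f s)) t = 0.
  by rewrite -(derive_cst c t v); apply: near_eq_derive.
rewrite D (ipC M ('D_v f t)) => /eqP; rewrite -mulr2n mulrn_eq0 /=.
by move=> /eqP.
Qed.

Lemma tangent_space_model M (x : E) : tangent_space (model M) x `<=` model_tangent M x.
Proof.
move=> v [I [g [[oI I0] sg gM g0 <-]]].
have dg : differentiable g 0 by exact: Ck_differentiable (sg 1%N) I0.
have nI : \forall s \near (0 : R), I s by exact: open_nbhs_nbhs.
rewrite -g0; case: M gM => gM; rewrite /model_tangent /ambient_normal/=.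
- have : 'D_1 (fun s => ip Euclidean (delta_mx 0 0 : E) (g s)) (0 : R) = 0 :> R.
    apply: etrans (derive_cst 0 (0 : R) (1 : R)); apply: near_eq_derive.
    apply: filterS nI => s /gM; rewrite /= entryE => e.
    by rewrite ipE !entry_delta0// e/= !mul0r mulr0 !addr0 mulr0.
  have dc : differentiable (fun=> delta_mx 0 0 : E) (0 : R) by exact: differentiable_cst.
  by have [_ ->] := derive_ip Euclidean (1 : R) dc dg; rewrite derive_cst ip0l add0r.
- by apply: (ip_const (c := 1)) dg _; apply: filterS nI => s /gM.
- by apply: (ip_const (c := -1)) dg _; apply: filterS nI => s /gM[].
Qed.

Lemma tangent_spaceS (S S' : set E) x : S `<=` S' ->
  tangent_space S x `<=` tangent_space S' x.
Proof.
by move=> SS' v [I [g [I0 sg gS g0 D]]]; exists I, g; split => // t /gS; exact: SS'.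
Qed.

Definition skew M L := forall u v, ip M (u *m L) v + ip M u (v *m L) = 0.

Lemma ip_tangent_proj M (x v w : E) : model_tangent M x w ->
  ip M (tangent_proj M x v) w = ip M v w.
Proof.
by rewrite /model_tangent /= => Tw; rewrite /tangent_proj ipBl ipZl Tw mulr0 subr0.
Qed.

(** The covariant derivative of the field along [w] is the tangential part of [w *m L], and the
    projection disappears in products with tangent vectors: the Killing equation becomes the
    skewness of [L]. *)
Lemma killing_of_affine M (b : E) L : skew M L ->
  (forall x, model M x -> model_tangent M x (b + x *m L)) ->
  exists Y : killing_field R M,
    forall x, model M x -> 'valL_0 (Y : model M -> E) x = b + x *m L.
Proof.
move=> skL tL; pose F (x : E) := b + x *m L.
pose Y0 : model M -> E := fun z => F (val z).
have YF x : model M x -> 'valL_0 Y0 x = F x.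
  by move=> Mx; rewrite -[x in LHS]/(val (SigSub (mem_set Mx))) valL_set_val.
have sF x : local_extension (model M) ('valL_0 Y0) x F.
  exists setT; split=> [|k|y My _]; first by split; [exact: openT|].
    exact: Ck_affine openT.
  by rewrite YF.
have KY : Y0 \in @killing R M.
  apply/asboolP; split=> [x _|x Mx|x u v Mx Tu Tv]; first by exists F.
    by rewrite YF//; exact: tL.
  have D w : model_tangent M x w ->
      covariant_derivative M (model M) ('valL_0 Y0) x w = tangent_proj M x (w *m L).
    move=> Tw; have [g [Sg g0 dg]] := model_curve Mx Tw.
    rewrite /covariant_derivative (derive_alongE Sg g0 dg (sF x)).
    by have [_ ->] := derive_affine b L x w.
  by rewrite !D// ip_tangent_proj// (ipC M u) ip_tangent_proj// (ipC M _ u) skL.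
by exists (KillingField KY).
Qed.

End ModelCalculus.

(** * Radial projection onto the model *)

Section RadialNormalization.
Context {R : realType}.
Local Notation E := 'rV[R]_4.
Implicit Types (M : spaceform) (V : normedModType R) (u v w : E).

(** In the curved cases, the open set of vectors that a positive factor brings to the model. In the
    flat case, the hyperplane itself, on which the projection is the identity; hence the recurring
    separation of [M <> Euclidean]. *)
Definition cone M : set E :=
  match M with
  | Euclidean => model Euclidean
  | Spherical => [set z | 0 < ip Spherical z z]
  | Hyperbolic => [set z | 0 < - ip Hyperbolic z z /\ 0 < z 0 0]
  end.

Definition sq_norm M (z : E) : R := model_sign M * ip M z z.

Definition radial_scale M (z : E) : R := (Num.sqrt (sq_norm M z))^-1.

Definition normalize M (z : E) : E :=
  if M is Euclidean then z else radial_scale M z *: z.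

Lemma sq_norm_gt0 M z : M <> Euclidean -> cone M z -> 0 < sq_norm M z.
Proof. by rewrite /sq_norm; case: M => //= _; rewrite ?mul1r// mulN1r; case. Qed.

Lemma radial_scale_gt0 M z : M <> Euclidean -> cone M z -> 0 < radial_scale M z.
Proof. by move=> ME Cz; rewrite invr_gt0 sqrtr_gt0; exact: sq_norm_gt0. Qed.

Lemma radial_scale_sqr M z : M <> Euclidean -> cone M z ->
  radial_scale M z * (radial_scale M z * sq_norm M z) = 1.
Proof.
move=> ME Cz; have f0 := sq_norm_gt0 ME Cz.
rewrite mulrA -expr2 exprVn sqr_sqrtr ?ltW// mulVf// gt_eqF//.
Qed.

Lemma normalizeE M z : M <> Euclidean -> normalize M z = radial_scale M z *: z.
Proof. by case: M. Qed.

Lemma normalize_in M z : cone M z -> model M (normalize M z).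
Proof.
have [->//|ME Cz] := pselect (M = Euclidean).
have e : ip M (normalize M z) (normalize M z) = model_sign M.
  rewrite normalizeE// ipZl ipZr; have := radial_scale_sqr ME Cz; rewrite /sq_norm => e.
  by rewrite -[RHS]mulr1 -e !(mulrCA (model_sign M)) (mulrA (model_sign M)) model_sign_sqr mul1r.
have r0 := radial_scale_gt0 ME Cz.
case: M ME Cz e r0 => [/(_ erefl)//|_|_] Cz e r0; first exact: e.
by split; [exact: e|case: Cz => _ z0; rewrite /normalize mxE mulr_gt0].
Qed.

Lemma model_cone M : model M `<=` cone M.
Proof.
case: M => // z; first by rewrite /= => zz; rewrite zz; exact: ltr01.
by case=> zz z0; split=> //; rewrite zz opprK; exact: ltr01.
Qed.

Lemma normalize_id M z : model M z -> normalize M z = z.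
Proof.
move=> Mz; case: M Mz => //= Mz; rewrite /radial_scale /sq_norm /model_sign.
  by rewrite mul1r Mz sqrtr1 invr1 scale1r.
by rewrite Mz.1 mulrNN mulr1 sqrtr1 invr1 scale1r.
Qed.

Lemma sq_norm_Ck M U k : open U -> Ck U k (sq_norm M).
Proof.
move=> oU; have Cid : Ck U k (fun z : E => z).
  by apply: (Ck_linmap U k (f := idfun)) => z; exact: cvg_id.
exact: (CkM oU (Ck_cst U k (model_sign M)) (Ck_ip M oU Cid Cid)).
Qed.

Lemma cone_open M : M <> Euclidean -> open (cone M).
Proof.
move=> ME; have oS : open [set z : E | 0 < sq_norm M z].
  rewrite openE => z z0; have c : {for z, continuous (sq_norm M)}.
    exact: (sq_norm_Ck M 0 openT).
  exact: (@cvgr_gt R _ _ _ (sq_norm M) (sq_norm M z) c 0 z0).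
case: M ME oS => [/(_ erefl)//|_|_] /=; rewrite /sq_norm /model_sign.
  by congr open; apply/seteqP; split=> z /=; rewrite mul1r.
move=> oS; rewrite (_ : [set z : E | _] = [set z : E | 0 < -1 * ip Hyperbolic z z] `&`
  [set z : E | 0 < z 0 0]).
  apply: openI => //; rewrite openE => z z0.
  have c : {for z, continuous (fun y : E => y 0 0)} by exact: coord_continuous.
  exact: (@cvgr_gt R _ _ _ (fun y : E => y 0 0) (z 0 0) c 0 z0).
by apply/seteqP; split=> z /=; rewrite mulN1r.
Qed.

Lemma radial_scale_Ck M k : M <> Euclidean -> Ck (cone M) k (radial_scale M).
Proof.
move=> ME; apply: Ck_inv_sqrt; [exact: cone_open|by move=> z; exact: sq_norm_gt0|].
by apply: sq_norm_Ck; exact: cone_open.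
Qed.

Lemma normalize_Ck M k : M <> Euclidean -> Ck (cone M) k (normalize M).
Proof.
move=> ME; have oC := cone_open ME.
rewrite (_ : normalize M = fun z => radial_scale M z *: z); last first.
  by apply/funext => z; exact: normalizeE.
apply: CkZ => //; first exact: radial_scale_Ck.
by apply: (Ck_linmap _ _ (f := idfun)) => z; exact: cvg_id.
Qed.

Lemma normalize_smooth M : smooth_on (cone M) (normalize M).
Proof.
have [->|ME] := pselect (M = Euclidean).
  rewrite (_ : normalize Euclidean = idfun)//.
  by apply: smooth_on_linmap => z; exact: cvg_id.
apply: smooth_smooth_on; [exact: cone_open ME|by []|] => k; exact: normalize_Ck.
Qed.

Lemma derive_id (x w : E) : 'D_w (fun z : E => z) x = w.
Proof.
have ci : continuous (idfun : E -> E) by move=> z; exact: cvg_id.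
have di : differentiable (idfun : E -> E) x by exact: linear_differentiable.
apply: etrans (deriveE _ di) _.
by have -> := diff_lin x ci.
Qed.

Lemma differentiable_idE (x : E) : differentiable (fun z : E => z) x.
Proof. by apply: (linear_differentiable (f := idfun)) => z; exact: cvg_id. Qed.

Lemma derive_sq_norm M (z w : E) : differentiable (sq_norm M) z /\
  'D_w (sq_norm M) z = 2 * (model_sign M * ip M z w).
Proof.
have dI := differentiable_idE z; have [dip Dip] := derive_ip M w dI dI.
have dc : differentiable (fun=> model_sign M : R) z by exact: differentiable_cst.
split; first exact: (differentiableM dc dip).
apply: etrans (deriveM (diff_derivable dc) (diff_derivable dip)) _.
rewrite derive_cst Dip derive_id /GRing.scale /= mulr0 addr0 (ipC M w); ring.
Qed.

Lemma derive_radial_scale M (z w : E) : M <> Euclidean -> cone M z ->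
  differentiable (radial_scale M) z /\
  'D_w (radial_scale M) z = - (radial_scale M z *
    (model_sign M * ip M (normalize M z) w * radial_scale M z)).
Proof.
move=> ME Cz; have [df Df] := derive_sq_norm M z w.
have [dr Dr] := derive_inv_sqrt w (sq_norm_gt0 ME Cz) df; split=> //.
apply: etrans Dr _; rewrite Df normalizeE// ipZl -/(radial_scale M z).
by field.
Qed.

Lemma derive_scale_id (r : E -> R) (z w : E) : differentiable r z ->
  'D_w (fun y => r y *: y) z = 'D_w r z *: z + r z *: w.
Proof.
move=> dr; have dI := differentiable_idE z.
have di i : differentiable (fun y : E => y 0 i) z.
  apply: (@differentiable_comp _ _ _ _ (fun y : E => y) (@row_coord R 4 i)) => //.
  by apply: linear_differentiable; exact: row_coord_continuous.
have rE i : (fun y : E => (r y *: y) 0 i) = r * (fun y : E => y 0 i).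
  by apply/funext => y; rewrite mxE.
have drz : differentiable (fun y : E => r y *: y) z.
  rewrite (rV_delta_sum (fun y : E => r y *: y)); apply: differentiable_sum => i.
  by apply: differentiableZl; rewrite rE; exact: differentiableM dr (di i).
apply/rowP => i; rewrite -derive_coord// rE.
rewrite (deriveM (diff_derivable dr) (diff_derivable (di i))) (derive_coord i w dI) derive_id.
by rewrite !mxE addrC /GRing.scale /= (mulrC (z 0 i)).
Qed.

Lemma derive_normalize M (z w : E) : M <> Euclidean -> cone M z ->
  'D_w (normalize M) z = radial_scale M z *:
    (w - (model_sign M * ip M (normalize M z) w) *: normalize M z).
Proof.
move=> ME Cz; rewrite (_ : normalize M = fun z => radial_scale M z *: z); last first.
  by apply/funext => y; exact: normalizeE.
have [dr Dr] := derive_radial_scale w ME Cz.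
rewrite derive_scale_id// Dr normalizeE// scalerBr !scalerA addrC scaleNr.
by rewrite !mulrA.
Qed.

End RadialNormalization.

(** * Conservation laws for Killing fields *)

Section KillingClassification.
Context {R : realType}.
Local Notation E := 'rV[R]_4.
Implicit Types (M : spaceform) (u v w : E).

Lemma killing_fieldP M (Y : killing_field R M) :
  let Z := 'valL_0 (Y : model M -> E) in
  let D := covariant_derivative M (model M) Z in
  [/\ smooth_on (model M) Z, forall x, model M x -> model_tangent M x (Z x) &
      forall x u v, model M x -> model_tangent M x u -> model_tangent M x v ->
        ip M (D x u) v + ip M u (D x v) = 0].
Proof. by case: Y => Y /= /asboolP. Qed.

Lemma ambient_normal_id M (x : E) : M <> Euclidean -> ambient_normal M x = x.
Proof. by case: M. Qed.

(** The first identity is the Killing equation at the pair (w, w), freed from the tangential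
    projection because [w] is tangent. The second differentiates <Z x, x> = 0 along a curve leaving
    [x] with velocity [w]. *)
Lemma killing_derive M (Y : killing_field R M) (x w : E) F :
  model M x -> model_tangent M x w ->
  local_extension (model M) ('valL_0 (Y : model M -> E)) x F ->
  ip M ('D_w F x) w = 0 /\
  (M <> Euclidean -> ip M ('D_w F x) x + ip M (F x) w = 0).
Proof.
move=> Mx Tw FE; have [_ tZ kZ] := killing_fieldP Y.
have [g [gM g0 dg]] := model_curve Mx Tw.
have dF := local_extension_differentiable FE.
split=> [|ME].
  have := kZ x w w Mx Tw Tw.
  rewrite /covariant_derivative (derive_alongE gM g0 dg FE) ip_tangent_proj//.
  rewrite (ipC M w) ip_tangent_proj// => /eqP.
  by rewrite -mulr2n mulrn_eq0 => /eqP.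
have [dgg Dg] := dg; have dg' : differentiable g 0 by exact/derivable1_diffP.
have dF' : differentiable F (g 0) by rewrite g0.
have dFg : differentiable (F \o g) 0 by exact: differentiable_comp.
have DFg : 'D_1 (F \o g) 0 = 'D_w F x by rewrite (derive_comp _ dg' dF') Dg g0.
have [U [[oU Ux] _ eF]] := FE.
have nU : \forall t \near (0 : R), U (g t).
  apply: (differentiable_continuous dg'); rewrite g0.
  exact: open_nbhs_nbhs.
have [_] := derive_ip M (1 : R) dFg dg'.
rewrite DFg Dg /= g0 => <-.
apply: etrans (derive_cst 0 (0 : R) (1 : R)); apply: near_eq_derive.
near=> t; have gMt : model M (g t) by near: t.
have Ut : U (g t) by near: t.
rewrite /= eF// ipC; have := tZ _ gMt.
by rewrite /model_tangent /mkset ambient_normal_id.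
Unshelve. all: by end_near. Qed.

Lemma derive_zero_segment (f : R -> R) :
  (forall t : R, 0 <= t <= 1 -> is_derive t 1 f 0) -> f 0 = f 1.
Proof.
move=> f0; have [|//|c _ e] := @MVT_segment R f (fun=> 0) 0 1 ler01.
- by move=> t; rewrite in_itv /= => /andP[t0 t1]; apply: f0; rewrite !ltW.
- apply: derivable_within_continuous => t; rewrite in_itv /= => t01.
  by have [] := f0 t t01.
by apply/eqP; rewrite eq_sym -subr_eq0 e mul0r.
Qed.

(** Along a straight line the product of the field with the direction is constant: its derivative is
    the first expression of [killing_derive]. *)
Lemma euclidean_killing_pairing (Y : killing_field R Euclidean) (x y : E) :
  let Z := 'valL_0 (Y : model Euclidean -> E) in
  model Euclidean x -> model Euclidean y ->
  ip Euclidean (Z x) (y - x) = ip Euclidean (Z y) (y - x).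
Proof.
move=> Z Mx My; have [sZ tZ _] := killing_fieldP Y; pose w : E := y - x; rewrite -/w.
have xw : x + w = y by rewrite addrC subrK.
have line t : model Euclidean (x + t *: w).
  by rewrite /model /= !mxE Mx My subr0 mulr0 addr0.
have Tw z : model_tangent Euclidean z w.
  rewrite /model_tangent /ambient_normal /= ipE !entry_delta0//= /entry.
  by rewrite (_ : inord 0 = 0) ?mxE ?Mx ?My; [ring|apply: val_inj; rewrite /= inordK].
pose f (t : R) : R := ip Euclidean (Z (x + t *: w)) w.
suff : f 0 = f 1 by rewrite /f scale0r addr0 scale1r xw.
apply: derive_zero_segment => t _; have [F FE] := sZ _ (line t).
have dF := local_extension_differentiable FE; have [U [[oU Ux] _ eF]] := FE.
apply: (near_eq_is_derive (g := f) (f := fun t : R => ip Euclidean (F (x + t *: w)) w : R)).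
  have nU : \forall s \near t, U (x + s *: w).
    have c : {for t, continuous (fun s : R => x + s *: w)} by exact: affine_continuous.
    by apply: c; exact: open_nbhs_nbhs.
  by near=> s; rewrite /f eF//; near: s.
have [D0 _] := killing_derive (line t) (Tw _) FE.
have dw : differentiable (fun=> w : E) (x + t *: w) by exact: differentiable_cst.
have [dip Dip] := derive_ip Euclidean w dF dw.
have := is_derive_line dip; rewrite Dip D0 derive_cst ip0r addr0.
exact.
Unshelve. all: by end_near. Qed.

(** The same conservation law along the segment from [x] to [y], for a suitable extension of the
    field. By tangency its values at the two ends are <Z x, y> and - <Z y, x>. *)
Lemma killing_pairing M (Y : killing_field R M) (x y : E) :
  let Z := 'valL_0 (Y : model M -> E) in
  M <> Euclidean -> model M x -> model M y ->
  (forall t : R, 0 <= t <= 1 -> cone M (x + t *: (y - x))) ->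
  ip M (Z x) y + ip M (Z y) x = 0.
Proof.
move=> Z ME Mx My Cxy; have [sZ tZ _] := killing_fieldP Y; pose w : E := y - x; rewrite -/w in Cxy *.
have tZ' z : model M z -> ip M z (Z z) = 0.
  by move=> /tZ; rewrite /model_tangent /mkset ambient_normal_id.
have xw : x + w = y by rewrite addrC subrK.
have oC : open (cone M : set E) := cone_open ME.
(* [Z (normalize z)] times the length of [z] is the extension of [Z] to the cone
   that is homogeneous of degree 1; it is a Killing field of the flat space. *)
pose len (z : E) : R := sq_norm M z * radial_scale M z.
pose f (t : R) : R := len (x + t *: w) * ip M (Z (normalize M (x + t *: w))) w.
have len1 z : model M z -> len z = 1.
  move=> Mz; have n1 : sq_norm M z = 1.
    have := ambient_normal_sqr Mz; rewrite ambient_normal_id// => e.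
    by rewrite /sq_norm e model_sign_sqr.
  by rewrite /len /radial_scale n1 sqrtr1 invr1 mulr1.
suff : f 0 = f 1.
  rewrite /f scale0r addr0 scale1r xw !len1// !mul1r !normalize_id//.
  rewrite !ipBr (ipC M (Z x) x) (ipC M (Z y) y) !tZ'// subr0 sub0r => ->.
  by rewrite addNr.
apply: derive_zero_segment => t t01; set z := x + t *: w.
have Cz : cone M z by exact: Cxy.
have Mm := normalize_in Cz; set m := normalize M z in Mm.
have [F FE] := sZ m Mm; have dF := local_extension_differentiable FE.
have [U [[oU Um] _ eF]] := FE.
have cN : {for z, continuous (normalize M)} by exact: (normalize_Ck 0 ME).
have dN : differentiable (normalize M) z by exact: Ck_differentiable (normalize_Ck 1 ME) Cz.
have dFN : differentiable (F \o normalize M) z by exact: differentiable_comp.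
have nU : \forall s \near t, U (normalize M (x + s *: w)).
  have c : {for t, continuous (fun s : R => x + s *: w)} by exact: affine_continuous.
  have nz : nbhs z (normalize M @^-1` U) by apply: cN; exact: open_nbhs_nbhs.
  exact: (c _ nz).
have nC : \forall s \near t, cone M (x + s *: w).
  have c : {for t, continuous (fun s : R => x + s *: w)} by exact: affine_continuous.
  exact: (c _ (open_nbhs_nbhs (conj oC Cz))).
apply: (near_eq_is_derive
    (g := f) (f := fun t : R => len (x + t *: w) * ip M ((F \o normalize M) (x + t *: w)) w : R)).
  near=> s; have Cs : cone M (x + s *: w) by near: s.
  by rewrite /f /= eF//; [exact: normalize_in|near: s].
have [dq Dq] := derive_sq_norm M z w.
have [dr Dr] := derive_radial_scale w ME Cz.
have dw : differentiable (fun=> w : E) z by exact: differentiable_cst.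
have [dip Dip] := derive_ip M w dFN dw.
have dlen : differentiable len z by exact: differentiableM.
have Dlen : 'D_w len z = model_sign M * ip M m w.
  apply: etrans (deriveM (diff_derivable dq) (diff_derivable dr)) _.
  rewrite Dq Dr /GRing.scale /= -/m.
  have -> : model_sign M * ip M z w = sq_norm M z * radial_scale M z *
      (model_sign M * ip M m w).
    rewrite /m normalizeE// ipZl; have := radial_scale_sqr ME Cz.
    move: (radial_scale M z) (sq_norm M z) => r q e.
    by rewrite -[LHS]mul1r -e; ring.
  have := radial_scale_sqr ME Cz.
  move: (radial_scale M z) (sq_norm M z) (model_sign M * ip M m w) => r q l e.
  by transitivity (r * (r * q) * l); [ring|rewrite e mul1r].
have dall := differentiableM dlen dip.
have := is_derive_line dall.
rewrite (deriveM (diff_derivable dlen) (diff_derivable dip)) Dip Dlen derive_cst ip0r addr0.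
rewrite derive_comp// (derive_normalize _ ME Cz) -/m.
(* [v] and [l *: m] are the tangential and radial parts of [w]. The derivative of the length
   contributes l <F m, v> and that of the field l <D_v F, m>; their sum vanishes because the field
   is tangent. *)
set l := model_sign M * ip M m w; set v := w - l *: m.
have Tv : model_tangent M m v.
  rewrite /model_tangent /mkset ambient_normal_id// /v ipBr ipZr /l.
  have := ambient_normal_sqr Mm; rewrite ambient_normal_id// => ->.
  by rewrite mulrAC model_sign_sqr mul1r subrr.
have [D1 D2] := killing_derive Mm Tv FE.
have wE : w = v + l *: m by rewrite /v subrK.
have Fm : ip M (F m) m = 0 by rewrite eF// ipC tZ'.
have -> : 'D_(radial_scale M z *: v) F m = radial_scale M z *: 'D_v F m.
  by rewrite !deriveE// linearZ.
rewrite ipZl /GRing.scale /= -/m.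
have -> : len z * (radial_scale M z * ip M ('D_v F m) w) = ip M ('D_v F m) w.
  rewrite /len; have := radial_scale_sqr ME Cz.
  move: (radial_scale M z) (sq_norm M z) (ip M _ _) => r q a e.
  by rewrite -[RHS]mul1r -e; ring.
rewrite [ip M ('D_v F m) w](_ : _ = l * ip M ('D_v F m) m); last first.
  by rewrite {1}wE ipDr ipZr D1 add0r.
rewrite [ip M (F m) w](_ : _ = ip M (F m) v); last by rewrite {1}wE ipDr ipZr Fm mulr0 addr0.
rewrite (mulrC (ip M (F m) v)) -mulrDr D2// mulr0.
exact.
Unshelve. all: by end_near. Qed.

End KillingClassification.

(** * Killing fields are affine *)

Section KillingAffine.
Context {R : realType}.
Local Notation E := 'rV[R]_4.
Implicit Types (M : spaceform) (u v w : E).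

Lemma gram_unit M : gram M \in @unitmx R 4.
Proof.
rewrite unitmxE /gram det_diag !big_ord_recl big_ord0 !mxE /= !mulr1 unitfE.
by case: M; rewrite ?oppr_eq0 oner_eq0.
Qed.

Lemma ip_mxE M m n (A : 'M[R]_(m, 4)) (B : 'M[R]_(n, 4)) i j :
  (A *m gram M *m B^T) i j = ip M (row i A) (row j B).
Proof.
rewrite ip_mx -row_mul [LHS]mxE [RHS]mxE; apply: eq_bigr => k _.
by congr (_ * _); rewrite !mxE.
Qed.

(** The relations <V y, b_i> = - <V b_i, y> with the rows b_i of [B] determine [V y], linearly in
    [y]. The matrix [L] so obtained is skew because L G + G L^T, with G the Gram matrix, vanishes on
    the basis. *)
Lemma skew_matrix M (T : set E) (V : E -> E) (B : 'M[R]_4) : B \in unitmx ->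
  (forall i, T (row i B)) ->
  (forall x y, T x -> T y -> ip M (V x) y + ip M (V y) x = 0) ->
  exists2 L, skew M L & forall y, T y -> V y = y *m L.
Proof.
move=> uB TB VT; have uG := gram_unit M.
have uGB : gram M *m B^T \in unitmx by rewrite unitmx_mul uG unitmx_tr.
pose VB : 'M[R]_4 := \matrix_i V (row i B).
have [L VL] : exists L, forall y, T y -> V y = y *m L.
  exists (- (gram M *m VB^T) *m invmx (gram M *m B^T)) => y Ty; rewrite mulmxA; apply: (canRL (mulmxK uGB)); rewrite mulmxA.
  apply/rowP => i; rewrite mulmxN mulmxA [RHS]mxE !ip_mxE !row_id rowK.
  by apply/eqP; rewrite -addr_eq0 (ipC M y) VT.
exists L => // u v.
have : B *m (L *m gram M + gram M *m L^T) *m B^T = 0.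
  rewrite mulmxDr mulmxDl; apply/matrixP => i j; rewrite [LHS]mxE [RHS]mxE.
  rewrite !mulmxA ip_mxE -(mulmxA _ L^T) -trmx_mul ip_mxE !row_mul.
  by rewrite -!(VL _ (TB _)) (ipC M (row i B)) VT.
move=> /(congr1 (fun A => invmx B *m A *m invmx B^T)).
rewrite mulmx0 mul0mx !mulmxA mulVmx// mul1mx mulmxK ?unitmx_tr// => Q0.
rewrite !ip_mx trmx_mul !mulmxA.
transitivity ((u *m L *m gram M *m v^T + u *m gram M *m L^T *m v^T) 0 0).
  by rewrite [RHS]mxE.
have -> : u *m L *m gram M *m v^T + u *m gram M *m L^T *m v^T = 0.
  by rewrite -mulmxDl -(mulmxA u L) -(mulmxA u (gram M)) -mulmxDr Q0 mulmx0 mul0mx.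
by rewrite mxE.
Qed.

(** Reversed Cauchy-Schwarz inequality: Lagrange's identity bounds the square of the spatial product
    strictly by that of the product of the time coordinates, which are positive. *)
Lemma hyperbolic_ip_lt0 (x y : E) : model Hyperbolic x -> model Hyperbolic y ->
  ip Hyperbolic x y < 0.
Proof.
rewrite /model /= !ipE !entryE; move: (entry x 0) (entry x 1) (entry x 2) (entry x 3).
move: (entry y 0) (entry y 1) (entry y 2) (entry y 3) => a b c d p q r s [xx p0] [yy a0].
have lagr : (q * b + r * c + s * d) ^+ 2 = (q ^+ 2 + r ^+ 2 + s ^+ 2) *
    (b ^+ 2 + c ^+ 2 + d ^+ 2) - ((q * c - r * b) ^+ 2 + (q * d - s * b) ^+ 2 +
    (r * d - s * c) ^+ 2) by ring.
have qq : q ^+ 2 + r ^+ 2 + s ^+ 2 = p ^+ 2 - 1 by lra.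
have bb : b ^+ 2 + c ^+ 2 + d ^+ 2 = a ^+ 2 - 1 by lra.
have pa0 : 0 < p * a by exact: mulr_gt0.
have le : (q * b + r * c + s * d) ^+ 2 < (p * a) ^+ 2.
  have := sqr_ge0 (q * c - r * b); have := sqr_ge0 (q * d - s * b).
  have := sqr_ge0 (r * d - s * c); have := sqr_ge0 b; have := sqr_ge0 c.
  have := sqr_ge0 d; have := sqr_ge0 q; have := sqr_ge0 r; have := sqr_ge0 s.
  by rewrite lagr qq bb exprMn; move: (p ^+ 2) (a ^+ 2) qq bb => P A; lra.
rewrite mulN1r addrC subr_lt0 ltNge; apply: contraL le => h.
by rewrite -leNgt ler_sqr ?nnegrE//; lra.
Qed.

Lemma spherical_ip_gt0 (z : E) : z != 0 -> 0 < ip Spherical z z.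
Proof.
rewrite ipE; apply: contraNT; rewrite -leNgt mul1r => le0.
have sq0 (a : R) : a * a <= 0 -> a = 0.
  by move=> a0; apply/eqP; rewrite -sqrf_eq0 eq_le sqr_ge0 expr2 a0.
have sq_ge0 i : 0 <= entry z i * entry z i by rewrite -expr2 sqr_ge0.
have := sq_ge0 0%N; have := sq_ge0 1%N; have := sq_ge0 2%N; have := sq_ge0 3%N => *.
apply/eqP/row4P => i i4; rewrite [RHS]mxE; apply: sq0.
by case: i i4 => [|[|[|[|//]]]] _; lra.
Qed.

(** On the sphere, a segment through the origin meets it at its midpoint, as its ends have equal
    norms, and then y = -x. On the hyperboloid the positive cone is convex, by the sign of the
    product of two of its points. *)
Lemma model_segment_cone M (x y : E) t : M <> Euclidean -> model M x -> model M y ->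
  y != - x -> 0 <= t <= 1 -> cone M (x + t *: (y - x)).
Proof.
move=> ME Mx My xy /andP[t0 t1]; have -> : x + t *: (y - x) = (1 - t) *: x + t *: y.
  by rewrite scalerBr scalerBl scale1r addrA addrAC.
have e : ip M ((1 - t) *: x + t *: y) ((1 - t) *: x + t *: y) =
    (1 - t) ^+ 2 * ip M x x + t ^+ 2 * ip M y y + 2 * (1 - t) * t * ip M x y.
  by rewrite !(ipDl, ipDr, ipZl, ipZr) (ipC M y x); ring.
case: M ME Mx My e => [/(_ erefl)//|_|_]; rewrite /cone /=.
  move=> x1 y1 e; apply: spherical_ip_gt0; apply: contraNneq xy => z0.
  have yx : t *: y = (t - 1) *: x.
    by apply/eqP; rewrite -subr_eq0 -scaleNr opprB addrC z0.
  have tt : t ^+ 2 = (t - 1) ^+ 2.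
    have := congr1 (fun z => ip Spherical z z) yx.
    by rewrite /= !ipZl !ipZr x1 y1 !mulr1 !expr2.
  have th : t = 2^-1 by lra.
  move: yx; rewrite th => /(congr1 (fun z => 2 *: z)); rewrite !scalerA.
  have -> : 2 * (2^-1 - 1) = -1 :> R by lra.
  by rewrite divff// scale1r scaleN1r => ->.
move=> Mx My ->; have xy0 := hyperbolic_ip_lt0 Mx My.
case: Mx My => -> x0 [-> y0]; split; last first.
  rewrite !mxE; have [->|t_neq0] := eqVneq t 0; first by rewrite subr0 mul1r mul0r addr0.
  have : 0 < t * y 0 0 by rewrite mulr_gt0// lt0r t_neq0.
  have : 0 <= (1 - t) * x 0 0 by rewrite mulr_ge0 ?subr_ge0// ltW.
  lra.
have : 0 <= (1 - t) * t * - ip Hyperbolic x y.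
  by rewrite !mulr_ge0// ?subr_ge0// oppr_ge0 ltW.
nra.
Qed.

(** In the curved cases the rows are points of the model; on the hyperboloid 5/4 and 3/4 come from
    the Pythagorean triple (3, 4, 5). *)
Definition model_basis M : 'M[R]_4 :=
  if M is Hyperbolic
  then rows4 (row_of 4 [:: 1; 0; 0; 0]) (row_of 4 [:: 5 / 4; 3 / 4; 0; 0])
    (row_of 4 [:: 5 / 4; 0; 3 / 4; 0]) (row_of 4 [:: 5 / 4; 0; 0; 3 / 4])
  else rows4 (row_of 4 [:: 1; 0; 0; 0]) (row_of 4 [:: 0; 1; 0; 0])
    (row_of 4 [:: 0; 0; 1; 0]) (row_of 4 [:: 0; 0; 0; 1]).

Lemma model_basis_unit M : model_basis M \in unitmx.
Proof.
rewrite unitmxE unitfE /model_basis.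
by case: M; rewrite -/(det4 _ _ _ _) det4E /= !entry_row_of//=; apply: lt0r_neq0; lra.
Qed.

Lemma model_basis_in M i : M <> Euclidean -> model M (row i (model_basis M)).
Proof.
move=> ME; rewrite /model_basis; case: M ME => [/(_ erefl)//|_|_]; rewrite rowK /model /=.
  by case: i => [[|[|[|[|//]]]] ?]; rewrite /= ipE !entry_row_of//=; lra.
rewrite ipE; case: i => [[|[|[|[|//]]]] ?]; rewrite /= !entry_row_of//= !mxE /=;
  split; lra.
Qed.

Theorem killing_affine M (Y : killing_field R M) : exists b (L : 'M[R]_4),
  [/\ skew M L, forall x, model M x -> 'valL_0 (Y : model M -> E) x = b + x *m L &
      M <> Euclidean -> b = 0].
Proof.
set Z := 'valL_0 _; have [_ tZ _] := killing_fieldP Y; rewrite -/Z in tZ.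
have [MEu|ME] := pselect (M = Euclidean).
  (* The hyperplane does not span the ambient space. After subtraction of its value at 0 the field
     is extended by 0 at the unit normal vector, which keeps the pairing skew and supplies a
     basis. *)
  subst M; pose T : set E := [set x | model Euclidean x \/ x = row_of 4 [:: 1; 0; 0; 0]].
  pose V (x : E) : E := if x 0 0 == 0 then Z x - Z 0 else 0.
  have M0 : model Euclidean (0 : E) by rewrite /model /= mxE.
  have VM x : model Euclidean x -> V x = Z x - Z 0 by rewrite /V => ->; rewrite eqxx.
  have Ve : V (row_of 4 [:: 1; 0; 0; 0]) = 0 by rewrite /V mxE oner_eq0.
  have TV x : model Euclidean x -> ip Euclidean (V x) (row_of 4 [:: 1; 0; 0; 0]) = 0.
    have e0 : row_of 4 [:: 1; 0; 0; 0] = delta_mx 0 0 :> E.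
      by apply: row4P => i i4; rewrite entry_row_of// entry_delta0//; case: i i4 => [|[|[|[|]]]].
    by move=> Mx; rewrite VM// e0 ipC ipBr !tZ// subrr.
  have VV x : model Euclidean x -> ip Euclidean (V x) x = 0.
    move=> Mx; have := euclidean_killing_pairing Y M0 Mx; rewrite -/Z subr0 VM// ipBl => ->.
    by rewrite subrr.
  have VD x y : model Euclidean x -> model Euclidean y ->
      ip Euclidean (V x) y + ip Euclidean (V y) x = 0.
    move=> Mx My; have := euclidean_killing_pairing Y Mx My; rewrite -/Z.
    have := VV x Mx; have := VV y My; rewrite !VM// !(ipBl, ipBr) => *; lra.
  have [||L skL VL] := @skew_matrix Euclidean T V (model_basis Euclidean) (model_basis_unit _).
  - move=> i; rewrite /T /model_basis /= rowK; case: i => [[|[|[|[|//]]]] ?] /=;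
      [by right|left; rewrite mxE..] => //.
  - move=> x y [Mx|->] [My|->]; first exact: VD.
    + by rewrite Ve ip0l addr0 TV.
    + by rewrite Ve ip0l add0r TV.
    + by rewrite Ve ip0l addr0.
  exists (Z 0), L; split=> // x Mx; have := VL x (or_introl Mx).
  by rewrite VM// => <-; rewrite addrC subrK.
have [||L skL ZL] := @skew_matrix M (model M) Z (model_basis M) (model_basis_unit M).
- by move=> i; exact: model_basis_in.
(* The segment between antipodal points leaves the cone, but for them tangency makes both products
   vanish. *)
- move=> x y Mx My; have [yx|xy] := eqVneq y (- x); last first.
    by apply: killing_pairing => // t t01; exact: model_segment_cone.
  have tZ' z : model M z -> ip M (Z z) z = 0.
    by move=> /tZ; rewrite /model_tangent /mkset ambient_normal_id// ipC.
  by rewrite -[x in ip M (Z y) x]opprK -yx {1}yx !ipNr !tZ'// oppr0 addr0.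
by exists 0, L; split => // x Mx; rewrite add0r ZL.
Qed.

End KillingAffine.

(** * Differential forms given by determinants *)

Section Det4Forms.
Context {R : realType}.
Local Notation E := 'rV[R]_4.
Implicit Types (M : spaceform) (V : normedModType R) (a b c d u v w : E).

Lemma det4D1 a a' b c d : det4 (a + a') b c d = det4 a b c d + det4 a' b c d.
Proof. by rewrite !det4E /= !entryD; ring. Qed.

Lemma det4Z1 k a b c d : det4 (k *: a) b c d = k * det4 a b c d.
Proof. by rewrite !det4E /= !entryZ; ring. Qed.

Lemma det4C12 a b c d : det4 b a c d = - det4 a b c d.
Proof. by rewrite !det4E /=; ring. Qed.

Lemma det4C23 a b c d : det4 a c b d = - det4 a b c d.
Proof. by rewrite !det4E /=; ring. Qed.

Lemma det4C34 a b c d : det4 a b d c = - det4 a b c d.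
Proof. by rewrite !det4E /=; ring. Qed.

Lemma det4D2 a b b' c d : det4 a (b + b') c d = det4 a b c d + det4 a b' c d.
Proof. by rewrite !(det4C12 _ a) det4D1 opprD. Qed.

Lemma det4Z2 k a b c d : det4 a (k *: b) c d = k * det4 a b c d.
Proof. by rewrite !(det4C12 _ a) det4Z1 mulrN. Qed.

Lemma det4_id34 a b c : det4 a b c c = 0.
Proof. by rewrite det4E /=; ring. Qed.

(** The free slot of the determinant is the third one, where the conormal form takes its
    argument. *)
Definition covector3 a b d : E := \row_i det4 a b (delta_mx 0 i) d.

Lemma dotv_covector3 a b d v : dotv (covector3 a b d) v = det4 a b v d.
Proof.
rewrite /dotv; under eq_bigr do rewrite mxE det4_leibniz mulr_suml.
rewrite exchange_big det4_leibniz; apply: eq_bigr => s _ /=.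
rewrite (bigD1 (s 2))//= big1 ?addr0 => [|i i2]; last first.
  by rewrite mxE eqxx eq_sym (negbTE i2) mul0r !mulr0 mul0r.
have c12 (e p q r t : R) : e * (p * (q * (1 * r))) * t = e * (p * (q * (t * r))) by ring.
by rewrite mxE !eqxx; exact: c12.
Qed.

Lemma Ck_covector3 V (U : set V) k (f1 f2 f4 : V -> E) : open U ->
  Ck U k f1 -> Ck U k f2 -> Ck U k f4 ->
  Ck U k (fun x => covector3 (f1 x) (f2 x) (f4 x)).
Proof.
move=> oU C1 C2 C4; apply: Ck_rV => // i.
rewrite (_ : (fun x => _) = fun x => det4 (f1 x) (f2 x) (delta_mx 0 i) (f4 x)).
  by apply: Ck_det4 => //; exact: Ck_cst.
by apply/funext => x; rewrite mxE.
Qed.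

Lemma derive_covector3 V (U : set V) (f1 f2 f4 : V -> E) (x u : V) v : open U -> U x ->
  Ck U 1 f1 -> Ck U 1 f2 -> Ck U 1 f4 ->
  dotv ('D_u (fun x => covector3 (f1 x) (f2 x) (f4 x)) x) v =
  det4 ('D_u f1 x) (f2 x) v (f4 x) + det4 (f1 x) ('D_u f2 x) v (f4 x) +
  det4 (f1 x) (f2 x) v ('D_u f4 x).
Proof.
move=> oU Ux C1 C2 C4; have dC := Ck_differentiable (Ck_covector3 oU C1 C2 C4) Ux.
have d1 := Ck_differentiable C1 Ux; have d2 := Ck_differentiable C2 Ux.
have d4 := Ck_differentiable C4 Ux.
have d4' i : differentiable (fun=> delta_mx 0 i : E) x by exact: differentiable_cst.
have -> : 'D_u (fun x => covector3 (f1 x) (f2 x) (f4 x)) x =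
    covector3 ('D_u f1 x) (f2 x) (f4 x) + covector3 (f1 x) ('D_u f2 x) (f4 x) +
    covector3 (f1 x) (f2 x) ('D_u f4 x).
  apply/rowP => i; rewrite -(derive_coord i u dC).
  rewrite (_ : (fun y => _) = fun y => det4 (f1 y) (f2 y) (delta_mx 0 i) (f4 y)); last first.
    by apply/funext => y; rewrite mxE.
  rewrite (derive_det4 u d1 d2 (d4' i) d4) derive_cst !mxE.
  have -> : det4 (f1 x) (f2 x) 0 (f4 x) = 0.
    by rewrite -(scale0r (0 : E)) det4C23 det4Z2 mul0r oppr0.
  by rewrite addr0.
by rewrite !dotvDl !dotv_covector3.
Qed.

(** Exterior derivative of an ambient field, in arbitrary directions. It agrees with
    [exterior_derivative] on tangent vectors when the field extends the given one, see
    [exterior_derivativeE]. *)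
Definition exterior (alpha : E -> E) (x u v : E) : R :=
  dotv ('D_u alpha x) v - dotv ('D_v alpha x) u.

Lemma exterior_linear k (alpha beta : E -> E) (x u v : E) :
  differentiable alpha x -> differentiable beta x ->
  exterior (k *: alpha + beta) x u v = k * exterior alpha x u v + exterior beta x u v.
Proof.
move=> da db; have D w : 'D_w (k *: alpha + beta) x = k *: 'D_w alpha x + 'D_w beta x.
  have dk : derivable (k *: alpha) x w by exact/derivableZ/diff_derivable.
  rewrite (deriveD dk (diff_derivable db)) (deriveZ _ (diff_derivable da)).
  by [].
rewrite /exterior !D; move: ('D_u alpha x) ('D_v alpha x) ('D_u beta x) ('D_v beta x).
move=> p q r t; rewrite !dotvDl !dotvZl.
have lin (a b c d : R) : k * a + b - (k * c + d) = k * (a - c) + (b - d) by ring.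
exact: lin.
Qed.

(** Pair with [x] the expression of [x] in [a], [b], [u], [v] given by Cramer's identity; the terms
    in [u] and [v] drop out. *)
Lemma det4_wedge M x a b u v : ip M x u = 0 -> ip M x v = 0 ->
  det4 x (ip M a x *: b - ip M b x *: a) u v = ip M x x * det4 a b u v.
Proof.
move=> xu xv; have := congr1 (ip M x) (det4_cramer a b u v x).
rewrite !ipDr !ipZr xu xv !mulr0 !addr0 -scaleNr det4D2 !det4Z2.
rewrite (mulrC (ip M x x)) => ->; rewrite (ipC M a) (ipC M b) (det4C12 a x); ring.
Qed.

Lemma ip_delta M u i : (i < 4)%N ->
  ip M (delta_mx 0 (inord i)) u = (if i == 0%N then model_sign M else 1) * entry u i.
Proof.
move=> i4; rewrite ipE !entry_delta//.
by case: M; case: i i4 => [|[|[|[|//]]]] _; rewrite /model_sign /=; ring.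
Qed.

(** By skewness x L is half the sum of the vectors <e_i, x> e_i L - <e_i L, x> e_i, with the signs
    of the metric, over the standard basis e_i; [det4_wedge] applies to each. So a form with
    coefficients quadratic in [x] has constant ones on the model, where <x, x> is constant. *)
Lemma det4_skew_radial M (L : 'M[R]_4) (x u v : E) : skew M L ->
  ip M x u = 0 -> ip M x v = 0 ->
  det4 x (x *m L) u v = ip M x x / 2 * \sum_(i < 4)
    (if i == 0%N :> nat then model_sign M else 1) *
    det4 (delta_mx 0 i) (delta_mx 0 i *m L) u v.
Proof.
move=> skL xu xv; pose e (i : nat) : R := if i == 0%N then model_sign M else 1.
have ee i : e i * e i = 1 by rewrite /e; case: ifP => _; rewrite ?model_sign_sqr ?mulr1.
have ipd (y : E) (i : 'I_4) : ip M (delta_mx 0 i) y = e i * y 0 i.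
  by rewrite -[in delta_mx 0 i](inord_val i) ip_delta// entryE.
have sumE (y : E) : y = \sum_(i < 4) e i *: (ip M (delta_mx 0 i) y *: delta_mx 0 i).
  by rewrite [LHS]row_sum_delta; apply: eq_bigr => i _; rewrite ipd !scalerA mulrA ee mul1r.
have xL : x *m L = \sum_(i < 4) (e i / 2) *:
    (ip M (delta_mx 0 i) x *: (delta_mx 0 i *m L) - ip M (delta_mx 0 i *m L) x *: delta_mx 0 i).
  have E1 : x *m L = \sum_(i < 4) e i *: (ip M (delta_mx 0 i) x *: (delta_mx 0 i *m L)).
    by rewrite {1}(sumE x) mulmx_suml; apply: eq_bigr => i _; rewrite !scalemxAl.
  have E2 : x *m L = \sum_(i < 4) e i *: (- ip M (delta_mx 0 i *m L) x *: delta_mx 0 i).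
    rewrite {1}(sumE (x *m L)); apply: eq_bigr => i _; congr (_ *: (_ *: _)).
    by apply/eqP; rewrite -addr_eq0 addrC skL.
  apply: (scalerI (_ : 2 != 0 :> R)); first by rewrite pnatr_eq0.
  rewrite scaler_sumr scaler_nat mulr2n {1}E1 E2 -big_split; apply: eq_bigr => i _.
  rewrite /= -scalerDr scalerA; have -> : 2 * (e i / 2) = e i by field.
  by rewrite scaleNr.
have det_sum (I : Type) (r : seq I) (f : I -> E) :
    det4 x (\sum_(i <- r) f i) u v = \sum_(i <- r) det4 x (f i) u v.
  elim: r => [|i r IH]; last by rewrite !big_cons det4D2 IH.
  by rewrite !big_nil -(scale0r (0 : E)) det4Z2 mul0r.
rewrite xL det_sum mulr_sumr; apply: eq_bigr => i _.
by rewrite det4Z2 (det4_wedge _ _ xu xv) /e; field.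
Qed.

(** The sum is the trace of [L] on the hyperplane times the volume of [u], [v], [x], and the
    diagonal of a skew matrix vanishes. *)
Lemma det4_skew_trace (L : 'M[R]_4) (x u v : E) : skew Euclidean L ->
  entry x 0 = 0 -> entry u 0 = 0 -> entry v 0 = 0 ->
  let n := delta_mx 0 0 : E in
  det4 n (u *m L) v x + det4 n u (v *m L) x + det4 n u v (x *m L) = 0.
Proof.
move=> skL x0 u0 v0 n; pose l i j := L (inord i) (inord j).
have entryL (y : E) j : entry y 0 = 0 -> entry (y *m L) j =
    entry y 1 * l 1%N j + entry y 2 * l 2%N j + entry y 3 * l 3%N j.
  move=> y0; rewrite {1}/entry mxE !big_ord_recl big_ord0 !entryE /= y0 /l /bump /=.
  rewrite mul0r add0r addr0 addrA.
  by congr (_ * L _ _ + _ * L _ _ + _ * L _ _); apply: val_inj; rewrite /= inordK.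
have lC i j : (0 < i < 4)%N -> (0 < j < 4)%N -> l i j = - l j i.
  move=> /andP[i0 i4] /andP[j0 j4]; have := skL (delta_mx 0 (inord i)) (delta_mx 0 (inord j)).
  rewrite (ipC _ (_ *m _)) !ip_delta// (gtn_eqF i0) (gtn_eqF j0) !mul1r => /eqP.
  rewrite addr_eq0 => /eqP; rewrite /entry /l -!rowE !mxE.
  exact.
have lD i : (0 < i < 4)%N -> l i i = 0.
  move=> hi; apply/eqP; have /eqP := lC i i hi hi.
  by rewrite -addr_eq0 -mulr2n mulrn_eq0.
rewrite !det4E /= !entry_delta0//= !entryL// x0 u0 v0 !lD// (lC 2%N 1%N)// (lC 3%N 1%N)//.
rewrite (lC 3%N 2%N)//; ring.
Qed.

Lemma exteriorZ k (alpha : E -> E) (x u v : E) : differentiable alpha x ->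
  exterior (k *: alpha) x u v = k * exterior alpha x u v.
Proof.
move=> da; have D w : 'D_w (k *: alpha) x = k *: 'D_w alpha x.
  exact: (deriveZ k (diff_derivable (v := w) da)).
rewrite /exterior !D; move: ('D_u alpha x) ('D_v alpha x) => p q.
by rewrite !dotvZl mulrBr.
Qed.

End Det4Forms.

(** * An explicit primitive of the flux form *)

Section FluxPrimitive.
Context {R : realType}.
Local Notation E := 'rV[R]_4.
Implicit Types (M : spaceform) (V : normedModType R) (a b c d u v w : E).

Lemma exterior_sum (I : Type) (r : seq I) (alpha : I -> E -> E) (x u v : E) :
  (forall i, differentiable (alpha i) x) ->
  differentiable (\sum_(i <- r) alpha i) x /\
  exterior (\sum_(i <- r) alpha i) x u v = \sum_(i <- r) exterior (alpha i) x u v.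
Proof.
move=> da; elim: r => [|i r [dr IH]].
  rewrite !big_nil; split; first exact: differentiable_cst.
  have D w : 'D_w (0 : E -> E) x = 0 by exact: derive_cst.
  rewrite /exterior !D -(scale0r (0 : E)) !dotvZl; ring.
rewrite !big_cons; split; first exact: differentiableD (da i) dr.
by have := exterior_linear 1 u v (da i) dr; rewrite scale1r mul1r IH.
Qed.

Lemma smooth_id : smooth setT (fun z : E => z).
Proof. by move=> k; apply: (Ck_linmap setT k (f := idfun)) => z; exact: cvg_id. Qed.

Lemma exterior_covector3_id a b (x u v : E) :
  exterior (fun y => covector3 a b y) x u v = - 2 * det4 a b u v.
Proof.
have C0 (c : E) := Ck_cst (setT : set E) 1 c.
have z1 (c d e : E) : det4 0 c d e = 0 by rewrite -(scale0r (0 : E)) det4Z1 mul0r.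
have z2 (c d e : E) : det4 c 0 d e = 0 by rewrite -(scale0r (0 : E)) det4Z2 mul0r.
have D w z : dotv ('D_w (fun y => covector3 a b y) x) z = 0 + 0 + det4 a b z w.
  have := derive_covector3 (f1 := fun=> a) (f2 := fun=> b) (x := x) w z openT I
    (C0 a) (C0 b) (smooth_id 1%N).
  by rewrite !derive_cst derive_id z1 z2.
apply: etrans (f_equal2 (fun p q : R => p - q) (D u v) (D v u)) _.
by rewrite (det4C34 _ _ u v); ring.
Qed.

(* On tangent vectors the flux form has constant coefficients in the two curved
   cases; in the flat case they are affine.  The factors come from contracting
   with the radial field, which multiplies the homogeneous parts of a closed form
   by their degree. *)
Definition flux_primitive M (b : E) (L : 'M[R]_4) : E -> E :=
  if M is Euclidean then
    (fun x => - 2^-1 *: covector3 (delta_mx 0 0) b x) +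
    (fun x => - 3^-1 *: covector3 (delta_mx 0 0) (x *m L) x)
  else \sum_(i < 4) (fun x => (- 4^-1 * (model_sign M * (if i == 0%N :> nat then model_sign M else 1))) *:
    covector3 (delta_mx 0 i) (delta_mx 0 i *m L) x).

Lemma smooth_flux_primitive M b L : smooth setT (flux_primitive M b L).
Proof.
move=> k; have CZ (c : R) (f : E -> E) : Ck setT k f -> Ck setT k (fun x => c *: f x).
  by move=> Cf; apply: CkZ => //; [exact: openT|exact: Ck_cst].
have CL : Ck setT k (fun x : E => x *m L).
  exact: (Ck_linmap setT k (f := mulr_map L) (@mulr_map_continuous R L)).
have C3 (f1 f2 : E -> E) : Ck setT k f1 -> Ck setT k f2 ->
    Ck setT k (fun x : E => covector3 (f1 x) (f2 x) x).
  by move=> C1 C2; apply: (Ck_covector3 openT C1 C2); exact: smooth_id.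
rewrite /flux_primitive; case: M => [||]; first apply: CkD; try exact: openT.
- by apply: CZ; apply: (C3 (fun=> _) (fun=> _)); exact: Ck_cst.
- by apply: CZ; apply: (C3 (fun=> _)) => //; exact: Ck_cst.
- apply: Ck_sum; first exact: openT.
  by move=> i _; apply: CZ; apply: (C3 (fun=> _) (fun=> _)); exact: Ck_cst.
- apply: Ck_sum; first exact: openT.
  by move=> i _; apply: CZ; apply: (C3 (fun=> _) (fun=> _)); exact: Ck_cst.
Qed.

(** In the curved cases [det4_skew_radial] writes the flux form as a sum of constant forms, each the
    exterior derivative of its covector up to the factor -2. In the flat case [det4_skew_trace]
    trades the two terms where [L] acts on [u] or [v] for one where it acts on [x], and the factor
    becomes -3 for the linear part. *)
Lemma exterior_flux_primitive M (b : E) (L : 'M[R]_4) (x u v : E) : skew M L ->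
  (M <> Euclidean -> b = 0) -> model M x -> model_tangent M x (b + x *m L) ->
  model_tangent M x u -> model_tangent M x v ->
  exterior (flux_primitive M b L) x u v = det4 (ambient_normal M x) (b + x *m L) u v.
Proof.
move=> skL b0 Mx TZ Tu Tv.
have smD (f : E -> E) : smooth setT f -> differentiable f x.
  by move=> sf; exact: Ck_differentiable (sf 1%N) I.
have dcov (a c : E) : differentiable (fun y => covector3 a c y) x.
  by apply: smD => k; apply: (Ck_covector3 openT (Ck_cst _ _ _) (Ck_cst _ _ _)); exact: smooth_id.
have dL : differentiable (fun y => covector3 (delta_mx 0 0) (y *m L) y) x.
  apply: smD => k; apply: (Ck_covector3 openT (Ck_cst _ _ _)); last exact: smooth_id.
  exact: (Ck_linmap setT k (f := mulr_map L) (@mulr_map_continuous R L)).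
have [MEu|ME] := pselect (M = Euclidean); last first.
  have Mn := ambient_normal_id x ME; rewrite /model_tangent /mkset Mn in Tu Tv.
  have -> : flux_primitive M b L = \sum_(i < 4)
      (- 4^-1 * (model_sign M * (if i == 0%N :> nat then model_sign M else 1))) *:
      (fun x => covector3 (delta_mx 0 i) (delta_mx 0 i *m L) x).
    by case: M ME {skL b0 Mx TZ Tu Tv Mn} => // /(_ erefl).
  have := ambient_normal_sqr Mx; rewrite Mn b0// add0r => xx.
  rewrite (det4_skew_radial skL Tu Tv) xx.
  apply: etrans (exterior_sum _ _ _ _).2 _ => [i|]; first exact: differentiableZ.
  rewrite mulr_sumr; apply: eq_bigr => i _; rewrite exteriorZ// exterior_covector3_id.
  by field.
subst M; rewrite /flux_primitive /ambient_normal.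
have -> : (fun x : E => - 2^-1 *: covector3 (delta_mx 0 0) b x) +
    (fun x : E => - 3^-1 *: covector3 (delta_mx 0 0) (x *m L) x) =
    (- 2^-1) *: (fun x : E => covector3 (delta_mx 0 0) b x) +
    (- 3^-1) *: (fun x : E => covector3 (delta_mx 0 0) (x *m L) x) by [].
rewrite exterior_linear//; last exact: differentiableZ.
rewrite exteriorZ// exterior_covector3_id.
set n : E := delta_mx 0 0.
have D w z : dotv ('D_w (fun y => covector3 n (y *m L) y) x) z =
    det4 n (w *m L) z x + det4 n (x *m L) z w.
  have := derive_covector3 (f1 := fun=> n) (f2 := mulr_map L) (x := x) w z openT I
    (Ck_cst _ 1 n) (Ck_linmap setT 1 (f := mulr_map L) (@mulr_map_continuous R L))
    (smooth_id 1%N).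
  rewrite derive_cst derive_id derive_mulr_map.
  by rewrite -[X in det4 X](scale0r (0 : E)) det4Z1 mul0r add0r.
have entry0 (w : E) : model_tangent Euclidean x w -> entry w 0 = 0.
  by rewrite /model_tangent /mkset /ambient_normal ipE !entry_delta0//= !mul0r !addr0 !mul1r.
have x0 : entry x 0 = 0 by move: Mx; rewrite /model /= entryE.
have := det4_skew_trace skL x0 (entry0 _ Tu) (entry0 _ Tv); rewrite -/n /=.
rewrite (det4C34 n u (x *m L)) (det4C23 n (x *m L) u) (det4C23 n (v *m L) u).
have := f_equal2 (fun p q : R => p - q) (D u v) (D v u).
rewrite -[dotv _ v - _]/(exterior (fun y => covector3 n (y *m L) y) x u v) => ->.
rewrite det4D2 (det4C34 n (x *m L) u v) => e; lra.
Qed.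

End FluxPrimitive.

(** * Charts, frames and the trace identity *)

Section SurfaceGeometry.
Context {R : realType}.
Local Notation E := 'rV[R]_4.
Implicit Types (M : spaceform) (Sigma : set E).

Definition surface_chart Sigma (U : set 'rV[R]_2) (X : 'rV[R]_2 -> E) :=
  [/\ open U, smooth U X, forall y, U y -> Sigma (X y) &
      forall y, U y -> injective ('d X y)].

Lemma surface_chart_at Sigma p : embedded_surface Sigma -> Sigma p ->
  exists U X u, [/\ surface_chart Sigma U X, U u & X u = p].
Proof.
move=> eS Sp; have [U [V [X [_ [oU [_ Vp] sX XU [iX _ _]]]]]] := eS p Sp.
have [u Uu Xu] : (X @` U) p by rewrite XU.
exists U, X, u; split=> //; split=> // y Uy.
by have [] : (Sigma `&` V) (X y) by rewrite -XU; exists y.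
Qed.

Lemma chart_tangent Sigma U X y (w : 'rV[R]_2) : surface_chart Sigma U X -> U y ->
  tangent_space Sigma (X y) ('D_w X y).
Proof.
move=> [oU sX XS _] Uy; pose g (t : R) := y + t *: w.
have cg : continuous g by exact: affine_continuous.
have g0 : g 0 = y by rewrite /g scale0r addr0.
exists (g @^-1` U), (X \o g); split.
- by split; [apply: open_comp => // t _; exact: cg|rewrite /= g0].
- have oJ : open (g @^-1` U) by apply: open_comp => // t _; exact: cg.
  by move=> n; apply: Ck_comp (sX n) => //; exact: Ck_affine_line.
- by move=> t; exact: XS.
- by rewrite /= g0.
- have [/derivable1_diffP dg eg] := is_derive_affine y w 0.
  have dX : differentiable X (g 0) by rewrite g0; exact: Ck_differentiable (sX 1%N) Uy.
  by have := derive_comp (1 : R) dg dX; rewrite eg -[y + 0 *: w]/(g 0) g0.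
Qed.

(** Stated for a linear map on the plane so that the orthonormal frame comes with its directions in
    the parameter domain; these span the small triangles of the converse. *)
Lemma gram_schmidt M (D : {linear 'rV[R]_2 -> E}) :
  (forall w, w != 0 -> 0 < ip M (D w) (D w)) ->
  exists w1 w2, [/\ ip M (D w1) (D w1) = 1, ip M (D w2) (D w2) = 1 &
    ip M (D w1) (D w2) = 0].
Proof.
move=> pos.
have unit_vector w : w != 0 -> exists2 c, c != 0 & ip M (D (c *: w)) (D (c *: w)) = 1.
  move=> /pos w0; exists (Num.sqrt (ip M (D w) (D w)))^-1.
    by rewrite invr_eq0 sqrtr_eq0 -ltNge.
  rewrite linearZ ipZl ipZr mulrA -expr2 exprVn sqr_sqrtr ?ltW// mulVf// gt_eqF//.
pose e1 : 'rV[R]_2 := delta_mx 0 0; pose e2 : 'rV[R]_2 := delta_mx 0 1.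
have e10 : e1 != 0.
  by apply/eqP => /rowP/(_ 0)/eqP; rewrite !mxE !eqxx /= oner_eq0.
have [c c0 n1] := unit_vector e1 e10; set w1 := c *: e1 in n1.
pose w2 := e2 - ip M (D w1) (D e2) *: w1.
have w20 : w2 != 0.
  apply/eqP => /rowP/(_ 1)/eqP; rewrite !mxE !eqxx /= !mulr0 subr0.
  by rewrite oner_eq0.
have [d d0 n2] := unit_vector w2 w20; exists w1, (d *: w2); split=> //.
have -> : D (d *: w2) = d *: (D e2 - ip M (D w1) (D e2) *: D w1).
  by rewrite linearZ /= /w2 linearB linearZ.
by rewrite ipZr ipBr ipZr n1 mulr1 subrr mulr0.
Qed.

Lemma chart_frame M Sigma U X u : Sigma `<=` model M -> surface_chart Sigma U X ->
  U u -> exists w1 w2, orthonormal_frame M Sigma (X u) ('D_w1 X u, 'D_w2 X u).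
Proof.
move=> SM cX Uu; have [oU sX XS iX] := cX.
have dX : differentiable X u by exact: Ck_differentiable (sX 1%N) Uu.
have T w := chart_tangent w cX Uu.
have [w w0|w1 [w2 [n1 n2 n12]]] := @gram_schmidt M ('d X u).
  apply: (ip_tangent_gt0 (x := X u)); first exact/SM/XS.
    by apply: tangent_space_model; rewrite -deriveE//; exact: tangent_spaceS SM _ (T w).
  apply: contra_neq w0 => dw0; apply: (iX u Uu); rewrite dw0.
  by rewrite linear0.
by exists w1, w2; split=> //=; rewrite !deriveE.
Qed.

Lemma surface_frame M Sigma p : Sigma `<=` model M -> embedded_surface Sigma ->
  Sigma p -> orthonormal_frame M Sigma p !=set0.
Proof.
move=> SM eS Sp; have [U [X [u [cX Uu <-]]]] := surface_chart_at eS Sp.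
by have [w1 [w2 fr]] := chart_frame SM cX Uu; eexists; exact: fr.
Qed.

(** [d1] and [d2] are meant to be the derivatives of the normal along [f1] and [f2]. The terms in
    [L] combine into its trace on the tangent plane, zero by skewness. Those in [d1] and [d2]
    combine into minus the trace of the shape operator times the last determinant, to which only the
    component of [Z] along [nu] contributes. *)
Lemma conormal_identity M n f1 f2 nu (L : 'M[R]_4) (Z d1 d2 : E) u1 u2 v1 v2 :
  orthonormal_basis M n f1 f2 nu -> skew M L -> ip M nu d1 = 0 -> ip M nu d2 = 0 ->
  let u := u1 *: f1 + u2 *: f2 in let v := v1 *: f1 + v2 *: f2 in
  det4 n (u *m L) v nu + det4 n Z v (u1 *: d1 + u2 *: d2) -
  (det4 n (v *m L) u nu + det4 n Z u (v1 *: d1 + v2 *: d2)) =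
  - (ip M d1 f1 + ip M d2 f2) * det4 n Z u v.
Proof.
move=> onb skL nd1 nd2 u v; have exp y := orthonormal_basis_expand y onb.
pose C := comb n f1 f2 nu.
have nE : n = C [:: 1; 0; 0; 0] by rewrite /C /comb /= scale1r !scale0r !addr0.
have nuE : nu = C [:: 0; 0; 0; 1] by rewrite /C /comb /= scale1r !scale0r !add0r.
have uE : u = C [:: 0; u1; u2; 0] by rewrite /C /comb /= !scale0r add0r addr0.
have vE : v = C [:: 0; v1; v2; 0] by rewrite /C /comb /= !scale0r add0r addr0.
have L11 : ip M f1 (f1 *m L) = 0.
  have := skL f1 f1; rewrite (ipC M (_ *m _)) => /eqP.
  by rewrite -mulr2n mulrn_eq0 => /eqP.
have L22 : ip M f2 (f2 *m L) = 0.
  have := skL f2 f2; rewrite (ipC M (_ *m _)) => /eqP.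
  by rewrite -mulr2n mulrn_eq0 => /eqP.
have L21 : ip M f2 (f1 *m L) = - ip M f1 (f2 *m L).
  by apply/eqP; rewrite -addr_eq0 ipC skL.
(* The coefficients along [n] and [nu] may stay anonymous: both vectors already occur in the
   determinants where [L] acts. *)
have combL (a b : R) : exists p q : R, (a *: f1 + b *: f2) *m L =
    C [:: p; b * ip M f1 (f2 *m L); - a * ip M f1 (f2 *m L); q].
  set w := a *: f1 + b *: f2.
  exists (ip M n (w *m L) / ip M n n), (ip M nu (w *m L)).
  have e1 : ip M f1 (w *m L) = b * ip M f1 (f2 *m L).
    by rewrite /w mulmxDl -!scalemxAl ipDr !ipZr L11 mulr0 add0r.
  have e2 : ip M f2 (w *m L) = - a * ip M f1 (f2 *m L).
    by rewrite /w mulmxDl -!scalemxAl ipDr !ipZr L22 L21 mulr0 addr0 mulrN mulNr.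
  by rewrite -e1 -e2; exact: exp.
have [p [q uLE]] := combL u1 u2; have [p' [q' vLE]] := combL v1 v2.
have dE a b : exists r, a *: d1 + b *: d2 = C [:: r; a * ip M d1 f1 + b * ip M d2 f1;
    a * ip M d1 f2 + b * ip M d2 f2; 0].
  exists (ip M n (a *: d1 + b *: d2) / ip M n n).
  rewrite {1}(exp (a *: d1 + b *: d2)) !ipDr !ipZr nd1 nd2 !mulr0 addr0.
  by rewrite !(ipC M f1) !(ipC M f2).
have [r duE] := dE u1 u2; have [r' dvE] := dE v1 v2.
have ZE := exp Z; set z0 := _ / _ in ZE; set z1 := ip M f1 Z in ZE.
set z2 := ip M f2 Z in ZE; set z3 := ip M nu Z in ZE.
rewrite -/u -/v in uLE vLE; rewrite uLE vLE duE dvE {}uE {}vE ZE -/C.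
rewrite [X in det4 X]nE [X in det4 _ _ _ X + _]nuE [X in _ - (det4 _ _ _ X + _)]nuE.
rewrite /C !det4_comb; move: (det4 n f1 f2 nu) => D.
rewrite !det4E /= !entry_row_of//=.
move: (ip M f1 (f2 *m L)) (ip M d1 f1) (ip M d1 f2) (ip M d2 f1) (ip M d2 f2).
move=> l s11 s12 s21 s22; clearbody z0 z1 z2 z3.
rewrite !(mul0r, mulr0, mul1r, mulr1, subr0, sub0r, addr0, add0r, oppr0).
ring.
Qed.

End SurfaceGeometry.

Lemma derive_dirZ (R : realType) (V W : normedModType R) (f : V -> W) x a v :
  differentiable f x -> 'D_(a *: v) f x = a *: 'D_v f x.
Proof. by move=> df; rewrite !deriveE// linearZ. Qed.

(** * The conormal form and the mean curvature *)

Section ConormalForm.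
Context {R : realType}.
Local Notation E := 'rV[R]_4.
Context (M : spaceform) (o : bool) (Sigma : set E) (nu : E -> E).
Context (SM : Sigma `<=` model M) (eS : embedded_surface Sigma)
  (nuS : unit_normal M Sigma nu).

Lemma normal_tangent x u : Sigma x -> tangent_space Sigma x u ->
  ip M (ambient_normal M x) u = 0.
Proof. by move=> Sx /(tangent_spaceS SM)/tangent_space_model. Qed.

Lemma normal_nu x : Sigma x -> ip M (ambient_normal M x) (nu x) = 0.
Proof. by move=> Sx; have [_ /(_ x Sx)[]] := nuS. Qed.

(** The frame selected by [divergence], in which the mean curvature is computed. *)
Definition frame_at x : E * E := xget (0, 0) (orthonormal_frame M Sigma x).

Lemma frame_atP x : Sigma x -> orthonormal_frame M Sigma x (frame_at x).
Proof. by move=> Sx; have [f fP] := surface_frame SM eS Sx; apply: xgetPex; exists f. Qed.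

Lemma orthonormal_frame_basis x f : Sigma x -> orthonormal_frame M Sigma x f ->
  orthonormal_basis M (ambient_normal M x) f.1 f.2 (nu x).
Proof.
move=> Sx [t1 t2 n1 n2 n12]; have [Tn nn nT] := nuS.2 x Sx.
split; first exact/ambient_normal_sqr_neq0/SM.
- by split; [exact: normal_tangent..|].
- by [].
- by split=> //; rewrite ipC nT.
Qed.

Lemma frame_basis x : Sigma x ->
  orthonormal_basis M (ambient_normal M x) (frame_at x).1 (frame_at x).2 (nu x).
Proof. by move=> Sx; exact/orthonormal_frame_basis/frame_atP. Qed.

Lemma tangent_coordinates x u : Sigma x -> tangent_space Sigma x u ->
  u = ip M (frame_at x).1 u *: (frame_at x).1 + ip M (frame_at x).2 u *: (frame_at x).2.
Proof.
move=> Sx Tu; rewrite {1}(orthonormal_basis_expand u (frame_basis Sx)) /comb /=.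
have [_ _ nT] := nuS.2 x Sx.
by rewrite nT// normal_tangent// mul0r !scale0r add0r addr0.
Qed.

(** Differentiate <nu, nu> = 1 along a curve of the surface with velocity [u]. *)
Lemma normal_derivative x u N : Sigma x -> tangent_space Sigma x u ->
  local_extension Sigma nu x N -> ip M (nu x) ('D_u N x) = 0.
Proof.
move=> Sx [I [g [[oI I0] sg gS g0 <-]]] NE.
have [U [[oU Ux] sN eN]] := NE.
have dN := local_extension_differentiable NE.
have dg : differentiable g 0 by exact: Ck_differentiable (sg 1%N) I0.
have dN' : differentiable N (g 0) by rewrite g0.
have dNg : differentiable (N \o g) 0 by exact: differentiable_comp.
have nI : \forall s \near (0 : R), I s by exact: open_nbhs_nbhs.
have nU : \forall s \near (0 : R), U (g s).
  by apply: (differentiable_continuous dg); rewrite g0; exact: open_nbhs_nbhs.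
have := ip_const (M := M) (c := 1) 1 dNg.
rewrite (derive_comp (1 : R) dg dN') /= g0 eN//; apply.
near=> s; have Ss : Sigma (g s) by apply: gS; near: s.
rewrite eN//; last by near: s.
by have [_ /(_ _ Ss)[]] := nuS.
Unshelve. all: by end_near. Qed.

Definition conormal_covector (Z : E -> E) (x : E) : E :=
  (-1) ^+ o *: covector3 (ambient_normal M x) (Z x) (nu x).

(** Removing from [Z] its component along [nu] does not change a determinant whose last slot is
    [nu]. *)
Lemma conormal_formE (Z : E -> E) :
  conormal_form M o nu Z = one_form (conormal_covector Z).
Proof.
apply/funext => x; apply/funext => v; rewrite /one_form dotvZl dotv_covector3.
rewrite /conormal_form /area volE -scaleNr det4D2 det4Z2; congr (_ * _).
by rewrite (det4C23 _ v (nu x)) det4_id34 oppr0 mulr0 addr0.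
Qed.

Lemma mean_curvatureE x N : Sigma x -> local_extension Sigma nu x N ->
  mean_curvature M Sigma nu x = ip M ('D_((frame_at x).1) N x) (frame_at x).1 +
    ip M ('D_((frame_at x).2) N x) (frame_at x).2.
Proof.
move=> Sx NE; have [t1 t2 _ _ _] := frame_atP Sx.
rewrite /mean_curvature /divergence -/(frame_at x) /covariant_derivative.
have e1 := derive_along_tangent NE t1; have e2 := derive_along_tangent NE t2.
have T1 : model_tangent M x (frame_at x).1 := normal_tangent Sx t1.
have T2 : model_tangent M x (frame_at x).2 := normal_tangent Sx t2.
exact: f_equal2 (etrans (ip_tangent_proj _ T1) (congr1 (ip M ^~ _) e1))
  (etrans (ip_tangent_proj _ T2) (congr1 (ip M ^~ _) e2)).
Qed.

Context (b : E) (L : 'M[R]_4) (Z : E -> E).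
Context (skL : skew M L) (ZL : forall x, model M x -> Z x = b + x *m L)
  (tZ : forall x, model M x -> model_tangent M x (Z x)).

Definition conormal_extension (N : E -> E) (x : E) : E :=
  (-1) ^+ o *: covector3 (ambient_normal M x) (b + x *m L) (N x).

Lemma Ck_conormal_extension (U : set E) k N : open U -> Ck U k N ->
  Ck U k (conormal_extension N).
Proof.
move=> oU CN; apply: CkZ => //; first exact: Ck_cst.
apply: Ck_covector3 => //; last exact: Ck_affine.
by rewrite ambient_normal_affine; exact: Ck_affine.
Qed.

Lemma conormal_extensionP x N : local_extension Sigma nu x N ->
  local_extension Sigma (conormal_covector Z) x (conormal_extension N).
Proof.
move=> [U [[oU Ux] sN eN]]; exists U; split=> [//|k|y Sy Uy].
  exact: Ck_conormal_extension.
by rewrite /conormal_extension /conormal_covector eN// -ZL//; exact: SM.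
Qed.

(** The derivative of the ambient normal drops out: it yields a determinant of four vectors
    orthogonal to that normal. The remaining terms are those of [conormal_identity] in the frame
    that defines the mean curvature. *)
Lemma conormal_exterior x N u v : Sigma x -> local_extension Sigma nu x N ->
  tangent_space Sigma x u -> tangent_space Sigma x v ->
  exterior (conormal_extension N) x u v =
  - mean_curvature M Sigma nu x * flux_form M o Z x u v.
Proof.
move=> Sx NE Tu Tv; have Mx := SM Sx; rewrite (mean_curvatureE Sx NE).
have [U [[oU Ux] sN eN]] := NE; have dN := local_extension_differentiable NE.
have Nx : N x = nu x by rewrite eN.
pose n : E -> E := ambient_normal M; have CL := Ck_affine 1 b L oU.
have Cn : Ck U 1 n by rewrite /n ambient_normal_affine; exact: Ck_affine.
pose cov (y : E) : E := covector3 (n y) (b + y *m L) (N y).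
have dcov : differentiable cov x.
  exact: Ck_differentiable (Ck_covector3 oU Cn CL (sN 1%N)) Ux.
have -> : conormal_extension N = (-1) ^+ o *: cov by [].
rewrite exteriorZ// /flux_form volE.
have D w z : tangent_space Sigma x w -> tangent_space Sigma x z ->
    dotv ('D_w cov x) z = det4 (n x) (w *m L) z (nu x) + det4 (n x) (Z x) z ('D_w N x).
  move=> Tw Tz; rewrite (derive_covector3 w z oU Ux Cn CL (sN 1%N)) Nx -ZL//.
  have [_ ->] := derive_affine b L x w.
  have -> : 'D_w n x = w *m ambient_normal_mx M.
    by rewrite /n ambient_normal_affine; have [_ ->] := derive_affine (ambient_normal_cst M) (ambient_normal_mx M) x w.
  rewrite (det4_orthogonal (M := M) (n := n x)) ?add0r//.
  - exact: ambient_normal_sqr_neq0.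
  - have := normal_tangent Sx Tw; rewrite /n /ambient_normal_mx; case: (M) => *;
      by rewrite ?mulmx0 ?ip0r ?mulmx1.
  - exact: tZ.
  - exact: normal_tangent.
  - exact: normal_nu.
have [t1 t2 _ _ _] := frame_atP Sx.
have n1 := normal_derivative Sx t1 NE; have n2 := normal_derivative Sx t2 NE.
have := conormal_identity (Z x) (ip M (frame_at x).1 u) (ip M (frame_at x).2 u)
  (ip M (frame_at x).1 v) (ip M (frame_at x).2 v) (frame_basis Sx) skL n1 n2.
rewrite /= -!tangent_coordinates//.
have DN w : tangent_space Sigma x w -> 'D_w N x =
    ip M (frame_at x).1 w *: 'D_((frame_at x).1) N x +
    ip M (frame_at x).2 w *: 'D_((frame_at x).2) N x.
  move=> Tw; rewrite {1}(tangent_coordinates Sx Tw) derive_dir_linear//.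
  exact: (congr1 (fun z => _ + z) (derive_dirZ _ _ dN)).
rewrite -!DN// -D// -D// -[dotv _ v - _]/(exterior cov x u v) => ->.
by rewrite mulrCA.
Qed.

End ConormalForm.

(** * Equality of integrals of forms, and the flux through a chain *)

Section FormIntegrals.
Context {R : realType}.
Local Notation E := 'rV[R]_4.
Local Notation mu := (@lebesgue_measure R).
Local Notation S2 := (stdsimplex R 2).
Local Notation pt t u := (row_of 3 [:: 1 - t - u; t; u]).

(** The two forms are compared at interior points of the simplex, where the velocities are tangent
    to [X]; continuity of the first integrand up to the boundary provides the integrability. *)
Lemma eq_integral2 (X : set E) (b b' : E -> E -> E -> R) (s : simplex R 2) :
  let f := 'valL_0 s in let df := derive_along S2 f in
  smooth_simplex_in X s ->
  {within S2, continuous (fun x => b (f x) (df x (vertex3 1 - vertex3 0))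
    (df x (vertex3 2 - vertex3 0)))} ->
  (forall x u v, X x -> tangent_space X x u -> tangent_space X x v ->
    b x u v = b' x u v) ->
  integral2 b s = integral2 b' s.
Proof.
move=> f df sX cb bb'; have [ss Xs] := sX.
rewrite /integral2 row_of3_1 row_of3_2; apply: eq_Rintegral_oo.
  move=> t /andP[t0 t1]; apply: eq_Rintegral_oo; last first.
    exact: simplex_inner_integrable cb (ltW t0).
  move=> u /andP[u0 u1]; have Sx : S2 (pt t u) by apply: barycentric3_in; lra.
  have T i j := simplex_tangent (x := pt t u) i j sX Sx.
  by apply: bb'; [exact: simplex_in_valL Xs Sx|apply: T..] => l;
    rewrite mxE; case: l => [[|[|[|//]]] ?] /=; lra.
exact: simplex_outer_integrable cb.
Qed.

Lemma integral2_0 (s : simplex R 2) : integral2 (fun _ _ _ => 0) s = 0.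
Proof.
have int0 (D : set R) : \int[mu]_(t in D) (0 : R) = 0 by rewrite /Rintegral integral0.
by rewrite /integral2; under eq_Rintegral do rewrite int0; exact: int0.
Qed.

Lemma integral1_linear (X : set E) (alpha beta : E -> E) (k : R) (s : simplex R 1) :
  smooth_on X alpha -> smooth_on X beta -> smooth_simplex_in X s ->
  integral1 (one_form (fun x => k *: alpha x + beta x)) s =
  k * integral1 (one_form alpha) s + integral1 (one_form beta) s.
Proof.
move=> sa sb [ss Xs]; set f := 'valL_0 s : 'rV[R]_2 -> E.
have cS := @stdsimplex_convex R 1.
have dE : row_of 2 [:: -1; 1] = delta_mx 0 1 - delta_mx 0 0 :> 'rV[R]_2.
  by apply/rowP => -[[|[|//]] ?]; rewrite !mxE -!val_eqE /= ?sub0r ?subr0.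
have int (c : E -> E) : smooth_on X c -> mu.-integrable `[0, 1] (EFin \o (fun t =>
    one_form c (f (row_of 2 [:: 1 - t; t])) (derive_along (stdsimplex R 1) f
      (row_of 2 [:: 1 - t; t]) (row_of 2 [:: -1; 1])))).
  move=> sc; pose g x := dotv (c (f x)) (derive_along (stdsimplex R 1) f x
    (delta_mx 0 1 - delta_mx 0 0)).
  have sg : smooth_on (stdsimplex R 1) g.
    apply: smooth_on_dotv; last by apply: smooth_on_derive => //; exact: stdsimplex_vertex.
    by apply: smooth_on_comp ss sc => y Sy; exact: simplex_in_valL Xs Sy.
  apply: continuous_itv_integrable.
  have := continuous_on_line (y := delta_mx 0 0) (w := delta_mx 0 1 - delta_mx 0 0)
    (A := `[0, 1]) (smooth_on_continuous sg).
  have lineE t : delta_mx 0 0 + t *: (delta_mx 0 1 - delta_mx 0 0) =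
      row_of 2 [:: 1 - t; t] :> 'rV[R]_2.
    by apply/rowP => -[[|[|//]] ?]; rewrite !mxE -!val_eqE /=; ring.
  rewrite dE (_ : (fun t : R => g (delta_mx 0 0 + t *: (delta_mx 0 1 - delta_mx 0 0))) =
    fun t => g (row_of 2 [:: 1 - t; t])); last by apply/funext => t; rewrite lineE.
  apply=> t /=; rewrite in_itv /= lineE => /andP[t0 t1].
  by apply: row_of2_in => //; lra.
rewrite /integral1 -/f.
have -> : k * (\int[mu]_(t in `[0, 1]) one_form alpha (f (row_of 2 [:: 1 - t; t]))
    (derive_along (stdsimplex R 1) f (row_of 2 [:: 1 - t; t]) (row_of 2 [:: -1; 1]))) =
  \int[mu]_(t in `[0, 1]) (k * one_form alpha (f (row_of 2 [:: 1 - t; t]))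
    (derive_along (stdsimplex R 1) f (row_of 2 [:: 1 - t; t]) (row_of 2 [:: -1; 1]))).
  by rewrite RintegralZl//; exact: int.
rewrite -RintegralD//; last 2 first.
- have ska : smooth_on X (fun x => k *: alpha x).
    by apply: smooth_onZ sa; exact: smooth_on_cst.
  apply: eq_integrable (int _ ska) => [|t _]; first exact: measurable_itv.
  by rewrite /= /one_form dotvZl.
- exact: int.
by apply: eq_Rintegral => t _; rewrite /one_form dotvDl dotvZl.
Qed.

Lemma smooth_on_det4 m (S : set 'rV[R]_m) (f1 f2 f3 f4 : 'rV[R]_m -> E) :
  smooth_on S f1 -> smooth_on S f2 -> smooth_on S f3 -> smooth_on S f4 ->
  smooth_on S (fun x => det4 (f1 x) (f2 x) (f3 x) (f4 x)).
Proof.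
move=> s1 s2 s3 s4; rewrite det4_fctE; apply: smooth_on_sum => s _.
by repeat (apply: smooth_onM => //); (exact: smooth_on_cst || exact: smooth_on_coord).
Qed.

Context {A : comNzRingType} (iota : {rmorphism A -> R}).

(** Stokes' theorem is applied in the space form rather than on the surface: [K] is free to leave
    [Sigma], and the primitive is smooth on the whole ambient space. *)
Lemma stokes_flux M o (b : E) (L : 'M[R]_4) (Z : E -> E) (K : chain R A 2) :
  skew M L -> (M <> Euclidean -> b = 0) ->
  (forall x, model M x -> Z x = b + x *m L) ->
  (forall x, model M x -> model_tangent M x (Z x)) -> chain_in (model M) K ->
  chain_integral iota (integral2 (flux_form M o Z)) K =
  chain_integral iota (integral1 (one_form ((-1) ^+ o *: flux_primitive M b L)))
    (boundary K).
Proof.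
move=> skL b0 ZL tZ KM; set prim := (-1) ^+ o *: _.
have sp : smooth setT prim.
  move=> k; have := smooth_flux_primitive M b L k.
  exact: CkZ openT (Ck_cst _ _ _).
have dp x : differentiable (flux_primitive M b L) x.
  exact: Ck_differentiable (smooth_flux_primitive M b L 1%N) I.
have spM : smooth_on (model M) prim by exact: (smooth_smooth_on openT).
rewrite (stokes iota spM KM); apply: eq_chain_integral KM _ => s sM; have [ss Ms] := sM.
apply: eq_integral2 sM _ _ => [|x u v Mx Tu Tv]; last first.
  have pE : local_extension (model M) prim x prim.
    by exists setT; split=> //; split; [exact: openT|].
  rewrite /exterior_derivative !(derive_along_tangent pE)//.
  rewrite -[RHS]/(exterior prim x u v) exteriorZ// exterior_flux_primitive//.
  - by rewrite /flux_form volE ZL.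
  - by rewrite -ZL//; exact: tZ.
  - exact: tangent_space_model.
  - exact: tangent_space_model.
set f := 'valL_0 s; have cS := @stdsimplex_convex R 2.
have fM y : S2 y -> model M (f y) by move=> Sy; exact: simplex_in_valL Ms Sy.
have saff (c : E) (B : 'M[R]_4) : smooth_on S2 (fun y => c + f y *m B).
  have sc : smooth_on (model M) (fun x : E => c + x *m B).
    by apply: (smooth_smooth_on openT) => // k; exact: Ck_affine openT.
  exact: (smooth_on_comp fM ss sc).
have sd w w' : S2 w -> S2 w' -> smooth_on S2 (fun y => derive_along S2 f y (w - w')).
  by move=> Sw Sw'; exact: smooth_on_derive.
apply/smooth_on_continuous.
apply: (@eq_smooth_on _ _ _ _ ((fun=> (-1) ^+ o) * fun y =>
    det4 (ambient_normal_cst M + f y *m ambient_normal_mx M) (b + f y *m L)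
    (derive_along S2 f y (vertex3 1 - vertex3 0))
    (derive_along S2 f y (vertex3 2 - vertex3 0)))).
  by move=> y Sy; rewrite /flux_form volE ambient_normal_affine ZL//; exact: fM.
apply: smooth_onM; first exact: smooth_on_cst.
by apply: smooth_on_det4; [exact: saff|exact: saff|apply: sd; exact: vertex3_in..].
Qed.

End FormIntegrals.

Lemma exterior_derivativeE (R : realType) (X : set 'rV[R]_4)
    (alpha F : 'rV[R]_4 -> 'rV[R]_4) x u v :
  local_extension X alpha x F -> tangent_space X x u -> tangent_space X x v ->
  exterior_derivative X alpha x u v = exterior F x u v.
Proof.
move=> FE Tu Tv; rewrite /exterior_derivative.
by rewrite (derive_along_tangent FE Tu) (derive_along_tangent FE Tv).
Qed.

(** * The form theta: extension, exterior derivative, integrals *)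

Section WeightedCovector.
Context {R : realType} {A : comNzRingType} (iota : {rmorphism A -> R}).
Local Notation E := 'rV[R]_4.
Context (M : spaceform) (o : bool) (Sigma : set E) (nu : E -> E).
Context (SM : Sigma `<=` model M) (eS : embedded_surface Sigma)
  (nuS : unit_normal M Sigma nu).
Context (H : R) (b : E) (L : 'M[R]_4) (Z : E -> E).
Context (skL : skew M L) (b0 : M <> Euclidean -> b = 0)
  (ZL : forall x, model M x -> Z x = b + x *m L)
  (tZ : forall x, model M x -> model_tangent M x (Z x)).

Definition signed_primitive : E -> E := (-1) ^+ o *: flux_primitive M b L.

Definition weighted_covector (x : E) : E :=
  H *: signed_primitive x + conormal_covector M o nu Z x.

Definition weighted_extension (N : E -> E) : E -> E :=
  H *: signed_primitive + conormal_extension M o b L N.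

Lemma Ck_signed_primitive (U : set E) k : open U -> Ck U k signed_primitive.
Proof.
move=> oU; apply: CkZ => //; first exact: Ck_cst.
by apply: CkW (smooth_flux_primitive M b L k).
Qed.

Lemma weighted_extensionP x N : Sigma x -> local_extension Sigma nu x N ->
  local_extension Sigma weighted_covector x (weighted_extension N).
Proof.
move=> Sx NE; have CE := conormal_extensionP o SM ZL NE.
have PE : local_extension Sigma signed_primitive x signed_primitive.
  exists setT; split=> //; first by split=> //; exact: openT.
  by move=> k; exact: Ck_signed_primitive openT.
exact: local_extension_linear.
Qed.

Lemma weighted_covector_smooth : smooth_on Sigma weighted_covector.
Proof.
move=> x Sx; have [N NE] := nuS.1 x Sx; exists (weighted_extension N).
exact: weighted_extensionP.
Qed.

Lemma weighted_exterior x N u v : Sigma x -> local_extension Sigma nu x N ->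
  tangent_space Sigma x u -> tangent_space Sigma x v ->
  exterior (weighted_extension N) x u v =
  (H - mean_curvature M Sigma nu x) * flux_form M o Z x u v.
Proof.
move=> Sx NE Tu Tv; have Mx := SM Sx.
have dp y : differentiable (flux_primitive M b L) y.
  exact: Ck_differentiable (smooth_flux_primitive M b L 1%N) I.
have dsp : differentiable signed_primitive x.
  exact: Ck_differentiable (Ck_signed_primitive 1 openT) I.
have dC : differentiable (conormal_extension M o b L N) x.
  exact: local_extension_differentiable (conormal_extensionP o SM ZL NE).
rewrite (exterior_linear H u v dsp dC) (conormal_exterior o SM eS nuS skL ZL tZ Sx NE Tu Tv).
rewrite exteriorZ// exterior_flux_primitive//.
- by rewrite /flux_form volE ZL// mulrBl mulNr.
- by rewrite -ZL//; exact: tZ.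
- exact: normal_tangent SM _ _ Sx Tu.
- exact: normal_tangent SM _ _ Sx Tv.
Qed.

Lemma weighted_exterior_derivative x u v : Sigma x ->
  tangent_space Sigma x u -> tangent_space Sigma x v ->
  exterior_derivative Sigma weighted_covector x u v =
  (H - mean_curvature M Sigma nu x) * flux_form M o Z x u v.
Proof.
move=> Sx Tu Tv; have [N NE] := nuS.1 x Sx.
rewrite -(weighted_exterior Sx NE Tu Tv).
exact: exterior_derivativeE (weighted_extensionP Sx NE) Tu Tv.
Qed.

Definition weighted_integral (Gamma : chain R A 1) : R :=
  chain_integral iota (integral1 (one_form weighted_covector)) Gamma.

Lemma weighted_integral_boundary (D : chain R A 2) :
  (forall p, Sigma p -> mean_curvature M Sigma nu p = H) -> chain_in Sigma D ->
  weighted_integral (boundary D) = 0.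
Proof.
move=> hH SD; rewrite /weighted_integral (stokes iota weighted_covector_smooth SD).
rewrite (eq_chain_integral iota (J := fun=> 0) SD) => [|s Ss].
  by rewrite /chain_integral big1// => s _; rewrite mulr0.
rewrite -[RHS](integral2_0 s); apply/esym; apply: eq_integral2 Ss _ _.
  by apply: smooth_on_continuous; exact: smooth_on_cst.
by move=> x u v Sx Tu Tv; rewrite weighted_exterior_derivative// hH// subrr mul0r.
Qed.

Lemma weighted_integral_linear a (c d : chain R A 1) :
  weighted_integral (a *: c + d) = iota a * weighted_integral c + weighted_integral d.
Proof. exact: chain_integral_linear. Qed.

(** The minus sign in front of [H] cancels that of [boundary K = - Gamma], whence the plus sign of
    the primitive in [weighted_covector]. *)
Lemma weighted_integralE (Gamma : chain R A 1) (K : chain R A 2) :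
  chain_in Sigma Gamma -> fills M Gamma K ->
  chain_integral iota (integral1 (conormal_form M o nu Z)) Gamma -
  H * chain_integral iota (integral2 (flux_form M o Z)) K = weighted_integral Gamma.
Proof.
move=> SG [KM bK]; rewrite (stokes_flux iota o skL b0 ZL tZ KM) bK chain_integralN.
rewrite mulrN opprK conormal_formE /weighted_integral.
have sp : smooth_on Sigma signed_primitive.
  by apply: (smooth_smooth_on openT) => // k; exact: Ck_signed_primitive openT.
have sc : smooth_on Sigma (conormal_covector M o nu Z).
  move=> x Sx; have [N NE] := nuS.1 x Sx; exists (conormal_extension M o b L N).
  exact: conormal_extensionP.
rewrite [RHS](eq_chain_integral iota (J := fun s => H * integral1 (one_form signed_primitive) s +
  integral1 (one_form (conormal_covector M o nu Z)) s) SG); last first.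
  by move=> s Ss; exact: (integral1_linear H sp sc Ss).
rewrite /chain_integral mulr_sumr [LHS]addrC -big_split; apply: eq_bigr => s _ /=.
by rewrite mulrDr mulrCA.
Qed.

End WeightedCovector.

(** * Existence of fillings *)

Section Filling.
Context {R : realType} {A : comNzRingType}.
Local Notation E := 'rV[R]_4.

(** The curve is the radial projection of the line through [p] directed by [v]; the differential of
    the projection at [p] fixes tangent vectors. It exhibits [nu p] as a velocity in
    [proper_surface]. *)
Lemma model_tangent_space M (p v : E) : M <> Euclidean -> model M p ->
  model_tangent M p v -> tangent_space (model M) p v.
Proof.
move=> ME Mp Tv; rewrite /model_tangent /mkset ambient_normal_id// in Tv.
have oC : open (cone M : set E) := cone_open ME.
pose g (t : R) : E := p + t *: v.
have g0 : g 0 = p by rewrite /g scale0r addr0.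
have cg : continuous g by exact: affine_continuous.
have Cp := model_cone Mp; have Np := normalize_id Mp.
have oI : open (g @^-1` cone M) by apply: open_comp => // t _; exact: cg.
exists (g @^-1` cone M), (normalize M \o g); split.
- by split=> //; rewrite /= g0.
- move=> k; apply: Ck_comp (normalize_Ck k ME) => //; exact: Ck_affine_line.
- by move=> t; exact: normalize_in.
- by rewrite /= g0.
- have [/derivable1_diffP dg eg] := is_derive_affine p v 0.
  have dN : differentiable (normalize M) (g 0).
    by rewrite g0; exact: Ck_differentiable (normalize_Ck 1 ME) Cp.
  have := derive_comp (1 : R) dg dN; rewrite eg -[p + 0 *: v]/(g 0) g0 => ->.
  rewrite derive_normalize// Np Tv mulr0 scale0r subr0.
  have -> : radial_scale M p = 1; last by rewrite scale1r.
  have := ambient_normal_sqr Mp; rewrite ambient_normal_id// => e.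
  by rewrite /radial_scale /sq_norm e model_sign_sqr sqrtr1 invr1.
Qed.

Lemma proper_surface M (Sigma : set E) nu : M <> Euclidean -> unit_normal M Sigma nu ->
  Sigma `<=` model M -> exists2 p, model M p & ~ Sigma p.
Proof.
move=> ME nuS SM; apply: contrapT => none.
have MS p : model M p -> Sigma p.
  by move=> Mp; apply: contrapT => nSp; apply: none; exists p.
have Mp := model_basis_in (R := R) 0 ME; set p := row 0 _ in Mp.
have [Tn n1 nT] := nuS.2 p (MS p Mp).
have := nT (nu p) (tangent_spaceS MS (model_tangent_space ME Mp Tn)).
by rewrite n1 => /eqP; rewrite oner_eq0.
Qed.

Lemma filling_exists M (Sigma : set E) nu (Gamma : chain R A 1) :
  Sigma `<=` model M -> unit_normal M Sigma nu ->
  chain_in Sigma Gamma -> boundary Gamma = 0 -> exists K, fills M Gamma K.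
Proof.
move=> SM nuS SG bG.
have [q Mq XC] : exists2 q, model M q & forall x (t : R), Sigma x -> 0 <= t <= 1 ->
    cone M ((1 - t) *: x + t *: q).
  have seg (x q : E) (t : R) : (1 - t) *: x + t *: q = x + t *: (q - x).
    by rewrite scalerBr scalerBl scale1r addrAC addrA.
  have [MEu|ME] := pselect (M = Euclidean).
    rewrite MEu in SM *; exists 0; first by rewrite /model /= mxE.
    by move=> x t /SM; rewrite /model /= => x0 _; rewrite !mxE x0 !mulr0 addr0.
  have [q Mq qS] : exists2 q, model M q & forall x, Sigma x -> q != - x.
    have [p Mp nSp] := proper_surface ME nuS SM.
    (* On the sphere the apex is the antipode of a point missed by [Sigma]; on the hyperboloid two
       points are never antipodal, by the sign of the first coordinate. *)
    case: M ME SM Mp {nuS} => [/(_ erefl)//|_|_] SM Mp.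
      exists (- p); first by move: Mp; rewrite /model /= ipNl ipNr opprK.
      by move=> x Sx; rewrite eqr_opp; apply/eqP => px; apply: nSp; rewrite px.
    exists p => // x /SM[_ x0]; apply/eqP => px; case: Mp => _.
    by rewrite px mxE oppr_gt0 ltNge ltW.
  exists q => // x t Sx t01; rewrite seg.
  by apply: model_segment_cone => //; [exact: SM|exact: qS].
have SN x : Sigma x -> normalize M x = x by move=> /SM; exact: normalize_id.
have [K KM bK] := cone_filling (normalize_smooth (M := M)) XC (@normalize_in R M) SN
  (normalize_id Mq) (model_cone Mq) SG bG.
by exists K.
Qed.

End Filling.

(** * Integrals over the triangle of functions bounded away from zero *)

Section SimplexPositivity.
Context {R : realType}.
Local Notation mu := (@lebesgue_measure R).
Local Notation S2 := (stdsimplex R 2).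
Local Notation pt t u := (row_of 3 [:: 1 - t - u; t; u]).

Lemma Rintegral_itv_cst (a k : R) : 0 <= a -> \int[mu]_(t in `[0, a]) k = k * a.
Proof.
move=> a0; have -> := Rintegral_cst mu (measurable_itv `[0, a]) k; congr (_ * _).
apply: etrans (congr1 fine (lebesgue_measure_itv `[0, a])) _; rewrite /= lte_fin.
by case: ltP => [_|a_le0] /=; [rewrite subr0|apply/eqP; rewrite eq_le a0].
Qed.

(** By the substitution t -> 1 - t it equals the integral of t, and the two add up to 1. *)
Lemma Rintegral_onem : \int[mu]_(t in `[0, 1]) (1 - t) = 2^-1 :> R.
Proof.
have cid : {within `[0, 1], continuous (fun t : R => t)}.
  by apply: continuous_subspaceT => t; exact: cvg_id.
have c1B : {within `[0, 1], continuous (fun t : R => 1 - t)}.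
  by apply: continuous_subspaceT => t; apply: cvgB; [exact: cvg_cst|exact: cvg_id].
have e : \int[mu]_(t in `[0, 1]) t = \int[mu]_(t in `[0, 1]) (1 - t) :> R.
  by rewrite (Rintegration_by_substitution_onem _ cid) ?ler01 ?lexx// /unstable.onem subrr.
have : \int[mu]_(t in `[0, 1]) t + \int[mu]_(t in `[0, 1]) (1 - t) = 1 :> R.
  rewrite -RintegralD//; [|exact: continuous_itv_integrable..].
  under eq_Rintegral do rewrite addrC subrK.
  by rewrite Rintegral_itv_cst ?mul1r.
by rewrite e => h; lra.
Qed.

Lemma simplex_integral_ge (F : 'rV[R]_3 -> R) d : {within S2, continuous F} ->
  (forall x, S2 x -> d <= F x) ->
  d / 2 <= \int[mu]_(t in `[0, 1]) \int[mu]_(u in `[0, 1 - t]) F (pt t u).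
Proof.
move=> cF dF; have c1B : {within `[0, 1], continuous (fun t : R => d * (1 - t))}.
  apply: continuous_subspaceT => t; apply: cvgM; first exact: cvg_cst.
  by apply: cvgB; [exact: cvg_cst|exact: cvg_id].
have -> : d / 2 = \int[mu]_(t in `[0, 1]) (d * (1 - t)).
  rewrite RintegralZl ?Rintegral_onem//; apply: continuous_itv_integrable.
  by apply: continuous_subspaceT => t; apply: cvgB; [exact: cvg_cst|exact: cvg_id].
apply: le_Rintegral => //; first exact: continuous_itv_integrable.
  exact: simplex_outer_integrable.
move=> t /=; rewrite in_itv /= => /andP[t0 t1].
rewrite -Rintegral_itv_cst ?subr_ge0//; apply: le_Rintegral => //.
- by apply: continuous_itv_integrable; apply: continuous_subspaceT => u; exact: cvg_cst.
- exact: simplex_inner_integrable.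
move=> u /=; rewrite in_itv /= => /andP[u0 u1].
by apply: dF; apply: barycentric3_in => //; lra.
Qed.

Lemma simplex_integral_neq0 (F : 'rV[R]_3 -> R) d : {within S2, continuous F} ->
  0 < d -> (forall x, S2 x -> d <= F x) \/ (forall x, S2 x -> F x <= - d) ->
  \int[mu]_(t in `[0, 1]) \int[mu]_(u in `[0, 1 - t]) F (pt t u) != 0.
Proof.
move=> cF d0 [dF|dF].
  by rewrite gt_eqF//; apply: lt_le_trans (simplex_integral_ge cF dF); rewrite divr_gt0.
(* The negative case reduces to the positive one for [0 - F], a difference to which
   [simplex_integralB] applies. *)
have c0 : {within S2, continuous (fun=> 0 : R)}.
  by apply: smooth_on_continuous; exact: smooth_on_cst.
have cN : {within S2, continuous (fun x => 0 - F x)}.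
  apply/subspace_continuousP => x Sx; apply: cvgB; first exact: cvg_cst.
  by move/subspace_continuousP: cF; exact.
have := simplex_integralB c0 cF.
have int0 (D : set R) : \int[mu]_(t in D) (0 : R) = 0 by rewrite /Rintegral integral0.
under [X in _ = X - _ -> _]eq_Rintegral do rewrite int0.
rewrite int0 sub0r => e; rewrite -oppr_eq0 -e gt_eqF//.
apply: lt_le_trans (_ : 0 < d / 2) _; first by rewrite divr_gt0.
by apply: (simplex_integral_ge cN) => x /dF; rewrite sub0r lerNr.
Qed.

End SimplexPositivity.

(** * Small triangles in a chart *)

Section SmallTriangles.
Context {R : realType}.
Local Notation E := 'rV[R]_4.
Local Notation mu := (@lebesgue_measure R).
Local Notation S2 := (stdsimplex R 2).
Local Notation pt t u := (row_of 3 [:: 1 - t - u; t; u]).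
Context (U : set 'rV[R]_2) (X : 'rV[R]_2 -> E) (u w1 w2 : 'rV[R]_2) (e : R).

(** Its restriction to the simplex parametrizes the triangle with vertices [u], [u + e *: w1] and
    [u + e *: w2]; being defined on the whole coordinate space, it can be differentiated. *)
Definition triangle_map (x : 'rV[R]_3) : 'rV[R]_2 :=
  u + ((e * x 0 1) *: w1 + (e * x 0 2) *: w2).

Definition small_triangle : simplex R 2 := fun x => X (triangle_map (val x)).

Lemma triangle_map_Ck k : Ck setT k triangle_map.
Proof.
have oT := @openT 'rV[R]_3.
have Cx (i : 'I_3) (w : 'rV[R]_2) : Ck setT k (fun x : 'rV[R]_3 => (e * x 0 i) *: w).
  apply: CkZl => //; apply: (CkM oT (Ck_cst _ _ e)).
  by apply: (Ck_linmap setT k (f := @row_coord R 3 i)); exact: row_coord_continuous.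
exact: (CkD oT (Ck_cst _ _ u) (CkD oT (Cx 1 w1) (Cx 2 w2))).
Qed.

Lemma triangle_map_line (x : 'rV[R]_3) (h : R) :
  triangle_map (h *: (vertex3 1 - vertex3 0) + x) = h *: (e *: w1) + triangle_map x /\
  triangle_map (h *: (vertex3 2 - vertex3 0) + x) = h *: (e *: w2) + triangle_map x.
Proof.
have c (i : nat) (j : 'I_3) : (i < 3)%N -> (h *: (vertex3 i - vertex3 0) + x) 0 j =
    h * ((j == i :> nat)%:R - (j == 0%N :> nat)%:R) + x 0 j.
  by move=> i3; rewrite !mxE !eqxx -!val_eqE /= !inordK.
by split; rewrite /triangle_map !c//=; apply/rowP => j; rewrite !mxE; ring.
Qed.

(** The difference quotients on the two sides are the same function of the step. *)
Lemma derive_triangle_map x : 'D_(vertex3 1 - vertex3 0) (X \o triangle_map) x =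
    'D_(e *: w1) X (triangle_map x) /\
  'D_(vertex3 2 - vertex3 0) (X \o triangle_map) x = 'D_(e *: w2) X (triangle_map x).
Proof.
have line v w : (forall h : R, triangle_map (h *: v + x) = h *: w + triangle_map x) ->
    'D_v (X \o triangle_map) x = 'D_w X (triangle_map x).
  move=> vw; have e0 : (fun h : R => h^-1 *: ((X \o triangle_map \o shift x) (h *: v) -
      (X \o triangle_map) x)) = (fun h : R => h^-1 *: ((X \o shift (triangle_map x)) (h *: w) -
      X (triangle_map x))) by apply/funext => h; rewrite /= vw.
  by rewrite /derive e0.
by split; apply: line => h; have [] := triangle_map_line x h.
Qed.

Lemma small_triangle_extension Sigma : surface_chart Sigma U X ->
  (forall x, S2 x -> U (triangle_map x)) ->
  smooth_simplex_in Sigma small_triangle /\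
  (forall x, S2 x -> local_extension S2 ('valL_0 small_triangle) x (X \o triangle_map)).
Proof.
move=> [oU sX XS _] SU.
have cm : continuous triangle_map by move=> x; exact: (triangle_map_Ck 0).
have oP : open (triangle_map @^-1` U) by apply: open_comp => // x _; exact: cm.
have ext x : S2 x -> local_extension S2 ('valL_0 small_triangle) x (X \o triangle_map).
  move=> Sx; exists (triangle_map @^-1` U); split=> [|k|y Sy _].
  - by split=> //; exact: SU.
  - by apply: Ck_comp (sX k) => //; exact: CkW (triangle_map_Ck k).
  - by rewrite -[y in RHS]/(val (SigSub (mem_set Sy))) valL_set_val.
split=> //; split=> [x Sx|x]; first by exists (X \o triangle_map); exact: ext.
by apply/XS/SU; have := valP x; rewrite inE.
Qed.

End SmallTriangles.

(** * From vanishing integrals to a vanishing 2-form *)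

Section TwoFormAtPoint.
Context {R : realType}.
Local Notation E := 'rV[R]_4.
Local Notation mu := (@lebesgue_measure R).
Local Notation S2 := (stdsimplex R 2).
Local Notation pt t u := (row_of 3 [:: 1 - t - u; t; u]).

(** Were [G u] nonzero, [G] would keep its sign and stay at distance at least |G u| / 2 from 0 on a
    small triangle at [u], over which the integral of [beta] is that of [e * e * G]. The assumption
    on multiples of the two directions serves the velocities of the triangle, which carry the factor
    [e]. *)
Lemma two_form_vanishes (Sigma : set E) U X (u w1 w2 : 'rV[R]_2)
    (beta : E -> E -> E -> R) (G : 'rV[R]_2 -> R) (V : set 'rV[R]_2) :
  surface_chart Sigma U X -> open V -> V `<=` U -> V u ->
  (forall y, V y -> {for y, continuous G}) ->
  (forall y a c, V y -> beta (X y) (a *: 'D_w1 X y) (c *: 'D_w2 X y) = a * c * G y) ->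
  (forall s, smooth_simplex_in Sigma s -> integral2 beta s = 0) -> G u = 0.
Proof.
move=> cX oV VU Vu cG bG int0; apply: contrapT => /eqP Gu.
pose d := `|G u| / 2; have d0 : 0 < d by rewrite divr_gt0 ?normr_gt0.
have nN : nbhs u (V `&` [set y | `|G u - G y| < d]).
  apply: filterI; first exact: open_nbhs_nbhs.
  by have /cvgr_dist_lt := cG u Vu; apply.
have [e e0 eN] : exists2 e : R, 0 < e & forall x, S2 x ->
    (V `&` [set y | `|G u - G y| < d]) (triangle_map u w1 w2 e x).
  have [e e0 eN] := parallelogram_nbhs w1 w2 nN; exists e => // x [x0 x1].
  have coord i : 0 <= e * x 0 i <= e.
    apply/andP; split; first exact: mulr_ge0 (ltW e0) (x0 i).
    by rewrite ler_piMr ?(ltW e0)// -x1 (bigD1 i)//= lerDl sumr_ge0.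
  by rewrite /triangle_map addrA; exact: eN.
have [oU sX XS iX] := cX.
have [sS ext] := small_triangle_extension cX (fun x Sx => VU _ (eN x Sx).1).
pose F (x : 'rV[R]_3) := e * e * G (triangle_map u w1 w2 e x).
have cF : {within S2, continuous F}.
  apply/subspace_continuousP => x Sx; apply: cvgM; first exact: cvg_cst.
  have cm : {for x, continuous (triangle_map u w1 w2 e)} by exact: (triangle_map_Ck u w1 w2 e 0).
  have cGm : {for x, continuous (G \o triangle_map u w1 w2 e)}.
    by apply: continuous_comp cm _; exact: cG (eN x Sx).1.
  by apply: cvg_trans cGm; apply: cvg_app; exact: cvg_within.
have := int0 _ sS; apply/eqP.
have -> : integral2 beta (small_triangle X u w1 w2 e) =
    \int[mu]_(t in `[0, 1]) \int[mu]_(u in `[0, 1 - t]) F (pt t u).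
  rewrite /integral2 row_of3_1 row_of3_2; apply: eq_Rintegral_itv => t /andP[t0 t1].
  apply: eq_Rintegral_itv => v /andP[v0 v1].
  have Sx : S2 (pt t v) by apply: barycentric3_in => //; lra.
  set x := pt t v in Sx *; have cS := @stdsimplex_convex R 2.
  have [D1 D2] := derive_triangle_map X u w1 w2 e x.
  have Vx := (eN x Sx).1; have dX : differentiable X (triangle_map u w1 w2 e x).
    by apply: Ck_differentiable (sX 1%N) _; exact: VU.
  have E1 := etrans (derive_along_convex cS Sx (vertex3_in 1) (vertex3_in 0) (ext x Sx))
    (etrans D1 (derive_dirZ e w1 dX)).
  have E2 := etrans (derive_along_convex cS Sx (vertex3_in 2) (vertex3_in 0) (ext x Sx))
    (etrans D2 (derive_dirZ e w2 dX)).
  have fx : 'valL_0 (small_triangle X u w1 w2 e) x = X (triangle_map u w1 w2 e x).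
    by rewrite -[x in LHS]/(val (SigSub (mem_set Sx))) valL_set_val.
  rewrite -/x; apply: etrans (bG _ e e Vx).
  by rewrite -E1 -E2 fx.
have ee : 0 < e * e by exact: mulr_gt0.
apply: (simplex_integral_neq0 cF (mulr_gt0 ee d0)).
have near x : S2 x -> `|G u - G (triangle_map u w1 w2 e x)| < d by move=> /eN[].
have [G0|G0] := ltrP 0 (G u); [left|right] => x /near; rewrite /F.
  rewrite ler_pM2l// /d (gtr0_norm G0) ltr_norml => /andP[_]; lra.
rewrite -mulrN ler_pM2l// /d (ler0_norm G0) ltr_norml => /andP[]; lra.
Qed.

End TwoFormAtPoint.

(** * Curvature at a point where the Killing field is normal *)

Section CurvatureAtPoint.
Context {R : realType}.
Local Notation E := 'rV[R]_4.
Context (M : spaceform) (o : bool) (Sigma : set E) (nu : E -> E).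
Context (SM : Sigma `<=` model M) (eS : embedded_surface Sigma)
  (nuS : unit_normal M Sigma nu).
Context (H : R) (b : E) (L : 'M[R]_4) (Z : E -> E).
Context (skL : skew M L) (b0 : M <> Euclidean -> b = 0)
  (ZL : forall x, model M x -> Z x = b + x *m L)
  (tZ : forall x, model M x -> model_tangent M x (Z x)).

Lemma exterior_scale (F : E -> E) (x v w : E) a c : differentiable F x ->
  exterior F x (a *: v) (c *: w) = a * c * exterior F x v w.
Proof.
move=> dF; rewrite /exterior (derive_dirZ a v dF) (derive_dirZ c w dF).
move: ('D_v F x) ('D_w F x) => p q; rewrite !dotvZl !dotvZr.
have scale (r t : R) : a * (c * r) - c * (a * t) = a * c * (r - t) by ring.
exact: scale.
Qed.

Lemma dotv_derive_sum (F : E -> E) (x v w : E) : differentiable F x ->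
  dotv ('D_v F x) w = \sum_i v 0 i * dotv ('D_(delta_mx 0 i) F x) w.
Proof.
move=> dF; rewrite (derive_rV_sum _ dF); elim: (index_enum _) => [|i r IH].
  by rewrite !big_nil -(scale0r (0 : E)) dotvZl mul0r.
by rewrite !big_cons dotvDl dotvZl IH.
Qed.

(** The directions vary with the point, so the derivatives of [F] are first expanded along the fixed
    basis of the ambient space. *)
Lemma Ck_exterior_chart (V : set 'rV[R]_2) (U : set E) (X v w : 'rV[R]_2 -> E) F k :
  open V -> open U -> (forall y, V y -> U (X y)) -> Ck V k X -> Ck V k v -> Ck V k w ->
  Ck U k.+1 F -> Ck V k (fun y => exterior F (X y) (v y) (w y)).
Proof.
move=> oV oU VU CX Cv Cw CF.
have half (v' w' : 'rV[R]_2 -> E) : Ck V k v' -> Ck V k w' ->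
    Ck V k (fun y => dotv ('D_(v' y) F (X y)) (w' y)).
  move=> Cv' Cw'; apply: (eq_Ck oV (f := \sum_i (fun y => v' y 0 i) *
      (fun y => dotv ('D_(delta_mx 0 i) F (X y)) (w' y)))).
    move=> y Vy; rewrite fct_sumE (dotv_derive_sum (v' y)) //.
    exact: Ck_differentiable CF (VU y Vy).
  apply: Ck_sum => // i _; apply: CkM => //; first exact: Ck_coord.
  apply: Ck_dotv => //; exact: Ck_comp oV oU VU CX (Ck_derive _ CF).
have := Ck_linear (-1) oV (half w v Cw Cv) (half v w Cv Cw).
apply: (eq_Ck oV) => y _; rewrite !fctE scaleN1r addrC.
by [].
Qed.

(** On an orthonormal frame at [p] the vanishing 2-form takes the value, up to sign, of [H] minus
    the mean curvature, times the determinant of the ambient normal, [nu p] and the frame, which is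
    not 0. *)
Lemma curvature_at p : Sigma p -> Z p = nu p ->
  (forall s, smooth_simplex_in Sigma s ->
    integral2 (exterior_derivative Sigma (weighted_covector M o nu H b L Z)) s = 0) ->
  mean_curvature M Sigma nu p = H.
Proof.
move=> Sp Zp int0; have [U [X [u [cX Uu Xu]]]] := surface_chart_at eS Sp.
have [oU sX XS iX] := cX; have [w1 [w2 fr]] := chart_frame SM cX Uu.
have [N NE] := nuS.1 p Sp; have [UN [[oN Np] sN eN]] := NE.
pose W := weighted_extension M o H b L N.
have CW k : Ck UN k W.
  apply: Ck_linear => //; first exact: Ck_signed_primitive.
  exact: Ck_conormal_extension.
pose V := U `&` X @^-1` UN; have oV : open V by exact: open_preimage_in oU oN (sX 0%N).
have VU y : V y -> U y by case.
have VN y : V y -> UN (X y) by case.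
have CX k : Ck V k X by exact: CkW (sX k).
have NV y : V y -> local_extension Sigma nu (X y) N by move=> [_ Ny]; exists UN.
pose G y := exterior W (X y) ('D_w1 X y) ('D_w2 X y).
have CG : Ck V 0 G.
  exact: Ck_exterior_chart oV oN VN (CX 0%N) (Ck_derive _ (CX 1%N)) (Ck_derive _ (CX 1%N)) (CW 1%N).
have Vu : V u by split=> //; rewrite /= Xu.
have bG y a c : V y -> exterior_derivative Sigma (weighted_covector M o nu H b L Z)
    (X y) (a *: 'D_w1 X y) (c *: 'D_w2 X y) = a * c * G y.
  move=> Vy; have Uy := VU y Vy; have Sy := XS y Uy.
  have dX : differentiable X y by exact: Ck_differentiable (sX 1%N) Uy.
  have Tw k w : tangent_space Sigma (X y) (k *: 'D_w X y).
    by have := chart_tangent (k *: w) cX Uy; rewrite derive_dirZ.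
  rewrite (exterior_derivativeE (weighted_extensionP o SM H ZL Sy (NV y Vy)) (Tw _ _) (Tw _ _)).
  apply: exterior_scale; exact: Ck_differentiable (CW 1%N) (VN y Vy).
have := two_form_vanishes cX oV VU Vu CG bG int0.
have [t1 t2 _ _ _] := fr; rewrite /= Xu in t1 t2.
rewrite /G Xu (weighted_exterior o SM eS nuS H skL b0 ZL tZ Sp NE t1 t2).
move=> /eqP; rewrite mulf_eq0 => /orP[|]; first by rewrite subr_eq0 => /eqP.
rewrite /flux_form volE mulf_eq0 signr_eq0 Zp /=.
rewrite Xu in fr; have := orthonormal_basis_det (orthonormal_frame_basis SM nuS Sp fr).
rewrite /= (det4C34 _ _ (nu p)) (det4C23 _ (nu p)) opprK => /negbTE det0 /eqP.
by move=> /eqP; rewrite det0.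
Qed.

End CurvatureAtPoint.

(** * Killing fields with a prescribed value *)

Section KillingAtPoint.
Context {R : realType}.
Local Notation E := 'rV[R]_4.

(* The witness is the translation by [w], or the rotation of the plane spanned by
   [p] and [w]. *)
Lemma killing_at M (p w : E) : model M p -> model_tangent M p w ->
  exists Y : killing_field R M, 'valL_0 (Y : model M -> E) p = w.
Proof.
move=> Mp Tw; have [MEu|ME] := pselect (M = Euclidean).
  subst M; have [|x Mx|Y YE] := @killing_of_affine R Euclidean w 0.
  - by move=> u v; rewrite !mulmx0 ip0l ip0r addr0.
  - by rewrite mulmx0 addr0; exact: Tw.
  - by exists Y; rewrite YE// mulmx0 addr0.
rewrite /model_tangent /mkset ambient_normal_id// in Tw.
(* The factor [model_sign M] compensates <p, p>, so that [p *m L = w] on the hyperboloid as well. *)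
pose L : 'M[R]_4 := model_sign M *: (gram M *m (p^T *m w - w^T *m p)).
have LE (x : E) : x *m L = model_sign M *: (ip M x p *: w - ip M x w *: p).
  have mxE1 (A B : E) : x *m gram M *m (A^T *m B) = ip M x A *: B.
    by rewrite mulmxA [x *m _ *m _]mx11_scalar -ip_mx mul_scalar_mx.
  by rewrite /L -scalemxAr mulmxA mulmxBr !mxE1.
have [u v|x Mx|Y YE] := @killing_of_affine R M 0 L.
- rewrite !LE !ipZl !ipZr !(ipBl, ipBr, ipZl, ipZr) (ipC M w v) (ipC M p v); ring.
- rewrite add0r /model_tangent /mkset ambient_normal_id// LE ipZr ipBr !ipZr.
  by rewrite (mulrC (ip M x w)) subrr mulr0.
exists Y; rewrite YE// add0r LE Tw scale0r subr0 scalerA.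
have := ambient_normal_sqr Mp; rewrite ambient_normal_id// => ->.
by rewrite model_sign_sqr scale1r.
Qed.

End KillingAtPoint.

(** * The flux as a function of the cycle and of the Killing field *)

Section WeightedFlux.
Context {R : realType} {A : comNzRingType} (iota : {rmorphism A -> R}).
Local Notation E := 'rV[R]_4.
Context (M : spaceform) (o : bool) (Sigma : set E) (nu : E -> E) (H : R).
Context (SM : Sigma `<=` model M) (eS : embedded_surface Sigma)
  (nuS : unit_normal M Sigma nu).
Implicit Types (Y : killing_field R M) (b : E) (L : 'M[R]_4).

(** A relation, because [b] and [L] come from an existence statement. The integrals below take them
    as parameters and are tied to [Y] alone by [killing_integralE]. *)
Definition affine_form Y b L := [/\ skew M L, M <> Euclidean -> b = 0 &
  forall x, model M x -> 'valL_0 (Y : model M -> E) x = b + x *m L].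

Lemma affine_form_exists Y : exists b L, affine_form Y b L.
Proof. by have [b [L [skL YL b0]]] := killing_affine Y; exists b, L. Qed.

Definition killing_covector Y b L : E -> E :=
  weighted_covector M o nu H b L ('valL_0 (Y : model M -> E)).

Definition killing_integral Y b L (Gamma : chain R A 1) : R :=
  chain_integral iota (integral1 (one_form (killing_covector Y b L))) Gamma.

Lemma killing_covector_smooth Y b L : affine_form Y b L ->
  smooth_on Sigma (killing_covector Y b L).
Proof. by move=> [_ _ YL]; exact: (weighted_covector_smooth o SM nuS H YL). Qed.

Lemma killing_integralE Y b L (Gamma : chain R A 1) K : affine_form Y b L ->
  chain_in Sigma Gamma -> fills M Gamma K ->
  weighted_flux iota M o nu H Gamma K Y = killing_integral Y b L Gamma.
Proof.
move=> [skL b0 YL] SG GK; have [_ tY _] := killing_fieldP Y.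
exact: (weighted_integralE iota o SM nuS H skL b0 YL tY SG GK).
Qed.

Lemma covector3_linear2 a (v w d : E) (k : R) :
  covector3 a (k *: v + w) d = k *: covector3 a v d + covector3 a w d.
Proof. by apply/rowP => i; rewrite !mxE det4D2 det4Z2. Qed.

Lemma scale2_linear (k c d : R) (p q r t : E) :
  c *: (k *: p + q) + d *: (k *: r + t) = k *: (c *: p + d *: r) + (c *: q + d *: t).
Proof. by apply/rowP => i; rewrite !mxE; ring. Qed.

(** Linearity in the affine data is what makes omega linear in the Killing field. *)
Lemma flux_primitive_linear k b b' L L' x :
  flux_primitive M (k *: b + b') (k *: L + L') x =
  k *: flux_primitive M b L x + flux_primitive M b' L' x.
Proof.
have mulL (y : E) : y *m (k *: L + L') = k *: (y *m L) + y *m L'.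
  by rewrite mulmxDr scalemxAr.
have lin (a : R) (p q : E) : a *: (k *: p + q) = k *: (a *: p) + a *: q.
  by rewrite scalerDr !scalerA mulrC.
rewrite /flux_primitive; case: M; rewrite ?fct_sumE.
- apply: etrans (_ : _ = - 2^-1 *: covector3 (delta_mx 0 0) (k *: b + b') x +
    - 3^-1 *: covector3 (delta_mx 0 0) (x *m (k *: L + L')) x) _; first by [].
  by rewrite mulL !covector3_linear2; exact: scale2_linear.
- rewrite scaler_sumr -big_split; apply: eq_bigr => i _ /=.
  by rewrite mulL covector3_linear2 lin.
- rewrite scaler_sumr -big_split; apply: eq_bigr => i _ /=.
  by rewrite mulL covector3_linear2 lin.
Qed.

Lemma signed_primitive_linear k b b' L L' x :
  signed_primitive M o (k *: b + b') (k *: L + L') x =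
  k *: signed_primitive M o b L x + signed_primitive M o b' L' x.
Proof.
apply: etrans (congr1 (fun z : E => (-1) ^+ o *: z) (flux_primitive_linear k b b' L L' x)) _.
by rewrite scalerDr !scalerA mulrC -scalerA.
Qed.

Lemma killing_valL_linear k Y Y' x :
  'valL_0 ((k *: Y + Y' : killing_field R M) : model M -> E) x =
  k *: 'valL_0 (Y : model M -> E) x + 'valL_0 (Y' : model M -> E) x.
Proof.
have -> : ((k *: Y + Y' : killing_field R M) : model M -> E) =
    k *: (Y : model M -> E) + (Y' : model M -> E) by exact: (linearP \val).
by rewrite valL_linear.
Qed.

Lemma affine_form_linear k Y Y' b b' L L' : affine_form Y b L -> affine_form Y' b' L' ->
  affine_form (k *: Y + Y') (k *: b + b') (k *: L + L').
Proof.
move=> [sk b0 YL] [sk' b0' YL']; split=> [u v|ME|x Mx].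
- rewrite !mulmxDr -!scalemxAr !(ipDl, ipDr, ipZl, ipZr).
  have := sk u v; have := sk' u v; move: (ip M _ _) (ip M _ _) (ip M _ _) (ip M _ _).
  move=> p q r t e e'; have -> : k * q + t + (k * p + r) = k * (q + p) + (t + r) by ring.
  by rewrite e e' mulr0 addr0.
- by rewrite b0// b0'// scaler0 addr0.
- rewrite killing_valL_linear YL// YL'//.
  by rewrite scalerDr mulmxDr -scalemxAr addrACA.
Qed.

Lemma killing_integral_linear k Y Y' b b' L L' (Gamma : chain R A 1) :
  affine_form Y b L -> affine_form Y' b' L' -> chain_in Sigma Gamma ->
  killing_integral (k *: Y + Y') (k *: b + b') (k *: L + L') Gamma =
  k * killing_integral Y b L Gamma + killing_integral Y' b' L' Gamma.
Proof.
move=> fY fY' SG; rewrite /killing_integral.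
have -> : killing_covector (k *: Y + Y') (k *: b + b') (k *: L + L') =
    fun x => k *: killing_covector Y b L x + killing_covector Y' b' L' x.
  apply/funext => x; rewrite /killing_covector /weighted_covector /conormal_covector.
  apply: etrans (f_equal2 (fun p q : E => H *: p + (-1) ^+ o *: q)
    (signed_primitive_linear k b b' L L' x)
    (etrans (congr1 (fun z => covector3 _ z _) (killing_valL_linear k Y Y' x))
      (covector3_linear2 _ _ _ _ _))) _.
  exact: scale2_linear.
rewrite (eq_chain_integral iota (J := fun s =>
    k * integral1 (one_form (killing_covector Y b L)) s +
    integral1 (one_form (killing_covector Y' b' L')) s) SG); last first.
  move=> s Ss; apply: integral1_linear Ss; exact: killing_covector_smooth.
rewrite /chain_integral mulr_sumr -big_split; apply: eq_bigr => s _ /=.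
by rewrite mulrDr mulrCA.
Qed.

Lemma smooth_cycleP (c : smooth_cycle A Sigma) :
  chain_in Sigma (c : chain R A 1) /\ boundary (c : chain R A 1) = 0.
Proof. by case: c => c /= /asboolP. Qed.

Lemma homologousP (c c' : smooth_cycle A Sigma) :
  homology_class c = homology_class c' :> homology1 A Sigma <->
  exists2 d : chain R A 2, chain_in Sigma d & boundary d = (c : chain R A 1) - (c' : chain R A 1).
Proof.
split=> [/eqP|[d Sd bd]].
  by rewrite -Quotient.idealrBE => /asboolP.
by apply/eqP; rewrite -Quotient.idealrBE; apply/asboolP; exists d.
Qed.

Lemma killing_integral_homologous Y b L (c c' : smooth_cycle A Sigma) :
  (forall p, Sigma p -> mean_curvature M Sigma nu p = H) -> affine_form Y b L ->
  homology_class c = homology_class c' :> homology1 A Sigma ->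
  killing_integral Y b L c = killing_integral Y b L c'.
Proof.
move=> hH [skL b0 YL] /homologousP[d Sd bd]; have [_ tY _] := killing_fieldP Y.
have := weighted_integral_boundary iota o SM eS nuS skL b0 YL tY hH Sd.
rewrite bd -[X in X - _]scale1r addrC -scaleN1r weighted_integral_linear rmorphN1 mulN1r.
by rewrite scale1r => /eqP; rewrite addrC subr_eq0 => /eqP.
Qed.

Lemma curvature_of_well_defined (c : homology1 A Sigma) :
  flux_well_defined iota M o nu H c ->
  forall p, Sigma p -> mean_curvature M Sigma nu p = H.
Proof.
move=> wd p Sp; have [Tn _ _] := nuS.2 p Sp.
have [Y Yp] := killing_at (SM Sp) Tn; have [b [L fY]] := affine_form_exists Y.
have [skL b0 YL] := fY; have [_ tY _] := killing_fieldP Y.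
have [G cG] := homology_classP c; have [SG bG] := smooth_cycleP G.
have [K GK] := filling_exists SM nuS SG bG.
apply: (curvature_at (o := o) SM eS nuS skL b0 YL tY Sp Yp) => s Ss.
have Ss' : chain_in Sigma (<< s >> : chain R A 2) := chain_inU Ss.
have bP : boundary (<< s >> : chain R A 2) \in cycle_pred Sigma.
  by apply/asboolP; split; [exact: boundary_in|exact: boundary_boundary].
pose B : smooth_cycle A Sigma := SmoothCycle bP.
(* The sum is written [1 *: B + G] to fit the linearity statements for chains and integrals. This
   cycle needs a filling of its own before the hypothesis can compare it with [G]. *)
have [SG' bG'] := smooth_cycleP (1 *: B + G).
have [K' GK'] := filling_exists SM nuS SG' bG'.
have cG' : homology_class (1 *: B + G) = c.
  rewrite cG; apply/homologousP; exists << s >> => //.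
  by rewrite scale1r; exact: esym (addrK (G : chain R A 1) (boundary << s >>)).
have := wd Y G (1 *: B + G) K K' (esym cG) cG' GK GK'.
rewrite (killing_integralE fY SG GK) (killing_integralE fY SG' GK').
rewrite [RHS](weighted_integral_linear iota M o nu H b L _ 1 B G) rmorph1 mul1r.
move=> /eqP; rewrite -subr_eq0 opprD addrCA subrr addr0 oppr_eq0 => /eqP.
rewrite /weighted_integral (stokes iota (killing_covector_smooth fY) Ss').
by rewrite chain_integralU.
Qed.

End WeightedFlux.

(** * The linear function on homology, and the converse *)

Theorem theorem2p1 (R : realType) (A : comNzRingType)
    (iota : {rmorphism A -> R}) (M : spaceform) (o : bool)
    (Sigma : set 'rV[R]_4) (nu : 'rV[R]_4 -> 'rV[R]_4) :
  Sigma `<=` model M -> connected Sigma -> embedded_surface Sigma ->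
  unit_normal M Sigma nu ->
  (forall H : R,
     (forall p, Sigma p -> mean_curvature M Sigma nu p = H) ->
     (forall c : homology1 A Sigma, flux_well_defined iota M o nu H c) /\
     (exists omega : homology1 A Sigma -> {linear killing_field R M -> R^o},
        (forall (a : A) c c' Y,
           omega (a *: c + c') Y = iota a * omega c Y + omega c' Y) /\
        (forall Gamma : smooth_cycle A Sigma,
           (exists K, fills M Gamma K) /\
           (forall K Y, fills M Gamma K ->
              omega (homology_class Gamma) Y =
              weighted_flux iota M o nu H Gamma K Y)))) /\
  (forall (H : R) (c : homology1 A Sigma),
     flux_well_defined iota M o nu H c ->
     exists H' : R, forall p, Sigma p -> mean_curvature M Sigma nu p = H').
Proof.
move=> SM _ eS nuS; split=> [H hH|H c wd]; last first.
  by exists H; exact: curvature_of_well_defined wd.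
have fillE (G : smooth_cycle A Sigma) : exists K, fills M (G : chain R A 1) K.
  by have [SG bG] := smooth_cycleP G; exact: filling_exists SM nuS SG bG.
split.
  move=> c Y G G' K K' cG cG' GK GK'; have [b [L fY]] := affine_form_exists Y.
  rewrite (killing_integralE iota o H SM nuS fY (smooth_cycleP G).1 GK).
  rewrite (killing_integralE iota o H SM nuS fY (smooth_cycleP G').1 GK').
  by apply: killing_integral_homologous; rewrite ?cG.
(* [omega] uses one chosen filling of one chosen representative of each class; [omega_class] then
   gives its value on every representative. *)
have [K KE] := choice fillE.
pose omega (c : homology1 A Sigma) (Y : killing_field R M) : R^o :=
  weighted_flux iota M o nu H (repr c : smooth_cycle A Sigma)
    (K (repr c : smooth_cycle A Sigma)) Y.
have omegaE c Y b L : affine_form Y b L ->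
    omega c Y = killing_integral iota o nu H Y b L (repr c : smooth_cycle A Sigma).
  by move=> fY; exact: (killing_integralE iota o H SM nuS fY (smooth_cycleP _).1 (KE _)).
have omega_linear c : linear (omega c).
  move=> k Y Y'; have [b [L fY]] := affine_form_exists Y.
  have [b' [L' fY']] := affine_form_exists Y'.
  (* For the combination of the two fields the affine data are the same combination of theirs, so
     that both sides are integrals over one cycle of forms depending linearly on these data. *)
  rewrite (omegaE _ _ _ _ (affine_form_linear k fY fY')) (omegaE _ _ _ _ fY).
  rewrite (omegaE _ _ _ _ fY').
  exact: (killing_integral_linear iota o H SM nuS k fY fY' (smooth_cycleP _).1).
have omega_class (G : smooth_cycle A Sigma) Y b L : affine_form Y b L ->
    omega (homology_class G) Y = killing_integral iota o nu H Y b L G.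
  move=> fY; rewrite (omegaE _ _ _ _ fY); apply: killing_integral_homologous => //.
  exact: reprK.
exists (fun c => HB.pack_for {linear killing_field R M -> R^o} (omega c)
  (GRing.isLinear.Build R (killing_field R M) R^o *:%R (omega c) (omega_linear c))).
split=> [a c c' Y|G].
  have [b [L fY]] := affine_form_exists Y.
  have [g ->] := homology_classP c; have [g' ->] := homology_classP c'.
  rewrite /= [a *: _]homology_class_scale -homology_classD !(omega_class _ _ _ _ fY).
  exact: chain_integral_linear.
split=> [|K' Y GK]; first exact: fillE.
have [b [L fY]] := affine_form_exists Y; rewrite /= (omega_class _ _ _ _ fY).
by apply/esym; exact: (killing_integralE iota o H SM nuS fY (smooth_cycleP _).1 GK).
Qed.
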